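(* Let $(f,\Lambda)$ be a pregeneric pair on $[0,L]$, and consider the magnetic geodesic flow $S(f,\Lambda)$ on the sphere $M$. Then the types of its critical circles are determined as follows. 1. For any $r\in(0,L)$ with $f'(r)\ne 0$, the following conditions are equivalent: (a) the critical orbit $\mathcal{O}_{r,k(r)}$ from the family $\mathcal{C}_1^k$ is non-degenerate; (b) $U''_{k(r)}(r)\neq 0$ (the second derivative in $r$ of the function $U_k$, taken with $k$ fixed and then evaluated at $k=k(r)$); (c) $k'(r)\Lambda'(r)\neq 0$; (d) $(f'(r)\Lambda''(r)-f''(r)\Lambda'(r))\Lambda'(r)\ne 0$. If $U''_{k(r)}(r)>0$ then the critical circle $\mathcal{O}_{r,k(r)}$ has elliptic type, and if $U''_{k(r)}(r)<0$ then it is hyperbolic; in this case $$\operatorname{sgn}U''_{k(r)}(r)=\operatorname{sgn}(-k'(r)\Lambda'(r))=\operatorname{sgn}\big((f'(r)\Lambda''(r)-f''(r)\Lambda'(r))\Lambda'(r)\big).$$ 2. Any critical orbit $\mathcal{O}_{r,\Lambda(r)}$ contained in $\mathcal{C}_1^\Lambda\setminus(\mathcal{C}_1^\Lambda\cap\mathcal{C}_1^k)$ is non-degenerate and has elliptic type. 3. If moreover $(f,\Lambda)$ is generic, then degenerate critical circles $\mathcal{O}_{r,k(r)}$ of the family $\mathcal{C}_1^k$ can be of one of the following two types: (i) a parabolic circle, when $r\in I$ satisfies $f'(r)\Lambda''(r)-f''(r)\Lambda'(r)=0$ (an inflection point of the planar curve $(f,\Lambda)$); its image under the momentum mapping $\mathcal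 F$ is an ordinary cusp point (of semi-cubic parabola type) of the bifurcation curve $\gamma_1$, and the germ of the Liouville foliation at this degenerate orbit has the type ''parabolic orbit''; (ii) a critical orbit contained in both families $\mathcal{C}_1^k$ and $\mathcal{C}_1^\Lambda$, when $r\in I\cap(0,L)$ satisfies $\Lambda'(r)=0$ (a point of the curve $(f,\Lambda)$ with a horizontal tangent); its image under the momentum mapping is a tangency point of the bifurcation curves $\gamma_1$ and $\gamma_2$, and the germ of the Liouville foliation at this degenerate orbit $\mathcal{O}_{r,\Lambda(r)}$ is of the type ''asymmetric elliptic fork''.
   Context: Generic pairs. Fix $L>0$. A pair of $C^\infty$ functions $f,\Lambda:[0,L]\to\mathbb R$ is called here pregeneric if: (1) $f>0$ on $(0,L)$ and $f$ extends to a smooth odd $2L$-periodic function on $\mathbb R$; (2) $\Lambda$ extends to a smooth even $2L$-periodic function on $\mathbb R$; (3) $f'(0)=1$, $f'(L)=-1$; (4) $f$ and $\Lambda$ are Morse functions (all critical points on $[0,L]$, endpoints included, are non-degenerate); (5) $(\Lambda'(r))^2+(f'(r))^2>0$ on $[0,L]$. It is called generic if in addition (6) the function $f'\Lambda''-f''\Lambda'$ has only simple zeros. The system. $M$ is a 2-sphere with poles $N$ ($r=0$) and $S$ ($r=L$), with coordinates $(r,\varphi)\in(0,L)\times\mathbb R/2\pi\mathbb Z$ on $M\setminus\{N,S\}$, with the Riemannian metric $ds^2=dr^2+f^2(r)d\varphi^2$ and the closed 2-form $\beta=\Lambda'(r)dr\wedge d\varphi$, both extending smoothly to $M$. The magnetic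 geodesic flow $S(f,\Lambda)$ is the Hamiltonian system on $T^*M$ given (over $M\setminus\{N,S\}$, and extended by continuity to $T^*M$) by $$H=\frac{p_r^2}{2}+\frac{p_\varphi^2}{2f^2(r)},\qquad \widetilde\omega=dp_r\wedge dr+dp_\varphi\wedge d\varphi+\Lambda'(r)dr\wedge d\varphi .$$ It has the additional first integral $K=p_\varphi+\Lambda(r)$, whose Hamiltonian flow is $2\pi$-periodic. The momentum mapping is $\mathcal F=(H,K):T^*M\to\mathbb R^2$ (values denoted $(h,k)$). The rank of a point is the rank of $d\mathcal F$ there; points of rank $<2$ are critical (singular). The Liouville foliation is the decomposition of $T^*M$ into connected components of the level sets of $\mathcal F$. Notation. $\{r_i\}$ is the set of critical points of $f$ on $[0,L]$ and $I=[0,L]\setminus\{r_i\}$. In the coordinates $(p_r,K,r,\varphi)$, $\mathcal{O}_{\rho,\kappa}=\{p_r=0,\ K=\kappa,\ r=\rho,\ \varphi\in\mathbb R/2\pi\mathbb Z\}$. For $r\in I$ put $k(r)=\Lambda(r)-f(r)\frac{\Lambda'(r)}{f'(r)}$ and $h(r)=\frac12\left(\frac{\Lambda'(r)}{f'(r)}\right)^2$. The two families of rank-1 critical circles are $\mathcal{C}_1^k=\bigcup_{r\in I\cap(0,L)}\mathcal{O}_{r,k(r)}$ and $\mathcal{C}_1^\Lambda=\bigcup_{r\in(0,L)}\mathcal{O}_{r,\Lambda(r)}$; their images under $\mathcal F$ are the bifurcation curves $\gamma_1=\{(h(r),k(r)):r\in I\cap(0,L)\}$ and $\gamma_2=\{(0,\Lambda(r)):r\in(0,L)\}$.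 The effective potential is $U_k(r)=\frac{(k-\Lambda(r))^2}{2f^2(r)}$. Non-degeneracy. A rank-1 point $x$, with $\alpha\,dH+\beta\,dK=0$ at $x$, $(\alpha,\beta)\ne(0,0)$, is non-degenerate if the linearization at $x$ of the Hamiltonian vector field of $\alpha H+\beta K$ induces an invertible operator on $W^{\perp}/W$, where $W$ is the line spanned by the Hamiltonian vector fields of $H,K$ at $x$ and $W^\perp$ is its $\widetilde\omega$-orthogonal complement. It is elliptic (respectively hyperbolic) if the eigenvalues of this operator are purely imaginary (respectively real). An orbit is non-degenerate, elliptic or hyperbolic if its points are. Degenerate types. A critical circle is parabolic (its germ has type ''parabolic orbit'') if in a neighbourhood of it there are coordinates $(p_1,p_2,q_1,q_2)$, with $(p_1,p_2,q_1)$ in a 3-disc $D^3$ and $q_2\in\mathbb R/2\pi\mathbb Z$, in which the circle is $p_1=p_2=q_1=0$ and the Liouville foliation is given by the functions $2\widetilde H=p_1^2+q_1^3-p_2q_1$, $\widetilde K=p_2$. Its germ is of elliptic fork type if in coordinates of the same kind the Liouville foliation is given by $2\widetilde H=p_1^2+q_1^4-2p_2q_1^2$, $\widetilde K=p_2$; the adjective ''asymmetric'' indicates that the involution $(p_1,p_2,q_1,q_2)\mapsto(-p_1,p_2,-q_1,q_2)$ is not required to be a symplectomorphism. A point $t$ of a planar parametrized curve $\gamma$ is an ordinary cusp if $\dot\gamma(t)=0$ and the second and third derivatives at $t$ are linearly independent. *)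

(* Defs.v *)
From HB Require Import structures.
From mathcomp Require Import all_boot all_order all_algebra.
From mathcomp Require Import all_classical all_reals all_analysis.
From mathcomp Require Import complex.

Set Implicit Arguments.
Unset Strict Implicit.
Unset Printing Implicit Defensive.

Import Order.TTheory GRing.Theory Num.Theory.
Import numFieldNormedType.Exports.

Local Open Scope ring_scope.
Local Open Scope classical_set_scope.

(** A function on [0, L] has at most one odd (or even)
    2L-periodic extension to the line, so a pair on [0, L] is represented by
    its extension; in particular derivatives at 0 and L are those of the
    extension. *)

Definition smooth1 (R : realType) (g : R -> R) : Prop :=
  forall n (x : R), derivable (derive1n n g) x 1.

Definition morse_on (R : realType) (L : R) (g : R -> R) : Prop :=
  forall r : R, 0 <= r <= L -> derive1 g r = 0 -> derive1n 2 g r != 0.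

Record pregeneric (R : realType) (L : R) (f Lam : R -> R) : Prop := {
  pg_f_pos : forall r : R, 0 < r < L -> 0 < f r;
  pg_f_smooth : smooth1 f;
  pg_f_odd : forall r : R, f (- r) = - f r;
  pg_f_periodic : forall r : R, f (r + 2 * L) = f r;
  pg_Lam_smooth : smooth1 Lam;
  pg_Lam_even : forall r : R, Lam (- r) = Lam r;
  pg_Lam_periodic : forall r : R, Lam (r + 2 * L) = Lam r;
  pg_f'0 : derive1 f 0 = 1;
  pg_f'L : derive1 f L = -1;
  pg_f_morse : morse_on L f;
  pg_Lam_morse : morse_on L Lam;
  pg_immersed : forall r : R, 0 <= r <= L ->
    0 < derive1 Lam r ^+ 2 + derive1 f r ^+ 2
}.

(** A positive multiple of the curvature of the planar curve (f, Lam) when it is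
    immersed; its simple zeros are inflection points. *)
Definition inflection (R : realType) (f Lam : R -> R) (r : R) : R :=
  derive1 f r * derive1n 2 Lam r - derive1n 2 f r * derive1 Lam r.

Definition generic (R : realType) (L : R) (f Lam : R -> R) : Prop :=
  pregeneric L f Lam /\
  forall r : R, 0 <= r <= L ->
    inflection f Lam r = 0 -> derive1 (inflection f Lam) r != 0.

Definition kfun (R : realType) (f Lam : R -> R) (r : R) : R :=
  Lam r - f r * (derive1 Lam r / derive1 f r).

Definition hfun (R : realType) (f Lam : R -> R) (r : R) : R :=
  (derive1 Lam r / derive1 f r) ^+ 2 / 2.

Definition Ueff (R : realType) (f Lam : R -> R) (k r : R) : R :=
  (k - Lam r) ^+ 2 / (2 * f r ^+ 2).

(** T^*(M minus the poles) is R x R x (0, L) x R/2piZ with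
    coordinates (p_r, p_phi, r, phi). It is handled through its covering by
    row vectors x in R^4 with 0 < r < L, the angle phi being lifted to R: two
    vectors represent the same point iff they have the same image under
    [unlift], which realizes R^3 x R/2piZ as a topological subspace of R^5.
    All critical circles considered here, and hence their germs, lie away from
    the poles. The same encoding serves for the model R^3 x R/2piZ with
    coordinates (p_1, p_2, q_1, q_2). *)

Notation i_pr := (@Ordinal 4 0 isT) (only parsing).
Notation i_pphi := (@Ordinal 4 1 isT) (only parsing).
Notation i_r := (@Ordinal 4 2 isT) (only parsing).
Notation i_phi := (@Ordinal 4 3 isT) (only parsing).

Notation i_p1 := (@Ordinal 4 0 isT) (only parsing).
Notation i_p2 := (@Ordinal 4 1 isT) (only parsing).
Notation i_q1 := (@Ordinal 4 2 isT) (only parsing).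
Notation i_q2 := (@Ordinal 4 3 isT) (only parsing).

Definition unlift (R : realType) (x : 'rV[R]_4) : R * R * R * (R * R) :=
  (x ord0 i_pr, x ord0 i_pphi, x ord0 i_r,
   (cos (x ord0 i_phi), sin (x ord0 i_phi))).

Definition phase (R : realType) (L : R) : set 'rV[R]_4 :=
  [set x : 'rV[R]_4 | 0 < x ord0 i_r < L].

Definition Ham (R : realType) (f : R -> R) (x : 'rV[R]_4) : R :=
  x ord0 i_pr ^+ 2 / 2 + x ord0 i_pphi ^+ 2 / (2 * f (x ord0 i_r) ^+ 2).

Definition Kint (R : realType) (Lam : R -> R) (x : 'rV[R]_4) : R :=
  x ord0 i_pphi + Lam (x ord0 i_r).

Definition momentum (R : realType) (f Lam : R -> R) (x : 'rV[R]_4) : R * R :=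
  (Ham f x, Kint Lam x).

(** The matrix B of dx_i /\ dx_j: its value on (u, v) is u *m B *m v^T. *)
Definition wedge (R : realType) (i j : 'I_4) : 'M[R]_4 :=
  delta_mx i j - delta_mx j i.

Definition Omega (R : realType) (Lam : R -> R) (x : 'rV[R]_4) : 'M[R]_4 :=
  wedge R i_pr i_r + wedge R i_pphi i_phi
  + derive1 Lam (x ord0 i_r) *: wedge R i_r i_phi.

Definition partial (R : realType) (i : 'I_4) (G : 'rV[R]_4 -> R)
    (x : 'rV[R]_4) : R :=
  'D_(delta_mx ord0 i) G x.

Definition grad (R : realType) (G : 'rV[R]_4 -> R) (x : 'rV[R]_4) :
    'rV[R]_4 :=
  \row_i partial i G x.

(** The vector field X with omega(X, v) = - dG(v) for all v. *)
Definition hamvf (R : realType) (Lam : R -> R) (G : 'rV[R]_4 -> R)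
    (x : 'rV[R]_4) : 'rV[R]_4 :=
  - grad G x *m invmx (Omega Lam x).

(** Subspaces are row spaces, and an operator A acts by u |-> u *m A. *)

Definition rank_dF (R : realType) (f Lam : R -> R) (x : 'rV[R]_4) : nat :=
  \rank (col_mx (grad (Ham f) x) (grad (Kint Lam) x)).

Definition Wmx (R : realType) (f Lam : R -> R) (x : 'rV[R]_4) :
    'M[R]_(1 + 1, 4) :=
  col_mx (hamvf Lam (Ham f) x) (hamvf Lam (Kint Lam) x).

(** The row space is {u | u *m Omega *m w^T = 0 for every w in W}. *)
Definition Wperp (R : realType) (f Lam : R -> R) (x : 'rV[R]_4) : 'M[R]_4 :=
  kermx (Omega Lam x *m (Wmx f Lam x)^T).

Definition linearization (R : realType) (f Lam : R -> R) (a b : R)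
    (x : 'rV[R]_4) : 'M[R]_4 :=
  jacobian (hamvf Lam (fun y => a * Ham f y + b * Kint Lam y)) x.

Definition invertible_on_quotient (F : fieldType) (n m p : nat)
    (W : 'M[F]_(m, n)) (V : 'M[F]_(p, n)) (A : 'M[F]_n) : Prop :=
  [/\ stablemx V A, stablemx W A,
      forall u : 'rV[F]_n, (u <= V)%MS -> (u *m A <= W)%MS -> (u <= W)%MS
    & forall v : 'rV[F]_n, (v <= V)%MS ->
        exists2 u : 'rV[F]_n, (u <= V)%MS & (u *m A - v <= W)%MS].

(** l is an eigenvalue of the operator induced by A on V/W: the class of some
    u in V outside W is an eigenvector. *)
Definition quotient_eigenvalue (F : fieldType) (n m p : nat)
    (W : 'M[F]_(m, n)) (V : 'M[F]_(p, n)) (A : 'M[F]_n) (l : F) : Prop :=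
  exists u : 'rV[F]_n,
    [/\ (u <= V)%MS, ~~ (u <= W)%MS & (u *m A - l *: u <= W)%MS].

Definition complexify (R : realType) (m n : nat) (A : 'M[R]_(m, n)) :
    'M[R[i]]_(m, n) :=
  map_mx (real_complex R) A.

Definition nondegenerate_for (R : realType) (f Lam : R -> R)
    (x : 'rV[R]_4) (a b : R) : Prop :=
  [/\ (a, b) != (0, 0),
      a *: grad (Ham f) x + b *: grad (Kint Lam) x = 0
    & invertible_on_quotient (Wmx f Lam x) (Wperp f Lam x)
        (linearization f Lam a b x)].

Definition eigenvalue_for (R : realType) (f Lam : R -> R)
    (x : 'rV[R]_4) (a b : R) (l : R[i]) : Prop :=
  quotient_eigenvalue (complexify (Wmx f Lam x)) (complexify (Wperp f Lam x))
    (complexify (linearization f Lam a b x)) l.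

(** At a rank-1 point the pair (a, b) is unique up to a nonzero real factor,
    on which none of the following three notions depends. *)
Definition nondegenerate (R : realType) (f Lam : R -> R) (x : 'rV[R]_4) :
    Prop :=
  rank_dF f Lam x = 1%N /\ exists a b, nondegenerate_for f Lam x a b.

Definition elliptic (R : realType) (f Lam : R -> R) (x : 'rV[R]_4) : Prop :=
  rank_dF f Lam x = 1%N /\ exists a b, nondegenerate_for f Lam x a b /\
    forall l, eigenvalue_for f Lam x a b l -> complex.Re l = 0.

Definition hyperbolic (R : realType) (f Lam : R -> R) (x : 'rV[R]_4) : Prop :=
  rank_dF f Lam x = 1%N /\ exists a b, nondegenerate_for f Lam x a b /\
    forall l, eigenvalue_for f Lam x a b l -> complex.Im l = 0.

Definition orbit_set (R : realType) (Lam : R -> R) (rho kappa : R) :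
    set 'rV[R]_4 :=
  [set x : 'rV[R]_4 |
    [/\ x ord0 i_pr = 0, Kint Lam x = kappa & x ord0 i_r = rho]].

Definition orbit_nondegenerate (R : realType) (f Lam : R -> R)
    (O : set 'rV[R]_4) : Prop := forall x, O x -> nondegenerate f Lam x.

Definition orbit_elliptic (R : realType) (f Lam : R -> R)
    (O : set 'rV[R]_4) : Prop := forall x, O x -> elliptic f Lam x.

Definition orbit_hyperbolic (R : realType) (f Lam : R -> R)
    (O : set 'rV[R]_4) : Prop := forall x, O x -> hyperbolic f Lam x.

Definition C1k (R : realType) (L : R) (f Lam : R -> R) : set 'rV[R]_4 :=
  \bigcup_(r in [set r : R | 0 < r < L /\ derive1 f r != 0])
    orbit_set Lam r (kfun f Lam r).

Definition C1Lam (R : realType) (L : R) (Lam : R -> R) : set 'rV[R]_4 :=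
  \bigcup_(r in [set r : R | 0 < r < L]) orbit_set Lam r (Lam r).

Definition gamma1 (R : realType) (f Lam : R -> R) (r : R) : R * R :=
  (hfun f Lam r, kfun f Lam r).

Definition gamma2 (R : realType) (Lam : R -> R) (r : R) : R * R :=
  (0, Lam r).

Definition curve_deriv (R : realType) (c : R -> R * R) (n : nat) (t : R) :
    R * R :=
  (derive1n n (fun s => (c s).1) t, derive1n n (fun s => (c s).2) t).

Definition ordinary_cusp (R : realType) (c : R -> R * R) (t : R) : Prop :=
  curve_deriv c 1 t = (0, 0) /\
  forall a b : R,
    (a * (curve_deriv c 2 t).1 + b * (curve_deriv c 3 t).1,
     a * (curve_deriv c 2 t).2 + b * (curve_deriv c 3 t).2) = (0, 0) ->
    a = 0 /\ b = 0.

(** The line through c t with direction v is the limit of the secants through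
    c t and c s as s tends to t. Unlike a condition on the velocity, this also
    makes sense for gamma2 at the critical points of Lam, where its
    parametrization is singular. *)
Definition tangent_direction (R : realType) (c : R -> R * R) (t : R)
    (v : R * R) : Prop :=
  [/\ v != (0, 0),
      \forall s \near t^', c s != c t
    & forall e : R, 0 < e -> \forall s \near t^',
        `|v.1 * ((c s).2 - (c t).2) - v.2 * ((c s).1 - (c t).1)|
          <= e * `|c s - c t| ].

Definition tangent_at (R : realType) (c1 : R -> R * R) (t1 : R)
    (c2 : R -> R * R) (t2 : R) : Prop :=
  c1 t1 = c2 t2 /\
  exists v, tangent_direction c1 t1 v /\ tangent_direction c2 t2 v.

Fixpoint Cn_on (R : realType) (n : nat) (U : set 'rV[R]_4)
    (g : 'rV[R]_4 -> R) : Prop :=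
  if n is m.+1 then
    (forall x, U x -> differentiable g x) /\
    forall i, Cn_on m U (partial i g)
  else forall x, U x -> {for x, continuous g}.

Definition smooth_on (R : realType) (U : set 'rV[R]_4) (g : 'rV[R]_4 -> R) :
    Prop := forall n, Cn_on n U g.

(** x and y (in U) lie on the same leaf of the foliation of the image of U by
    connected components of the level sets of F. *)
Definition same_leaf (R : realType) (F : 'rV[R]_4 -> R * R)
    (U : set 'rV[R]_4) (x y : 'rV[R]_4) : Prop :=
  connected_component
    ((@unlift R) @` [set z | U z /\ F z = F x]) (unlift x) (unlift y).

Definition disc_circle (R : realType) (e : R) : set 'rV[R]_4 :=
  [set y : 'rV[R]_4 |
    y ord0 i_p1 ^+ 2 + y ord0 i_p2 ^+ 2 + y ord0 i_q1 ^+ 2 < e ^+ 2].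

Definition core_circle (R : realType) : set 'rV[R]_4 :=
  [set y : 'rV[R]_4 | [/\ y ord0 i_p1 = 0, y ord0 i_p2 = 0 & y ord0 i_q1 = 0]].

(** In a neighbourhood U of the circle O there are coordinates psi with values
    in D^3 x R/2piZ in which O is the core circle and the Liouville foliation
    is given by the functions G. The coordinates are lifted to the covering
    spaces, which is possible because U is then a solid torus around O. *)
Definition foliation_germ (R : realType) (L : R) (f Lam : R -> R)
    (O : set 'rV[R]_4) (G : 'rV[R]_4 -> R * R) : Prop :=
  exists (U : set 'rV[R]_4) (psi : 'rV[R]_4 -> 'rV[R]_4) (e : R),
    [/\ [/\ 0 < e, open U, O `<=` U, U `<=` phase L
          & forall x y, unlift x = unlift y -> U x -> U y],
        [/\ forall i, smooth_on U (fun x => psi x ord0 i),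
            forall x, U x -> jacobian psi x \in unitmx,
            psi @` U = disc_circle e
          & forall x y, U x -> U y ->
              (unlift (psi x) = unlift (psi y) <-> unlift x = unlift y)],
        forall x, U x -> (O x <-> core_circle (psi x))
      & forall x y, U x -> U y ->
          (same_leaf (momentum f Lam) U x y <->
           same_leaf G (disc_circle e) (psi x) (psi y))].

Definition parabolic_model (R : realType) (y : 'rV[R]_4) : R * R :=
  ((y ord0 i_p1 ^+ 2 + y ord0 i_q1 ^+ 3 - y ord0 i_p2 * y ord0 i_q1) / 2,
   y ord0 i_p2).

Definition fork_model (R : realType) (y : 'rV[R]_4) : R * R :=
  ((y ord0 i_p1 ^+ 2 + y ord0 i_q1 ^+ 4
    - 2 * y ord0 i_p2 * y ord0 i_q1 ^+ 2) / 2,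
   y ord0 i_p2).

Definition parabolic_orbit (R : realType) (L : R) (f Lam : R -> R)
    (O : set 'rV[R]_4) : Prop :=
  foliation_germ L f Lam O (@parabolic_model R).

(** "Asymmetric": the involution (p_1, p_2, q_1, q_2) |-> (-p_1, p_2, -q_1, q_2)
    need not preserve the symplectic form, so no condition relates psi to
    Omega. *)
Definition asymmetric_elliptic_fork (R : realType) (L : R) (f Lam : R -> R)
    (O : set 'rV[R]_4) : Prop :=
  foliation_germ L f Lam O (@fork_model R).

(* Main.v *)
Require Import Defs.
From HB Require Import structures.
From mathcomp Require Import all_boot all_order all_algebra.
From mathcomp Require Import ring lra.
From mathcomp Require Import all_classical all_reals all_analysis.
From mathcomp Require Import complex.

Set Implicit Arguments.
Unset Strict Implicit.
Unset Printing Implicit Defensive.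

Import Order.TTheory GRing.Theory Num.Theory.
Import numFieldNormedType.Exports.

Local Open Scope ring_scope.
Local Open Scope classical_set_scope.

(** Put m = - Lam' / f' and w = (k - Lam) / f, so that U_k = w ^ 2 / 2,
    k = Lam + f m, k' = f m', h = m ^ 2 / 2 and h' = m m'.

    At a critical circle dH = c dK with c = p_phi / f ^ 2, and W^perp / W has
    the coordinates (dp_r, dr). The linearization of H - c K acts there by
    (x, y) |-> (- U'' y, x), so its eigenvalues are the square roots of - U''.
    Differentiating the identity U_{k(r)}'(r) = 0 gives
    U_{k(r)}''(r) = - k'(r) Lam'(r) / f(r) ^ 2.

    For the germs one writes 2 C(k) ^ 2 U_k(r) + A(k) = g(Q(k, r), P(k)), where
    (p_1 ^ 2 + g(q_1, p_2)) / 2 is the model Hamiltonian; up to signs the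
    coordinates are then p_1 = C(k) p_r, p_2 = P(k), q_1 = Q(k, r), q_2 = phi.
    Where Lam' = 0 the circles are parametrized by k through the
    inverse rho of the function r |-> k(r), Taylor's formula at rho(k) gives
    +/- w = +/- m(rho(k)) - Q ^ 2, and squaring yields the elliptic fork.
    Where the curve (f, Lam) has a simple inflection, k(r) - k_0 = +/- s ^ 2
    for a coordinate s, and by Whitney's theorem on even functions
    h(r(s)) = a(s ^ 2) - 2/3 c(s ^ 2) s ^ 3 with smooth a and c. For
    t = +/- (k - k_0) and y = s ^ 2 - t this turns U_k into
    a(t) + c(t) (s ^ 3 / 3 - t s) + y ^ 2 E, and the last term is absorbed by
    q = s + y eta, where eta solves eta + s eta ^ 2 + y eta ^ 3 / 3 = E / c, so
    that U_k = a(t) + c(t) (q ^ 3 / 3 - t q). *)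

(** * Differential calculus on rows of four coordinates *)

(** In the plane with abscissa f and ordinate Lam, - w is the slope of the line joining (0, k) to
    (f(r), Lam(r)), and U_k is critical at r exactly when this line is tangent to the curve (f, Lam)
    there or is horizontal. So k(r) is the intercept of the tangent line and m(r) is minus its
    slope: up to the passage from m to h = m ^ 2 / 2, [gamma1] is the dual curve. This is why simple
    inflections produce cusps, and why horizontal tangents bring [gamma1] to the line h = 0.

    The obstacle in the parabolic case is smoothness on the side t < 0 of the cusp, where U_k has no
    critical point nearby. The critical values h(r(s)) determine a(t) and c(t) only for t = s ^ 2 >=
    0, while the coordinates must be smooth across t = 0. Borel's theorem extends a and c to t < 0,
    and any smooth extension serves: h is matched at the points s ^ 2 only, and the passage from s ^
    2 to t is Taylor's formula, whose remainder is a smooth multiple of y ^ 2 whatever the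
    extension. *)

Section RowCalculus.
Context {R : realType}.
Local Notation V4 := 'rV[R]_4.
Implicit Types (U : set V4) (g h : V4 -> R) (x y : V4) (J : set R).

Lemma ler_coord_norm (v : V4) i : `|v ord0 i| <= `|v|.
Proof.
rewrite [leRHS]/Num.Def.normr/= mx_normrE.
exact: (le_bigmax _ (fun ij : 'I_1 * 'I_4 => `|v ij.1 ij.2|) (ord0, i)).
Qed.

Lemma diff_partial g x (v : V4) : differentiable g x ->
  'd g x v = \sum_i partial i g x * v ord0 i.
Proof.
move=> dg; rewrite {1}(row_sum_delta v) linear_sum; apply: eq_bigr => i _.
by rewrite linearZ/= /partial deriveE// mulrC.
Qed.

Lemma differentiable_eps g x : differentiable g x ->
  forall e, 0 < e -> \forall v \near (0 : V4),
    `|g (v + x) - g x - \sum_i partial i g x * v ord0 i| <= e * `|v|.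
Proof.
move=> dg e e0; have /diff_locally/eqaddoP/(_ e e0) := dg.
apply: filterS => v; rewrite /= !fctE /= opprD addrA.
by rewrite diff_partial.
Qed.

(** The candidate differential; its linear structure lets [diff_unique] identify it with
    ['d g x]. *)
Definition lin_row (c : 'I_4 -> R) (v : V4) : R := \sum_i c i * v ord0 i.

Lemma lin_row_is_linear c : linear (lin_row c).
Proof.
move=> a u v; rewrite /lin_row scaler_sumr -big_split; apply: eq_bigr => i _ /=.
by rewrite !mxE mulrDr; congr (_ + _); rewrite mulrCA.
Qed.

HB.instance Definition _ c := GRing.isLinear.Build R V4 R _ (lin_row c)
  (lin_row_is_linear c).

Lemma lin_row_continuous c : continuous (lin_row c).
Proof.
move=> v; apply: (@cvg_big _ _ +%R 0 xpredT (@add_continuous R) _ (nbhs v)).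
by move=> i _; apply: cvgM; [exact: cvg_cst | exact: coord_continuous].
Qed.

(** The route to differentiability for functions given by integrals or by implicit equations: by
    uniqueness of the differential, a first-order estimate with guessed coefficients yields
    differentiability and the partial derivatives at once. *)
Lemma is_diff_eps g x (c : 'I_4 -> R) :
  (forall e, 0 < e -> \forall v \near (0 : V4),
    `|g (v + x) - g x - \sum_i c i * v ord0 i| <= e * `|v|) ->
  differentiable g x /\ forall i, partial i g x = c i.
Proof.
move=> H.
have D : 'd g x = lin_row c :> (_ -> _).
  apply: diff_unique; first exact: lin_row_continuous.
  apply/eqaddoP => e e0; have := H e e0.
  by apply: filterS => v; rewrite /= !fctE /= opprD addrA.
have dg : differentiable g x.
  apply/diff_locallyP; rewrite D; split; first exact: lin_row_continuous.
  apply/eqaddoP => e e0; have := H e e0.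
  by apply: filterS => v; rewrite /= !fctE /= opprD addrA.
split=> // i; rewrite /partial deriveE// D /lin_row (bigD1 i)//= big1 => [|j ji].
  by rewrite mxE !eqxx mulr1 addr0.
by rewrite mxE eqxx (negbTE ji) mulr0.
Qed.

Lemma near_eq_differentiable g h x : (\forall y \near x, g y = h y) ->
  differentiable g x -> differentiable h x /\ forall i, partial i h x = partial i g x.
Proof.
move=> gh dg; apply: is_diff_eps => e e0.
have ghx : g x = h x by exact: nbhs_singleton gh.
have gh0 : \forall v \near (0 : V4), g (v + x) = h (v + x).
  by rewrite (near_shift 0 x) /= in gh; move: gh; rewrite subr0.
by apply: filterS2 gh0 (differentiable_eps dg e0) => v /= <-; rewrite -ghx.
Qed.

Lemma partial_comp1 (phi : R -> R) g x i :
  differentiable g x -> derivable phi (g x) 1 ->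
  differentiable (phi \o g) x /\
  partial i (phi \o g) x = derive1 phi (g x) * partial i g x.
Proof.
move=> dg dphi; have dp := dphi; move/derivable1_diffP in dp.
have dc : differentiable (phi \o g) x by exact: differentiable_comp.
split=> //; rewrite /partial !deriveE// diff_comp//= -[X in 'd phi _ X]mulr1.
by rewrite linearZ/= derive1E' // mulrC.
Qed.

Lemma differentiable_row (phi : V4 -> V4) x :
  (forall i, differentiable (fun y => phi y ord0 i) x) -> differentiable phi x.
Proof.
move=> H; pose F i (y : V4) : V4 := phi y ord0 i *: delta_mx ord0 i.
have -> : phi = \sum_i F i.
  by apply/funext => y; rewrite fct_sumE {1}(row_sum_delta (phi y)).
by apply: differentiable_sum => i; exact: differentiableZl.
Qed.

Lemma partial_coord x i j :
  partial i (fun y : V4 => y ord0 j) x = (i == j)%:R.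
Proof.
have pp e : 0 < e -> \forall w \near (0 : V4),
    `|(w + x) ord0 j - x ord0 j - \sum_k (k == j)%:R * w ord0 k| <= e * `|w|.
  move=> e0; near=> w; rewrite (bigD1 j)//= eqxx mul1r big1.
    by rewrite !mxE addrK addr0 subrr normr0 mulr_ge0// ltW.
  by move=> k /negbTE ->; rewrite mul0r.
by have [_] := @is_diff_eps (fun y : V4 => y ord0 j) x _ pp; apply.
Unshelve. all: by end_near. Qed.

Lemma diff_coord (phi : V4 -> V4) x (v : V4) i : differentiable phi x ->
  ('d phi x v) ord0 i = 'd (fun y => phi y ord0 i) x v.
Proof.
move=> dphi; pose p (y : V4) : R := y ord0 i.
have E : (fun y => phi y ord0 i) = p \o phi by [].
have dpp : differentiable p (phi x) by exact: differentiable_coord.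
rewrite E (@diff_comp _ _ _ _ phi p)//=.
rewrite (@diff_partial p)// (bigD1 i)//= partial_coord eqxx mul1r.
by rewrite big1 ?addr0// => j /negbTE ji; rewrite partial_coord ji mul0r.
Qed.

Lemma partial_comp (phi : V4 -> V4) g x i :
  (forall j, differentiable (fun y => phi y ord0 j) x) ->
  differentiable g (phi x) ->
  differentiable (g \o phi) x /\
  partial i (g \o phi) x =
    \sum_j partial j g (phi x) * partial i (fun y => phi y ord0 j) x.
Proof.
move=> dphi dg; have dp := differentiable_row dphi.
have dc : differentiable (g \o phi) x by exact: differentiable_comp.
split=> //; rewrite /partial deriveE// (@diff_comp _ _ _ _ phi g)//= (@diff_partial g)//.
apply: eq_bigr => j _; congr (_ * _).
by rewrite diff_coord// deriveE.
Qed.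

Lemma partialD g h x i : differentiable g x -> differentiable h x ->
  partial i (fun y => g y + h y) x = partial i g x + partial i h x.
Proof. by move=> dg dh; rewrite /partial deriveD//; apply: diff_derivable. Qed.

Lemma partialM g h x i : differentiable g x -> differentiable h x ->
  partial i (fun y => g y * h y) x = g x * partial i h x + h x * partial i g x.
Proof. by move=> dg dh; rewrite /partial deriveM//; apply: diff_derivable. Qed.

Lemma partial_cst (c : R) x i : partial i (fun=> c) x = 0.
Proof. by rewrite /partial derive_cst. Qed.

End RowCalculus.

(** * Functions of class C^n on open sets of rows *)

Section SmoothFunctions.
Context {R : realType}.
Local Notation V4 := 'rV[R]_4.
Implicit Types (U : set V4) (g h : V4 -> R) (x y : V4) (J : set R).

Lemma open_coord (J : set R) i : open J -> open [set x : V4 | J (x ord0 i)].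
Proof. by move=> oJ; apply: open_comp => // x _; exact: coord_continuous. Qed.

Lemma continuous_at_near (T S : topologicalType) (u v : T -> S) (x : T) :
  (\forall z \near x, u z = v z) -> {for x, continuous u} -> {for x, continuous v}.
Proof.
move=> uv cu; rewrite /prop_for /continuous_at -(nbhs_singleton uv).
by apply: cvg_trans cu; exact: near_eq_cvg.
Qed.

(** Inductions on the order replace a partial derivative by a formula valid on [U] alone; as [U] is
    open, agreement on [U] carries over to the derivatives. *)
Lemma Cn_on_eq n U g h : open U -> (forall x, U x -> g x = h x) ->
  Cn_on n U g -> Cn_on n U h.
Proof.
move=> oU; elim: n g h => [|n IHn] g h gh /=.
  move=> cg x Ux; apply: continuous_at_near (cg x Ux).
  by apply: filterS (open_nbhs_nbhs (conj oU Ux)) => y /gh.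
move=> [dg cg].
have H x (Ux : U x) : differentiable h x /\ forall i, partial i h x = partial i g x.
  apply: near_eq_differentiable (dg x Ux); by apply: filterS gh _; exact: open_nbhs_nbhs.
split=> [x /H[]//|i]; apply: IHn (cg i) => x /H[_ ->//].
Qed.

Lemma Cn_on_continuous n U g : Cn_on n U g -> forall x, U x -> {for x, continuous g}.
Proof. by case: n => [//|n] [dg _] x /dg; exact: differentiable_continuous. Qed.

Lemma Cn_onW n U g : Cn_on n.+1 U g -> Cn_on n U g.
Proof.
elim: n g => [|n IHn] g; first by move=> cg x Ux; exact: Cn_on_continuous cg x Ux.
by move=> [dg cg]; split=> // i; exact/IHn/cg.
Qed.

Lemma Cn_on_sub n U U' g : U' `<=` U -> Cn_on n U g -> Cn_on n U' g.
Proof.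
move=> UU'; elim: n g => [|n IHn] g /=; first by move=> cg x /UU'/cg.
by move=> [dg cg]; split=> [x /UU'/dg//|i]; exact: IHn (cg i).
Qed.

Lemma Cn_on_cst n U (c : R) : Cn_on n U (fun=> c).
Proof.
elim: n c => [|n IHn] c /=; first by move=> x _; exact: cst_continuous.
split=> [x _|i]; first exact: differentiable_cst.
rewrite (_ : partial i (fun=> c) = fun=> 0)//.
by apply/funext => x; exact: partial_cst.
Qed.

Lemma Cn_on_coord n U i : Cn_on n U (fun x => x ord0 i).
Proof.
case: n => [|n] /=; first by move=> x _; exact: coord_continuous.
split=> [x _|j]; first exact: differentiable_coord.
rewrite (_ : partial j _ = fun=> (j == i)%:R); first exact: Cn_on_cst.
by apply/funext => x; exact: partial_coord.
Qed.

Lemma Cn_onD n U g h : open U -> Cn_on n U g -> Cn_on n U h ->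
  Cn_on n U (fun x => g x + h x).
Proof.
move=> oU; elim: n g h => [|n IHn] g h /=.
  by move=> cg ch x Ux; apply: continuousD; [exact: cg|exact: ch].
move=> [dg cg] [dh ch]; split=> [x Ux|i].
  by apply: differentiableD; [exact: dg|exact: dh].
apply: (@Cn_on_eq _ _ (fun x => partial i g x + partial i h x)) => //.
  by move=> x Ux; rewrite partialD//; [exact: dg|exact: dh].
exact: IHn.
Qed.

Lemma Cn_onM n U g h : open U -> Cn_on n U g -> Cn_on n U h ->
  Cn_on n U (fun x => g x * h x).
Proof.
move=> oU; elim: n g h => [|n IHn] g h.
  by move=> cg ch x Ux; apply: continuousM; [exact: cg|exact: ch].
move=> cg' ch'; have [dg cg] := cg'; have [dh ch] := ch'; split=> [x Ux|i].
  by apply: differentiableM; [exact: dg|exact: dh].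
apply: (@Cn_on_eq _ _ (fun x => g x * partial i h x + h x * partial i g x)) => //.
  by move=> x Ux; rewrite partialM//; [exact: dg|exact: dh].
by apply: Cn_onD => //; [exact: IHn (Cn_onW cg') (ch i) | exact: IHn (Cn_onW ch') (cg i)].
Qed.

Lemma Cn_on_sum n U (F : 'I_4 -> V4 -> R) : open U -> (forall i, Cn_on n U (F i)) ->
  Cn_on n U (fun x => \sum_i F i x).
Proof.
move=> oU cF.
rewrite (_ : (fun x => _) = fun x => F ord0 x + (F (lift ord0 ord0) x
   + (F (lift ord0 (lift ord0 ord0)) x + (F (lift ord0 (lift ord0 (lift ord0 ord0))) x + 0)))).
  by do !apply: Cn_onD => //; exact: Cn_on_cst.
by apply/funext => x; rewrite !big_ord_recl big_ord0.
Qed.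

(** For a function whose partial derivatives are smooth expressions in the function itself, such as
    the root of an implicit equation: each order of regularity buys the next. *)
Lemma Cn_on_bootstrap U g : (forall x, U x -> differentiable g x) ->
  (forall n i, Cn_on n U g -> Cn_on n U (partial i g)) -> smooth_on U g.
Proof.
move=> dg H; elim=> [|n IHn] /=; last by split=> // i; exact: H.
by move=> x /dg; exact: differentiable_continuous.
Qed.

End SmoothFunctions.

(** * Smooth functions of one variable *)

Section SmoothFunctions1.
Context {R : realType}.
Local Notation V4 := 'rV[R]_4.
Implicit Types (U : set V4) (g h : V4 -> R) (J : set R).

Fixpoint Cn1 (n : nat) (J : set R) (g : R -> R) : Prop :=
  if n is m.+1 then (forall x, J x -> derivable g x 1) /\ Cn1 m J (derive1 g)
  else forall x, J x -> {for x, continuous g}.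

Definition Sm (J : set R) (g : R -> R) : Prop := forall n, Cn1 n J g.

Lemma Cn1_eq n J (g h : R -> R) : open J -> (forall x, J x -> g x = h x) ->
  Cn1 n J g -> Cn1 n J h.
Proof.
move=> oU; elim: n g h => [|n IHn] g h gh /=.
  move=> cg x Ux; apply: continuous_at_near (cg x Ux).
  by apply: filterS (open_nbhs_nbhs (conj oU Ux)) => y /gh.
move=> [dg cg].
have H x (Ux : J x) : \forall y \near x, g y = h y by by apply: filterS gh _; exact: open_nbhs_nbhs.
split=> [x Jx|]; first exact: near_eq_derivable (H x Jx) (dg x Jx).
by apply: IHn cg => x Jx; rewrite !derive1E; exact/near_eq_derive/H.
Qed.

Lemma Cn1_continuous n J (g : R -> R) : Cn1 n J g -> forall x, J x -> {for x, continuous g}.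
Proof.
by case: n => [//|n] [dg _] x /dg/derivable1_diffP; exact: differentiable_continuous.
Qed.

Lemma Cn1_sub n J J' (g : R -> R) : J' `<=` J -> Cn1 n J g -> Cn1 n J' g.
Proof.
move=> JJ'; elim: n g => [|n IHn] g /=; first by move=> cg x /JJ'/cg.
by move=> [dg cg]; split=> [x /JJ'/dg//|]; exact: IHn cg.
Qed.

Lemma Cn_on_comp1 n U J (phi : R -> R) g : open U -> (forall x, U x -> J (g x)) ->
  Cn1 n J phi -> Cn_on n U g -> Cn_on n U (fun x => phi (g x)).
Proof.
move=> oU UJ; elim: n phi => [|n IHn] phi.
  by move=> cp cg x Ux; apply: continuous_comp; [exact: cg|exact/cp/UJ].
move=> [dp cp] cg'; have [dg cg] := cg'.
have H x (Ux : U x) i := partial_comp1 i (dg x Ux) (dp _ (UJ x Ux)).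
split=> [x /H/(_ ord0)[]//|i].
apply: (@Cn_on_eq _ _ _ (fun x => derive1 phi (g x) * partial i g x)) => //.
  by move=> x /H/(_ i)[_ <-].
by apply: Cn_onM => //; [exact: IHn cp (Cn_onW cg') | exact: cg].
Qed.

Lemma Cn_on_comp n U U' (phi : V4 -> V4) g : open U -> (forall x, U x -> U' (phi x)) ->
  Cn_on n U' g -> (forall j, Cn_on n U (fun x => phi x ord0 j)) ->
  Cn_on n U (fun x => g (phi x)).
Proof.
move=> oU UJ; elim: n g => [|n IHn] g.
  move=> cg cp x Ux; apply: continuous_comp; last exact/cg/UJ.
  rewrite (_ : phi = fun y => \sum_j phi y ord0 j *: (delta_mx ord0 j : V4)).
    apply: (@cvg_big _ _ +%R 0 xpredT (@add_continuous V4) _ (nbhs x)) => j _.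
    by apply: cvgZr_tmp; exact: cp.
  by apply/funext => y; rewrite -row_sum_delta.
move=> [dg cg] cp.
have dp x (Ux : U x) j : differentiable (fun y => phi y ord0 j) x by case: (cp j) => + _; apply.
have H x (Ux : U x) i := partial_comp i (dp x Ux) (dg _ (UJ x Ux)).
split=> [x /H/(_ ord0)[]//|i].
apply: (@Cn_on_eq _ _ _ (fun x => \sum_j partial j g (phi x) *
    partial i (fun y => phi y ord0 j) x)) => //.
  by move=> x /H/(_ i)[_ <-].
apply: Cn_on_sum => // j; apply: Cn_onM => //.
  by apply: IHn (cg j) _ => k; exact: Cn_onW.
by case: (cp j) => _; apply.
Qed.

Definition line i (c : V4) (t : R) : V4 := c + t *: delta_mx ord0 i.

Lemma is_derive_line i c t g : differentiable g (line i c t) ->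
  is_derive t 1 (fun u => g (line i c u)) (partial i g (line i c t)).
Proof.
move=> dg.
have E : (fun h : R => h^-1 *: (((fun u => g (line i c u)) \o shift t) (h *: 1) - g (line i c t))) =
   (fun h : R => h^-1 *: ((g \o shift (line i c t)) (h *: delta_mx ord0 i) - g (line i c t))).
  apply/funext => h /=; congr (_ *: (g _ - _)); rewrite /line scalerDl addrCA.
  by congr (_ + (_ + _)); rewrite [h%:A]mulr1.
have dv : derivable g (line i c t) (delta_mx ord0 i) by exact: diff_derivable.
split; first by rewrite /derivable E.
by rewrite /partial /derive E.
Qed.

Lemma Cn1_line n U J i c g : open J -> (forall t, J t -> U (line i c t)) ->
  Cn_on n U g -> Cn1 n J (fun t => g (line i c t)).
Proof.
move=> oJ JU; elim: n g => [|n IHn] g.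
  move=> cg t Jt; apply: (@continuous_comp _ _ _ (line i c)); last exact/cg/JU.
  apply: cvgD; first exact: cvg_cst.
  by apply: cvgZr_tmp; exact: cvg_id.
move=> [dg cg]; have H t (Jt : J t) := is_derive_line (dg _ (JU t Jt)).
split=> [t /H[]//|].
apply: (@Cn1_eq _ _ (fun t => partial i g (line i c t))) => //.
  by move=> t /H[_ <-]; rewrite derive1E.
apply: (IHn _ (cg i)).
Qed.

Lemma line0E i t : line i 0 t ord0 i = t.
Proof. by rewrite /line add0r !mxE !eqxx mulr1. Qed.

(** Identifies one-variable regularity with that of a function of the first coordinate of a row, so
    that sums, products and composites are inherited from [Cn_on]. *)
Lemma Cn1_of_row n J (phi : R -> R) : open J ->
  Cn_on n [set x : V4 | J (x ord0 ord0)] (fun x => phi (x ord0 ord0)) <-> Cn1 n J phi.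
Proof.
move=> oJ; split=> H.
  have := @Cn1_line n _ J ord0 0 _ oJ _ H.
  have -> : (fun t => phi (line ord0 0 t ord0 ord0)) = phi.
    by apply/funext => t; rewrite line0E.
  by apply=> t Jt; rewrite /= line0E.
apply: Cn_on_comp1 H _ => //; [exact: open_coord | exact: Cn_on_coord].
Qed.

Lemma Cn1D n J (g h : R -> R) : open J -> Cn1 n J g -> Cn1 n J h ->
  Cn1 n J (fun x => g x + h x).
Proof.
move=> oJ cg ch; apply/Cn1_of_row => //; apply: Cn_onD; first exact: open_coord.
  exact/Cn1_of_row.
exact/Cn1_of_row.
Qed.

Lemma Cn1M n J (g h : R -> R) : open J -> Cn1 n J g -> Cn1 n J h ->
  Cn1 n J (fun x => g x * h x).
Proof.
move=> oJ cg ch; apply/Cn1_of_row => //; apply: Cn_onM; first exact: open_coord.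
  exact/Cn1_of_row.
exact/Cn1_of_row.
Qed.

Lemma Cn1_cst n J (c : R) : open J -> Cn1 n J (fun=> c).
Proof. by move=> oJ; apply/Cn1_of_row => //; exact: Cn_on_cst. Qed.

Lemma Cn1_id n J : open J -> Cn1 n J id.
Proof. by move=> oJ; apply/Cn1_of_row => //; exact: Cn_on_coord. Qed.

Lemma Cn1_comp n J J' (phi g : R -> R) : open J -> (forall x, J x -> J' (g x)) ->
  Cn1 n J' phi -> Cn1 n J g -> Cn1 n J (fun x => phi (g x)).
Proof.
move=> oJ JJ' cp cg; apply/Cn1_of_row => //.
apply: (@Cn_on_comp1 _ _ J' phi (fun x => g (x ord0 ord0))) => //.
- exact: open_coord.
- by move=> x /JJ'.
- exact/Cn1_of_row.
Qed.

Lemma Cn1_bootstrap J (g : R -> R) : (forall x, J x -> derivable g x 1) ->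
  (forall n, Cn1 n J g -> Cn1 n J (derive1 g)) -> Sm J g.
Proof.
move=> dg H; elim=> [|n IHn] /=; last by split=> //; exact: H.
by move=> x /dg/derivable1_diffP; exact: differentiable_continuous.
Qed.

Lemma Sm_derive1 J (g : R -> R) : Sm J g -> Sm J (derive1 g).
Proof. by move=> sg n; have [] := sg n.+1. Qed.

Lemma Sm_derivable J (g : R -> R) : Sm J g -> forall x, J x -> derivable g x 1.
Proof. by move=> sg; have [] := sg 1%N. Qed.

(** The derivative is - (1 / x) ^ 2, a polynomial in the function itself, so the bootstrap
    applies. *)
Lemma Sm_inv : Sm [set x : R | x != 0] GRing.inv.
Proof.
apply: Cn1_bootstrap => [x /= x0|n cn].
  by apply: derivableV => //; exact: derivable_id.
have o0 : open [set x : R | x != 0] by exact: open_neq.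
apply: (@Cn1_eq _ _ (fun x : R => -1 * (x^-1 * x^-1))) => //.
  move=> x /= x0; have [_] := is_deriveV x0 (is_derive_id x (1 : R)).
  by rewrite derive1E => ->; rewrite [_ *: _]mulr1 mulN1r -expr2 exprVn.
by apply: Cn1M => //; [exact: Cn1_cst | exact: Cn1M].
Qed.

Lemma Sm_sqrt : Sm [set x : R | 0 < x] Num.sqrt.
Proof.
have o0 : open [set x : R | 0 < x] by exact: open_gt.
apply: Cn1_bootstrap => [x /= x0|n cn].
  by have [] := is_derive1_sqrt x0.
apply: (@Cn1_eq _ _ (fun x : R => (2 * Num.sqrt x)^-1)) => //.
  by move=> x /= x0; have [_ <-] := is_derive1_sqrt x0; rewrite derive1E.
apply: (@Cn1_comp _ _ [set x | x != 0] GRing.inv (fun x => 2 * Num.sqrt x)) => //.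
- by move=> x /= x0; rewrite mulf_neq0// gt_eqF// sqrtr_gt0.
- exact: Sm_inv.
- by apply: Cn1M => //; exact: Cn1_cst.
Qed.

Lemma smooth1_Sm (g : R -> R) : smooth1 g -> Sm setT g.
Proof.
move=> sg n; elim: n g sg => [|n IHn] g sg /=.
  by move=> x _; have /derivable1_diffP/differentiable_continuous := sg 0%N x.
by split=> [x _|]; [exact: (sg 0%N)|apply: IHn => k x; have := sg k.+1 x; rewrite derive1Sn].
Qed.

End SmoothFunctions1.

(** * Averages along segments and Taylor remainders *)

Section UnitIntegral.
Context {R : realType}.
Local Notation mu := (@lebesgue_measure R).

Definition Int01 (h : R -> R) : R := \int[mu]_(u in `[0, 1]) h u.

(** Two-sided continuity, endpoints included: the integrands below live on a neighbourhood of
    [0, 1], and this form is directly stable under the operations on functions continuous at a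
    point. *)
Definition cont01 (h : R -> R) : Prop :=
  forall u : R, 0 <= u <= 1 -> {for u, continuous h}.

Implicit Types g h : R -> R.

Lemma cont01_within h : cont01 h -> {within `[0, 1], continuous h}.
Proof.
move=> ch; apply: continuous_in_subspaceT => u.
by rewrite inE/= ?in_itv/= => /ch.
Qed.

Lemma cont01_integrable h : cont01 h -> mu.-integrable `[0, 1] (EFin \o h).
Proof.
move=> ch; apply: continuous_compact_integrable; first exact: segment_compact.
exact: cont01_within.
Qed.

Lemma Int01D g h : cont01 g -> cont01 h ->
  Int01 (fun u => g u + h u) = Int01 g + Int01 h.
Proof. by move=> cg ch; rewrite /Int01 RintegralD//; exact: cont01_integrable. Qed.

Lemma Int01B g h : cont01 g -> cont01 h ->
  Int01 (fun u => g u - h u) = Int01 g - Int01 h.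
Proof. by move=> cg ch; rewrite /Int01 RintegralB//; exact: cont01_integrable. Qed.

Lemma Int01Z c h : cont01 h -> Int01 (fun u => c * h u) = c * Int01 h.
Proof. by move=> ch; rewrite /Int01 RintegralZl//; exact: cont01_integrable. Qed.

Lemma Int01_cst c : Int01 (fun=> c) = c.
Proof.
rewrite /Int01 Rintegral_cst//= lebesgue_measure_itv/= lte_fin ltr01.
by rewrite -EFinD/= subr0 mulr1.
Qed.

Lemma Int01_norm_le h c : cont01 h ->
  (forall u, 0 <= u <= 1 -> `|h u| <= c) -> `|Int01 h| <= c.
Proof.
move=> ch hc; have ih := cont01_integrable ch.
rewrite -[leRHS]Int01_cst.
apply: (le_trans (le_normr_Rintegral _ ih)) => //.
apply: le_Rintegral => //.
- apply: (@cont01_integrable (fun u => `|h u|)) => u /ch cu.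
  by apply: (@continuous_comp R R R h Num.norm) => //; exact: norm_continuous.
- by apply: (@cont01_integrable (fun=> c)) => u _; exact: cst_continuous.
Qed.

Lemma Int01_ext g h : (forall u, 0 <= u <= 1 -> g u = h u) -> Int01 g = Int01 h.
Proof.
move=> gh; apply: eq_Rintegral => u; rewrite inE/= ?in_itv/= => u01.
exact: gh.
Qed.

Lemma Int01_FTC (F f : R -> R) : (forall u : R, 0 <= u <= 1 -> is_derive u (1 : R) F (f u)) ->
  cont01 f -> Int01 f = F 1 - F 0.
Proof.
move=> dF cf; rewrite /Int01 /Rintegral (@continuous_FTC2 _ _ F)//.
- exact: cont01_within.
- have cF u : 0 <= u <= 1 -> {for u, continuous F}.
    by move=> /dF[/derivable1_diffP/differentiable_continuous].
  split.
  + move=> u; rewrite in_itv/= => /andP[u0 u1].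
    by have [] : is_derive u (1 : R) F (f u) by apply: dF; rewrite !ltW.
  + by apply: cvg_at_right_filter; apply: cF; rewrite lexx ler01.
  + by apply: cvg_at_left_filter; apply: cF; rewrite lexx ler01.
- move=> u; rewrite in_itv/= => /andP[u0 u1]; rewrite derive1E.
  by have [_ ->] : is_derive u (1 : R) F (f u) by apply: dF; rewrite !ltW.
Qed.

End UnitIntegral.

Section SegmentAverages.
Context {R : realType}.
Local Notation V4 := 'rV[R]_4.
Variable J : set R.
Hypothesis oJ : open J.
Hypothesis cJ : forall x y u, J x -> J y -> 0 <= u <= 1 -> J ((1 - u) * x + u * y).

Definition segavg (a : nat) (g : R -> R) (x y : R) : R :=
  Int01 (fun u => u ^+ a * g ((1 - u) * x + u * y)).

Lemma convex_between a b z : J a -> J b -> a <= z <= b -> J z.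
Proof.
move=> Ja Jb /andP[az zb]; have [ab|ab] := eqVneq a b.
  by rewrite (_ : z = a)//; apply/eqP; rewrite eq_le az ab zb.
have ba : 0 < b - a by rewrite subr_gt0 lt_neqAle ab (le_trans az zb).
have -> : z = (1 - (z - a) / (b - a)) * a + (z - a) / (b - a) * b.
  by field; rewrite gt_eqF.
apply: cJ => //; rewrite divr_ge0 ?(ltW ba) ?subr_ge0//=.
by rewrite ler_pdivrMr// mul1r lerB.
Qed.

Lemma affine_continuous (x y : R) : continuous (fun u : R => (1 - u) * x + u * y).
Proof.
move=> u; apply: cvgD; apply: cvgM; try exact: cvg_cst; last exact: cvg_id.
by apply: cvgB; [exact: cvg_cst | exact: cvg_id].
Qed.

Lemma cont01_segavg a (g : R -> R) x y : (forall z, J z -> {for z, continuous g}) -> J x -> J y ->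
  cont01 (fun u => u ^+ a * g ((1 - u) * x + u * y)).
Proof.
move=> cg Jx Jy u u01; apply: continuousM; first exact: exprn_continuous.
apply: (@continuous_comp R R R (fun u => (1 - u) * x + u * y) g).
  exact: affine_continuous.
exact/cg/cJ.
Qed.

(** The order of z and z' is left open, and c is located by its distance to z, so that the lemma can
    be iterated in Taylor estimates. *)
Lemma MVT_between (g : R -> R) z z' : (forall t, J t -> derivable g t 1) -> J z -> J z' ->
  exists2 c, J c /\ `|c - z| <= `|z' - z| & g z' - g z = derive1 g c * (z' - z).
Proof.
move=> dg Jz Jz'.
have cw a b : J a -> J b -> {within `[a, b], continuous g}.
  move=> Ja Jb; apply: continuous_in_subspaceT => t; rewrite inE/= ?in_itv/= => tab.
  by apply: differentiable_continuous; apply/derivable1_diffP/dg; apply: convex_between tab.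
have di a b : J a -> J b -> forall t, t \in `]a, b[%R -> is_derive t 1 g (derive1 g t).
  move=> Ja Jb t; rewrite in_itv/= => /andP[ta tb].
  split; last by rewrite derive1E.
  by apply: dg; apply: (convex_between Ja Jb); rewrite !ltW.
have [zz'|z'z] := leP z z'.
  have [c + E] := MVT_segment zz' (di _ _ Jz Jz') (cw _ _ Jz Jz').
  rewrite in_itv/= => /andP[zc cz']; exists c => //; split.
    by apply: (convex_between Jz Jz'); rewrite zc.
  by rewrite !ger0_norm ?subr_ge0// lerB.
have [c + E] := MVT_segment (ltW z'z) (di _ _ Jz' Jz) (cw _ _ Jz' Jz).
rewrite in_itv/= => /andP[zc cz]; exists c.
  split; first by apply: (convex_between Jz' Jz); rewrite zc.
  by rewrite !ler0_norm ?subr_le0 ?(ltW z'z)// lerN2 lerB.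
by rewrite -opprB E -mulrN opprB.
Qed.

(** M and d serve all points z of the segment at once, which is what allows the estimate to be
    integrated along it. M is the maximum of |g''| on the segment enlarged by d at both ends. *)
Lemma taylor1_bound (g : R -> R) : Sm J g -> forall x y, J x -> J y ->
  exists2 M, 0 <= M & exists2 d, 0 < d &
    forall z z', Num.min x y <= z <= Num.max x y -> `|z' - z| <= d ->
    J z' /\ `|g z' - g z - (z' - z) * derive1 g z| <= M * (z' - z) ^+ 2.
Proof.
move=> sg x y Jx Jy.
set a := Num.min x y; set b := Num.max x y.
have Ja : J a by rewrite /a; case: ltP.
have Jb : J b by rewrite /b; case: ltP.
have ab : a <= b by rewrite ge_min le_max lexx.
have JE c : J c -> exists2 d : R, 0 < d & forall t, `|t - c| <= d -> J t.
  move=> Jc; have /nbhs_ballP[d /= d0 dJ] := open_nbhs_nbhs (conj oJ Jc).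
  exists (d / 2); rewrite ?divr_gt0// => t tc; apply: dJ.
  by rewrite /ball/= distrC (le_lt_trans tc)// gtr_pMr// invf_lt1// ltr1n.
have [d1 d10 H1] := JE _ Ja; have [d2 d20 H2] := JE _ Jb.
pose d := Num.min d1 d2.
have d0 : 0 < d by rewrite lt_min d10 d20.
have Jad : J (a - d).
  by apply: H1; rewrite addrC addKr normrN gtr0_norm// ge_min lexx.
have Jbd : J (b + d).
  by apply: H2; rewrite addrC addKr gtr0_norm// ge_min lexx orbT.
have JJ t : a - d <= t <= b + d -> J t by exact: convex_between.
have s1 := Sm_derive1 sg; have s2 := Sm_derive1 s1.
have adbd : a - d <= b + d.
  by rewrite (le_trans (_ : _ <= a)) ?gerBl ?(ltW d0)// (le_trans ab)// lerDl ltW.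
have cw : {within `[a - d, b + d], continuous (fun t => `|derive1 (derive1 g) t|)}.
  apply: continuous_in_subspaceT => t; rewrite inE/= ?in_itv/= => /JJ Jt.
  apply: (@continuous_comp R R R (derive1 (derive1 g)) Num.norm).
    exact: (Cn1_continuous (s2 0%N)).
  exact: norm_continuous.
have [c _ Hc] := EVT_max adbd cw.
exists (`|derive1 (derive1 g) c|) => //; exists d => // z z' /andP[az zb] zz'.
have Iz t : `|t - z| <= d -> a - d <= t <= b + d.
  rewrite ler_norml => /andP[h1 h2].
  by apply/andP; split; lra.
have Jz : J z by apply/JJ/Iz; rewrite subrr normr0 ltW.
have Jz' : J z' by exact/JJ/Iz.
split=> //.
have [t [Jt tz] ->] := MVT_between (Sm_derivable sg) Jz Jz'.
have [t' [Jt' t'z] E] := MVT_between (Sm_derivable s1) Jz Jt.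
have -> : derive1 g t * (z' - z) - (z' - z) * derive1 g z =
  (derive1 g t - derive1 g z) * (z' - z) by ring.
rewrite E !normrM -[(z' - z) ^+ 2]ger0_norm ?sqr_ge0// normrX expr2 -mulrA.
apply: ler_pM; [exact: normr_ge0|by rewrite mulr_ge0| |].
  by apply: Hc; rewrite in_itv/= Iz// (le_trans t'z)// (le_trans tz).
by rewrite ler_pM.
Qed.

End SegmentAverages.

Lemma sum4E (V : nmodType) (F : 'I_4 -> V) :
  \sum_i F i = F i_pr + F i_pphi + F i_r + F i_phi.
Proof.
rewrite !big_ord_recl big_ord0 addr0 !addrA.
by do ![congr (_ + _)]; congr F; apply: val_inj.
Qed.

Section SegmentAverages.
Context {R : realType}.
Local Notation V4 := 'rV[R]_4.
Variable J : set R.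
Hypothesis oJ : open J.
Hypothesis cJ : forall x y u, J x -> J y -> 0 <= u <= 1 -> J ((1 - u) * x + u * y).
Implicit Types g : R -> R.

Let cts g : Sm J g -> forall z, J z -> {for z, continuous g}.
Proof. by move=> sg; exact: Cn1_continuous (sg 0%N). Qed.

(** Differentiation under the integral sign: the chain rule puts 1 - u or u in front of g', whence A
    a - A a.+1 and A a.+1, and the error is the integral of the uniform Taylor remainder. *)
Lemma segavg_diff a g (p : V4) : Sm J g -> J (p ord0 i_pr) -> J (p ord0 i_pphi) ->
  let F (q : V4) := segavg a g (q ord0 i_pr) (q ord0 i_pphi) in
  let A n := segavg n (derive1 g) (p ord0 i_pr) (p ord0 i_pphi) in
  differentiable F p /\ forall i, partial i F p =
    if i == i_pr then A a - A a.+1 else if i == i_pphi then A a.+1 else 0.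
Proof.
move=> sg Jx Jy F A; apply: is_diff_eps => e e0.
have s1 := Sm_derive1 sg.
have [M M0 [d d0 H]] := taylor1_bound oJ cJ sg Jx Jy.
(* On a ball of this radius M |v| <= e, which turns the quadratic remainder M |v| ^ 2 into e |v|;
   the summand 1 keeps the denominator positive. *)
have dM : 0 < Num.min d (e / (M + 1)) by rewrite lt_min d0 divr_gt0// ltr_wpDl.
apply/nbhs_ballP; exists (Num.min d (e / (M + 1))) => // v.
rewrite -ball_normE/= sub0r normrN lt_min => /andP[vd ve].
rewrite sum4E /= mul0r addr0 mul0r addr0 /F /A.
set x := p ord0 i_pr; set y := p ord0 i_pphi.
set v0 := v ord0 i_pr; set v1 := v ord0 i_pphi.
rewrite !mxE -/x -/y -/v0 -/v1.
have v0v : `|v0| <= `|v| by exact: ler_coord_norm.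
have v1v : `|v1| <= `|v| by exact: ler_coord_norm.
have wv u : 0 <= u <= 1 -> `|(1 - u) * v0 + u * v1| <= `|v|.
  move=> /andP[u0 u1]; apply: (le_trans (ler_normD _ _)).
  rewrite !normrM (ger0_norm u0) ger0_norm ?subr_ge0//.
  have -> : `|v| = (1 - u) * `|v| + u * `|v| by ring.
  by apply: lerD; rewrite ler_wpM2l ?subr_ge0.
have zxy u : 0 <= u <= 1 ->
    Num.min x y <= (1 - u) * x + u * y <= Num.max x y.
  move=> /andP[u0 u1]; have u1' : 0 <= 1 - u by rewrite subr_ge0.
  have E t : t = (1 - u) * t + u * t by ring.
  apply/andP; split.
    by rewrite [leLHS]E; apply: lerD; rewrite ler_wpM2l// ge_min lexx ?orbT.
  by rewrite [leRHS]E; apply: lerD; rewrite ler_wpM2l// le_max lexx ?orbT.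
have zE u : (1 - u) * (v0 + x) + u * (v1 + y) =
  (1 - u) * x + u * y + ((1 - u) * v0 + u * v1) by ring.
have T u : 0 <= u <= 1 -> let z := (1 - u) * x + u * y in
    let w := (1 - u) * v0 + u * v1 in
    J (z + w) /\ `|g (z + w) - g z - w * derive1 g z| <= M * `|v| ^+ 2.
  move=> u01 z w; have [|Jz Tz] := H z (z + w) (zxy u u01) _.
    by rewrite addrC addKr (le_trans (wv _ u01))// ltW.
  split=> //; move: Tz; rewrite (addrC z w) addrK => /le_trans; apply.
  rewrite ler_wpM2l// -[w ^+ 2]ger0_norm ?sqr_ge0// normrX.
  by rewrite lerXn2r ?nnegrE//; exact: wv.
have I0 : 0 <= (0 : R) <= 1 by rewrite lexx ler01.
have I1 : 0 <= (1 : R) <= 1 by rewrite lexx ler01.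
have c0 : cont01 (fun u => u ^+ a * g ((1 - u) * x + u * y)).
  by apply: (@cont01_segavg _ J cJ) => //; exact: cts.
have cd n : cont01 (fun u => u ^+ n * derive1 g ((1 - u) * x + u * y)).
  by apply: (@cont01_segavg _ J cJ) => //; exact: (Cn1_continuous (s1 0%N)).
have cv : cont01 (fun u => u ^+ a * g ((1 - u) * (v0 + x) + u * (v1 + y))).
  apply: (@cont01_segavg _ J cJ) => //; first exact: cts.
    have [+ _] := T 0 I0; rewrite subr0 !mul1r !mul0r !addr0.
    by rewrite addrC.
  have [+ _] := T 1 I1; rewrite subrr !mul1r !mul0r !add0r.
  by rewrite addrC.
have cZ c h : cont01 h -> cont01 (fun u : R => c * h u).
  by move=> ch u u01; apply: continuousM; [exact: cst_continuous | exact: ch].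
have cB (h1 h2 : R -> R) : cont01 h1 -> cont01 h2 -> cont01 (fun u : R => h1 u - h2 u).
  by move=> ch1 ch2 u u01; apply: continuousB; [exact: ch1 | exact: ch2].
have cD (h1 h2 : R -> R) : cont01 h1 -> cont01 h2 -> cont01 (fun u : R => h1 u + h2 u).
  by move=> ch1 ch2 u u01; apply: continuousD; [exact: ch1 | exact: ch2].
rewrite /segavg -Int01B// (mulrC _ v0) (mulrC _ v1) -(Int01B (cd a)) ?cd//.
rewrite -!Int01Z//; [|exact: cB].
rewrite -Int01D//; [|exact/cZ/cB|exact: cZ].
rewrite -Int01B; [|exact: cB|by apply: (cD); apply: (cZ) => //; exact: cB].
apply: (@le_trans _ _ (M * `|v| ^+ 2)).
  apply: Int01_norm_le => [|u u01].
    by apply: (cB); [exact: cB|apply: (cD); apply: (cZ) => //; exact: cB].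
  have [_] := T u u01; rewrite zE; set z := (_ + u * y); set w := (_ + u * v1).
  have -> : u ^+ a * g (z + w) - u ^+ a * g z - (v0 * (u ^+ a * derive1 g z -
     u ^+ a.+1 * derive1 g z) + v1 * (u ^+ a.+1 * derive1 g z)) =
     u ^+ a * (g (z + w) - g z - w * derive1 g z) by rewrite /w exprS; ring.
  move: u01 => /andP[u0 u1]; rewrite normrM ger0_norm ?exprn_ge0//.
  by apply: le_trans; rewrite ler_piMl// exprn_ile1.
rewrite expr2 mulrA ler_wpM2r// (@le_trans _ _ (M * (e / (M + 1))))//.
  by rewrite ler_wpM2l// ltW.
rewrite mulrA ler_pdivrMr; last by rewrite ltr_wpDl.
by rewrite mulrC ler_wpM2l ?(ltW e0)// lerDl.
Qed.

(** The induction runs with a and g arbitrary, since the partial derivatives are averages of g' with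
    exponents a and a + 1. *)
Lemma segavg_smooth a g : Sm J g ->
  smooth_on [set q : V4 | J (q ord0 i_pr) /\ J (q ord0 i_pphi)]
    (fun q => segavg a g (q ord0 i_pr) (q ord0 i_pphi)).
Proof.
set U := [set q : V4 | _]; have oU : open U.
  apply: (@openI _ [set q : V4 | J (q ord0 i_pr)] [set q : V4 | J (q ord0 i_pphi)]).
    exact: open_coord.
  exact: open_coord.
move=> sg n; elim: n a g sg => [|n IHn] a g sg.
  move=> p [Jx Jy]; have [+ _] := segavg_diff a sg Jx Jy.
  exact: differentiable_continuous.
have s1 := Sm_derive1 sg.
split=> [p [Jx Jy]|i]; first by have [] := segavg_diff a sg Jx Jy.
pose A n (q : V4) := segavg n (derive1 g) (q ord0 i_pr) (q ord0 i_pphi).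
apply: (@Cn_on_eq _ _ _ (fun q =>
    if i == i_pr then A a q - A a.+1 q else if i == i_pphi then A a.+1 q else 0)) => //.
  by move=> q [Jx Jy]; have [_ ->] := segavg_diff a sg Jx Jy.
have cA k : Cn_on n U (A k) by exact: IHn.
case: (i == i_pr); last by case: (i == i_pphi) => //; exact: Cn_on_cst.
apply: (@Cn_on_eq _ _ _ (fun q => A a q + -1 * A a.+1 q)) => //.
  by move=> q _; rewrite mulN1r.
by apply: Cn_onD => //; apply: Cn_onM => //; exact: Cn_on_cst.
Qed.

Lemma is_derive_seg (x y u : R) :
  is_derive u (1 : R) (fun u : R => (1 - u) * x + u * y) (y - x).
Proof. by apply: is_derive_eq; rewrite /GRing.scale/=; ring. Qed.

Lemma segavg_taylor1 g x y : Sm J g -> J x -> J y ->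
  g y - g x = (y - x) * segavg 0 (derive1 g) x y.
Proof.
move=> sg Jx Jy; have s1 := Sm_derive1 sg.
pose z (u : R) := (1 - u) * x + u * y.
rewrite -Int01Z; last by apply: (@cont01_segavg _ J cJ) => //; exact: cts.
have H1 (u : R) : 0 <= u <= 1 -> is_derive u (1 : R) (fun u => g (z u))
    ((y - x) * (u ^+ 0 * derive1 g (z u))).
  move=> u01; have dg : is_derive (z u) (1 : R) g (derive1 g (z u)).
    by split; [apply: (Sm_derivable sg); exact: cJ | rewrite derive1E].
  apply: (is_derive_eq (is_derive1_comp dg (is_derive_seg x y u))).
  by rewrite mul1r mulrC.
rewrite (Int01_FTC H1); last first.
  move=> u u01; apply: continuousM; first exact: cst_continuous.
  by apply: (@cont01_segavg _ J cJ 0) => //; exact: cts.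
by rewrite /z subr0 subrr !mul1r !mul0r addr0 add0r.
Qed.

Lemma segavg_taylor2 g x y : Sm J g -> J x -> J y ->
  g y - g x - (y - x) * derive1 g x =
  (y - x) ^+ 2 * (segavg 0 (derive1 (derive1 g)) x y - segavg 1 (derive1 (derive1 g)) x y).
Proof.
move=> sg Jx Jy; have s1 := Sm_derive1 sg; have s2 := Sm_derive1 s1.
pose z (u : R) := (1 - u) * x + u * y.
have c2 n : cont01 (fun u : R => u ^+ n * derive1 (derive1 g) (z u)).
  by apply: (@cont01_segavg _ J cJ) => //; exact: cts.
have cB : cont01 (fun u : R => u ^+ 0 * derive1 (derive1 g) (z u) -
    u ^+ 1 * derive1 (derive1 g) (z u)).
  by move=> u u01; apply: continuousB; exact: c2.
rewrite /segavg -Int01B; [|exact: c2|exact: c2].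
rewrite -Int01Z; last exact: cB.
(* The terms in g' cancel in this derivative, leaving the weight 1 - u in front of g''; the
   fundamental theorem of calculus then gives the remainder. *)
have H1 (u : R) : 0 <= u <= 1 -> is_derive u (1 : R)
    (fun u => g (z u) + (y - x) * ((1 - u) * derive1 g (z u)))
    ((y - x) ^+ 2 * (u ^+ 0 * derive1 (derive1 g) (z u) -
      u ^+ 1 * derive1 (derive1 g) (z u))).
  move=> u01; have Jz : J (z u) by exact: cJ.
  have dz := is_derive_seg x y u.
  have d0 : is_derive (z u) (1 : R) g (derive1 g (z u)).
    by split; [exact: (Sm_derivable sg) | rewrite derive1E].
  have d1 : is_derive (z u) (1 : R) (derive1 g) (derive1 (derive1 g) (z u)).
    by split; [exact: (Sm_derivable s1) | rewrite [RHS]derive1E].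
  have e0 := is_derive1_comp d0 dz; have e1 := is_derive1_comp d1 dz.
  apply: (is_derive_eq (is_deriveD e0 (is_deriveZ (y - x) (is_deriveM
     (is_deriveB (is_derive_cst (1 : R) u 1) (is_derive_id u (1 : R))) e1)))).
  rewrite /GRing.scale/= sub0r mulrN1 expr0 expr1 mul1r expr2 /z.
  by rewrite (_ : (cst 1 - id) u = 1 - u)//; ring.
rewrite (Int01_FTC H1); last first.
  by move=> u u01; apply: continuousM; [exact: cst_continuous|exact: cB].
rewrite /z subr0 subrr !mul1r !mul0r addr0 add0r; ring.
Qed.

End SegmentAverages.

(** * Borel's theorem and smooth even functions *)

Section Borel.
Context {R : realType}.

Lemma is_derive1_eps (F : R -> R) x l :
  (forall e, 0 < e -> \forall h \near (0 : R), `|F (h + x) - F x - h * l| <= e * `|h|) ->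
  is_derive x (1 : R) F l.
Proof.
move=> H.
have Fl : h^-1 *: ((F \o shift x) (h *: (1 : R)) - F x) @[h --> 0^'] --> l.
  apply/cvgrPdist_le => e e0; near=> h.
  have h0 : h != 0 by near: h; exact: nbhs_dnbhs_neq.
  rewrite /= [h%:A]mulr1 /GRing.scale/=.
  have -> : l - h^-1 * (F (h + x) - F x) = - (h^-1 * (F (h + x) - F x - h * l)).
    by field.
  rewrite normrN normrM normfV mulrC ler_pdivrMr ?normr_gt0//.
  by near: h; apply: nbhs_dnbhs; exact: H.
by split; [apply/cvg_ex; exists l | exact/cvg_lim].
Unshelve. all: by end_near. Qed.

(** Proves smoothness of a whole tower of successive derivatives at once, which suits functions that
    are summed or glued order by order. *)
Lemma Sm_family (J : set R) (G : nat -> R -> R) : open J ->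
  (forall m t, J t -> is_derive t (1 : R) (G m) (G m.+1 t)) -> forall m, Sm J (G m).
Proof.
move=> oJ dG m n; elim: n m => [|n IHn] m.
  by move=> t /(dG m)[/derivable1_diffP/differentiable_continuous].
split=> [t /(dG m)[]//|]; apply: Cn1_eq (IHn m.+1) => // t /(dG m)[_ <-].
by rewrite derive1E.
Qed.

(** The m-th derivative of sin ^ i cos ^ j. The predecessors at 0 are harmless, as their
    coefficients vanish. Powers of the sine replace the usual cutoff functions in Borel's theorem:
    they vanish to a prescribed order at 0 and have bounded derivatives on the whole line. *)
Fixpoint trig (m i j : nat) (y : R) : R :=
  if m is m'.+1 then i%:R * trig m' i.-1 j.+1 y - j%:R * trig m' i.+1 j.-1 y
  else sin y ^+ i * cos y ^+ j.

Lemma is_derive_trig m i j y : is_derive y (1 : R) (trig m i j) (trig m.+1 i j y).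
Proof.
elim: m i j => [|m IHm] i j /=.
  have H := is_deriveM (is_deriveX i (is_derive_sin y)) (is_deriveX j (is_derive_cos y)).
  have E : (sin ^+ i * cos ^+ j : R -> R) = fun t => sin t ^+ i * cos t ^+ j.
    by apply/funext => t; rewrite !fctE.
  rewrite E {E} in H; apply: (is_derive_eq H) => {H}.
  rewrite !fctE /GRing.scale/=.
  by case: i => [|i]; case: j => [|j] /=; rewrite ?exprS; ring.
by apply: is_deriveB; apply: is_deriveZ; exact: IHm.
Qed.

(** Each differentiation yields two terms whose coefficients add up to i + j in absolute value, and
    the total degree i + j is preserved. *)
Lemma trig_bound m i j y : `|trig m i j y| <= (i + j)%:R ^+ m.
Proof.
elim: m i j => [|m IHm] i j /=.
  rewrite expr0 normrM !normrX mulr_ile1// exprn_ile1// ler_norml.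
    by rewrite sin_geN1 sin_le1.
  by rewrite cos_geN1 cos_le1.
rewrite exprS [X in _ <= X * _]natrD mulrDl; apply: (le_trans (ler_normB _ _)); apply: lerD.
  case: i => [|i]; first by rewrite mul0r normr0 mul0r.
  by rewrite normrM normr_nat ler_wpM2l// addSnnS IHm.
case: j => [|j]; first by rewrite mul0r normr0 mul0r.
by rewrite normrM normr_nat ler_wpM2l// -addSnnS IHm.
Qed.

Lemma trig_lt0 m i j : (m < i)%N -> trig m i j 0 = 0.
Proof.
elim: m i j => [|m IHm] [//|i] j mi /=; first by rewrite sin0 expr0n mul0r.
by rewrite !IHm ?mulr0 ?subrr// ltnW// ltnW.
Qed.

(** At 0 only the terms that lower the exponent of the sine at every step survive, and their
    coefficients multiply to i!. *)
Lemma trig_diag0 i j : trig i i j 0 = i`!%:R.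
Proof.
elim: i j => [|i IHi] j /=; first by rewrite expr0 mul1r cos0 expr1n.
by rewrite IHi trig_lt0 1?ltnW// mulr0 subr0 factS natrM.
Qed.

Lemma strong_recursion (step : nat -> (nat -> R) -> R) :
  (forall n u v, (forall k, (k < n)%N -> u k = v k) -> step n u = step n v) ->
  exists al : nat -> R, forall n, al n = step n al.
Proof.
move=> step_ext.
(* The list of the first n values; the default 0 of [nth] beyond them does not affect [step n], by
   [step_ext]. *)
pose fix pre n : seq R := if n is n'.+1 then rcons (pre n') (step n' (nth 0 (pre n')))
  else [::].
have sp n : size (pre n) = n by elim: n => //= n IHn; rewrite size_rcons IHn.
pose al n := nth 0 (pre n.+1) n; exists al => n.
have alE m k : (k < m)%N -> nth 0 (pre m) k = al k.
  elim: m => // m IHm; rewrite ltnS leq_eqVlt => /predU1P[->//|km].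
  by rewrite /= nth_rcons sp km IHm.
rewrite /al/= nth_rcons sp ltnn eqxx; apply: step_ext => k kn; exact: alE.
Qed.

Lemma taylor1_global (T0 T1 T2 : R -> R) K :
  (forall t, is_derive t (1 : R) T0 (T1 t)) -> (forall t, is_derive t (1 : R) T1 (T2 t)) ->
  (forall t, `|T2 t| <= K) ->
  forall t h, `|T0 (h + t) - T0 t - h * T1 t| <= K * h ^+ 2.
Proof.
move=> d0 d1 TK t h.
have cT (x y u : R) : setT x -> setT y -> 0 <= u <= 1 ->
  (setT : set R) ((1 - u) * x + u * y) by [].
have [c [_ ct] E] := @MVT_between _ _ cT T0 t (h + t)
  (fun s _ => @ex_derive _ _ _ _ _ _ _ (d0 s)) I I.
have [c' [_ _] E'] := @MVT_between _ _ cT T1 t c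
  (fun s _ => @ex_derive _ _ _ _ _ _ _ (d1 s)) I I.
rewrite addrK in ct E; rewrite E derive1E derive_val.
have -> : T1 c * h - h * T1 t = (T1 c - T1 t) * h by ring.
rewrite E' derive1E derive_val !normrM -mulrA.
have K0 : 0 <= K by exact: le_trans (TK t).
rewrite -[h ^+ 2]ger0_norm ?sqr_ge0// normrX expr2.
by apply: ler_pM => //; exact: ler_wpM2r.
Qed.

Lemma geometric_dominated_cvg (u : nat -> R) C : (forall n, `|u n| <= C * 2^-1 ^+ n) ->
  cvgn (series u).
Proof.
move=> uC; apply: normed_cvg.
apply: (@series_le_cvg _ _ (geometric C 2^-1)) => //.
- by move=> n; exact: normr_ge0.
- by move=> n; exact: le_trans (uC n).
- by apply: is_cvg_geometric_series; rewrite ger0_norm// invf_lt1// ltr1n.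
Qed.

Lemma geometric_dominated_le (u : nat -> R) C : (forall n, `|u n| <= C * 2^-1 ^+ n) ->
  `|limn (series u)| <= C * 2.
Proof.
move=> uC; have cu := geometric_dominated_cvg uC.
have q1 : `|2^-1 : R| < 1 by rewrite ger0_norm// invf_lt1// ltr1n.
have C0 : 0 <= C by have := uC 0%N; rewrite expr0 mulr1; exact: le_trans.
rewrite -lim_norm//; apply: limr_le; first exact: is_cvg_norm.
near=> n; rewrite /series/=; apply: (le_trans (ler_norm_sum _ _ _)).
apply: (@le_trans _ _ (series (geometric C 2^-1) n)).
  by apply: ler_sum => k _; exact: uC.
apply: (le_trans (geometric_le_lim n C0 _ q1)); first by rewrite invr_gt0.
by rewrite le_eqVlt; apply/orP; left; apply/eqP; field.
Unshelve. all: by end_near. Qed.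

(** The bound on second derivatives makes the first-order error of the n-th term at most C h ^ 2 / 2
    ^ n, so that the errors add up to at most 2 C h ^ 2. *)
Lemma is_derive_series (T0 T1 T2 : nat -> R -> R) C :
  (forall n t, is_derive t (1 : R) (T0 n) (T1 n t)) ->
  (forall n t, is_derive t (1 : R) (T1 n) (T2 n t)) ->
  (forall n t, `|T0 n t| <= C * 2^-1 ^+ n) ->
  (forall n t, `|T1 n t| <= C * 2^-1 ^+ n) ->
  (forall n t, `|T2 n t| <= C * 2^-1 ^+ n) ->
  forall t, is_derive t (1 : R) (fun s => limn (series (T0 ^~ s)))
    (limn (series (T1 ^~ t))).
Proof.
move=> d0 d1 b0 b1 b2 t; apply: is_derive1_eps => e e0.
have C0 : 0 <= C by have := b0 0%N 0; rewrite expr0 mulr1; exact: le_trans.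
have d : 0 < e / (C * 2 + 1) by rewrite divr_gt0// ltr_wpDl// mulr_ge0.
apply/nbhs_ballP; exists (e / (C * 2 + 1)) => // h.
rewrite /ball/= sub0r normrN => he.
pose u n := T0 n (h + t) - T0 n t - h * T1 n t.
have uC n : `|u n| <= (C * h ^+ 2) * 2^-1 ^+ n.
  by rewrite mulrAC; exact: (taylor1_global (d0 n) (d1 n) (b2 n)).
have c0 s : cvgn (series (T0 ^~ s)) by apply: geometric_dominated_cvg => n; exact: b0.
have c1 s : cvgn (series (T1 ^~ s)) by apply: geometric_dominated_cvg => n; exact: b1.
have su : series u = fun n => series (T0 ^~ (h + t)) n - series (T0 ^~ t) n -
    h * series (T1 ^~ t) n.
  apply/funext => n; rewrite /series/= -sumrB mulr_sumr -sumrB.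
  by apply: eq_bigr => k _.
have <- : limn (series u) = limn (series (T0 ^~ (h + t))) - limn (series (T0 ^~ t)) -
    h * limn (series (T1 ^~ t)).
  apply: cvg_lim => //; rewrite su; apply: cvgB; first by apply: cvgB; exact: c0.
  by apply: cvgM; [exact: cvg_cst | exact: c1].
apply: (le_trans (geometric_dominated_le uC)).
rewrite -[h ^+ 2]ger0_norm ?sqr_ge0// normrX expr2 mulrAC mulrA ler_wpM2r//.
apply: (@le_trans _ _ (C * 2 * (e / (C * 2 + 1)))).
  by rewrite ler_wpM2l ?mulr_ge0// ltW.
rewrite mulrA ler_pdivrMr ?ltr_wpDl// ?mulr_ge0//.
by rewrite mulrC ler_wpM2l ?(ltW e0)// lerDl.
Qed.

(* [B] is the sum of [al n * (sin (b n * t) / b n) ^+ n]: the n-th term vanishes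
   to order n at 0, so [al n] can be adjusted recursively, and a large [b n]
   makes all the derivatives of orders less than n at most [2 ^- n]. *)
Lemma borel (a : nat -> R) : exists B : nat -> R -> R,
  (forall m t, is_derive t (1 : R) (B m) (B m.+1 t)) /\ forall m, B m 0 = a m.
Proof.
(* The scale is at least 1 and exceeds 2 ^ n |al n| n ^ n, which is what the bound on the m-th
   derivative requires for m < n. *)
pose bb n (x : R) := 1 + 2 ^+ n * `|x| * n%:R ^+ n.
(* Solves for [al n] the equation that the n-th derivative at 0 be [a n]: the terms of index above n
   contribute 0, and the n-th one contributes al n * n!, its powers of the scale cancelling. *)
pose step n (u : nat -> R) := (a n - \sum_(k < n) u k / bb k (u k) ^+ k *
  bb k (u k) ^+ n * trig n k 0 0) / n`!%:R.
have [|al alE] := strong_recursion (step := step).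
  move=> n u v uv; rewrite /step; congr ((_ - _) / _); apply: eq_bigr => k _.
  by rewrite uv.
pose b n := bb n (al n).
have b1 n : 1 <= b n by rewrite /b /bb lerDl !mulr_ge0// exprn_ge0.
have b0 n : 0 < b n by exact: lt_le_trans (b1 n).
pose T n m t := al n / b n ^+ n * b n ^+ m * trig m n 0 (b n * t).
have dT n m t : is_derive t (1 : R) (T n m) (T n m.+1 t).
  have dl : is_derive t (1 : R) (fun s => b n * s) (b n).
    by apply: is_derive_eq; rewrite /GRing.scale/= mulr1.
  have H := is_deriveZ (al n / b n ^+ n * b n ^+ m)
    (is_derive1_comp (is_derive_trig m n 0 (b n * t)) dl).
  apply: (is_derive_eq H).
  rewrite /T [in RHS]exprS; move: (trig m.+1 n 0 (b n * t)) => w.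
  by rewrite /GRing.scale/=; ring.
pose K m n := `|al n| * b n ^+ m * n%:R ^+ m.
(* For n > m the choice of [b n] gives the constant 1; the finitely many n <= m are absorbed by the
   sum. *)
pose C m := 1 + \sum_(n < m.+1) 2 ^+ n * K m n.
have K0 m n : 0 <= K m n by rewrite /K !mulr_ge0// exprn_ge0// ltW.
have C1 m : 1 <= C m by rewrite /C lerDl sumr_ge0// => k _; rewrite mulr_ge0// exprn_ge0.
have TK n m t : `|T n m t| <= `|al n| / b n ^+ n * b n ^+ m * n%:R ^+ m.
  rewrite /T !normrM normfV !normrX !(gtr0_norm (b0 n)).
  by rewrite ler_wpM2l ?mulr_ge0 ?invr_ge0 ?exprn_ge0 ?(ltW (b0 n))// -[n in n%:R]addn0 trig_bound.
have TC n m t : `|T n m t| <= C m * 2^-1 ^+ n.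
  apply: (le_trans (TK n m t)); rewrite exprVn ler_pdivlMr ?exprn_gt0//.
  have [nm|mn] := ltnP n m.+1.
    apply: (@le_trans _ _ (2 ^+ n * K m n)).
      rewrite mulrC ler_wpM2l ?exprn_ge0// /K ler_wpM2r ?exprn_ge0//.
      rewrite ler_wpM2r ?exprn_ge0 ?(ltW (b0 n))//.
      by rewrite ler_piMr// invf_le1 ?exprn_gt0// exprn_ege1.
    rewrite /C (bigD1 (Ordinal nm))//= addrCA lerDl addr_ge0// sumr_ge0// => k _.
    by rewrite mulr_ge0// exprn_ge0.
  apply: le_trans (C1 m).
  have E : `|al n| / b n ^+ n * b n ^+ m * n%:R ^+ m * 2 ^+ n <=
      (2 ^+ n * `|al n| * n%:R ^+ n) / b n.
    have -> : `|al n| / b n ^+ n * b n ^+ m * n%:R ^+ m * 2 ^+ n =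
      (2 ^+ n * `|al n|) * (n%:R ^+ m * (b n ^+ m / b n ^+ n)) by ring.
    rewrite -(mulrA (2 ^+ n * _)) ler_wpM2l ?mulr_ge0 ?exprn_ge0//.
    apply: ler_pM; rewrite ?mulr_ge0 ?invr_ge0 ?exprn_ge0 ?(ltW (b0 n))//.
      by rewrite ler_weXn2l ?(ltnW mn)// ler1n (leq_trans _ mn).
    rewrite ler_pdivrMr ?exprn_gt0// mulrC ler_pdivlMr// -exprSr.
    by rewrite ler_weXn2l.
  apply: (le_trans E); rewrite ler_pdivrMr// mul1r /b /bb lerDr.
  exact: ler01.
pose B m t := limn (series (fun n => T n m t)).
exists B; split=> [m t|m].
  pose D := C m + C m.+1 + C m.+2.
  have CD k : 0 <= C k by exact: le_trans (C1 k).
  have q0 n : 0 <= (2^-1 : R) ^+ n by rewrite exprn_ge0// invr_ge0.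
  apply: (@is_derive_series (fun n => T n m) (fun n => T n m.+1) (fun n => T n m.+2) D) => // n s.
  - by apply: (le_trans (TC _ _ _)); rewrite ler_wpM2r// /D -addrA lerDl addr_ge0.
  - by apply: (le_trans (TC _ _ _)); rewrite ler_wpM2r// /D addrAC lerDr addr_ge0.
  - by apply: (le_trans (TC _ _ _)); rewrite ler_wpM2r// /D lerDr addr_ge0.
have T0 n : (m < n)%N -> T n m 0 = 0 by move=> mn; rewrite /T mulr0 trig_lt0// mulr0.
have TE : \sum_(n < m.+1) T n m 0 = a m.
  rewrite big_ord_recr/= {2}/T mulr0 trig_diag0 divfK ?expf_neq0 ?gt_eqF//.
  have SE : \sum_(k < m) al k / bb k (al k) ^+ k * bb k (al k) ^+ m * trig m k 0 0 =
      \sum_(k < m) T k m 0 by apply: eq_bigr => k _; rewrite /T mulr0.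
  by rewrite alE /step SE divfK ?pnatr_eq0 -?lt0n ?fact_gt0// addrC subrK.
apply: cvg_lim => //; apply: cvg_near_cst; near=> N.
have mN : (m.+1 <= N)%N by near: N; exact: nbhs_infty_ge.
rewrite /series/= (big_cat_nat (leq0n m.+1) mN)//= big_mkord TE big1_seq ?addr0// => k.
by rewrite mem_index_iota => /andP[_ /andP[mk _]]; exact: T0.
Unshelve. all: by end_near. Qed.

End Borel.

(** * Smooth even functions as smooth functions of the square *)

Section Whitney.
Context {R : realType}.
Local Notation V4 := 'rV[R]_4.

Definition sball (d : R) : set R := [set s | `|s| < d].

Lemma open_sball d : open (sball d).
Proof.
have -> : sball d = Num.norm @^-1` [set x : R | x < d] by [].
by apply: open_comp; [move=> x _; exact: norm_continuous | exact: open_lt].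
Qed.

Lemma sball_convex d x y u : sball d x -> sball d y -> 0 <= u <= 1 ->
  sball d ((1 - u) * x + u * y).
Proof.
rewrite /sball/= !ltr_norml => /andP[a b] /andP[a' b'] /andP[u0 u1].
have u1' : 0 <= 1 - u by rewrite subr_ge0.
have [->|uN0] := eqVneq u 0; first by rewrite subr0 mul1r mul0r addr0 a b.
have {uN0} u0' : 0 < u by rewrite lt_neqAle eq_sym uN0.
have E t : t = (1 - u) * t + u * t by ring.
apply/andP; split.
  by rewrite [ltLHS]E ler_ltD// ?ltr_pM2l// ler_wpM2l// ltW.
by rewrite [ltRHS]E ler_ltD// ?ltr_pM2l// ler_wpM2l// ltW.
Qed.

Lemma sballN d s : sball d s -> sball d (- s).
Proof. by rewrite /sball/= normrN. Qed.

Lemma sball0 d : 0 < d -> sball d 0.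
Proof. by rewrite /sball/= normr0. Qed.

(** By the mean value theorem, the difference quotient of F at 0 is a value of F1 at a point between
    0 and h. *)
Lemma is_derive_removable (F F1 : R -> R) d : 0 < d ->
  (forall t, sball d t -> {for t, continuous F}) ->
  (forall t, sball d t -> t != 0 -> is_derive t (1 : R) F (F1 t)) ->
  {for 0, continuous F1} -> is_derive (0 : R) (1 : R) F (F1 0).
Proof.
move=> d0 cF dF cF1; apply: is_derive1_eps => e e0.
have /cvgrPdist_le/(_ e e0)/nbhs_ballP[r /= r0 rF] := cF1.
apply/nbhs_ballP; exists (Num.min d r); first by rewrite /= lt_min d0.
move=> h; rewrite /ball/= sub0r normrN lt_min => /andP[hd hr].
have [->|h0] := eqVneq h 0; first by rewrite addr0 subrr mul0r subrr normr0 mulr0.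
have B x : `|x| <= `|h| -> `|F1 0 - F1 x| <= e.
  by move=> xh; apply: rF; rewrite /ball/= sub0r normrN (le_lt_trans xh).
have cw a b : `|a| <= `|h| -> `|b| <= `|h| -> {within `[a, b], continuous F}.
  rewrite !ler_norml => /andP[ah _] /andP[_ bh].
  apply: continuous_in_subspaceT => t; rewrite inE/= ?in_itv/= => /andP[at' tb].
  apply: cF; apply: le_lt_trans hd; rewrite ler_norml.
  by rewrite (le_trans ah)// (le_trans tb).
have key c : `|c| <= `|h| -> F h - F 0 = F1 c * h ->
    `|F (h + 0) - F 0 - h * F1 0| <= e * `|h|.
  move=> ch E; rewrite addr0 E.
  have -> : F1 c * h - h * F1 0 = - ((F1 0 - F1 c) * h) by ring.
  by rewrite normrN normrM ler_wpM2r// B.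
have [hn|hp|/eqP] := ltgtP h 0; last by rewrite (negbTE h0).
  have cw' : {within `[h, 0], continuous F} by apply: cw => //; rewrite normr0.
  have dF' x : x \in `]h, 0[%R -> is_derive x (1 : R) F (F1 x).
    rewrite in_itv/= => /andP[hx x0]; apply: dF; last by rewrite lt_eqF.
    by apply: le_lt_trans hd; rewrite !ltr0_norm// lerN2 ltW.
  have [c + E] := MVT hn dF' cw'; rewrite in_itv/= => /andP[hc c0]; apply: (key c).
    by rewrite !ltr0_norm// lerN2 ltW.
  by rewrite -opprB E sub0r mulrN opprK.
have cw' : {within `[0, h], continuous F} by apply: cw => //; rewrite normr0.
have dF' x : x \in `]0, h[%R -> is_derive x (1 : R) F (F1 x).
  rewrite in_itv/= => /andP[x0 xh]; apply: dF; last by rewrite gt_eqF.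
  by apply: le_lt_trans hd; rewrite !gtr0_norm// ltW.
have [c + E] := MVT hp dF' cw'; rewrite in_itv/= => /andP[c0 ch]; apply: (key c).
  by rewrite !gtr0_norm// ltW.
by rewrite E subr0.
Qed.

Variable d : R.
Hypothesis d0 : 0 < d.
Let J := sball d.
Let oJ : open J := @open_sball d.
Let cJ := @sball_convex d.

Definition even_on (D : set R) (g : R -> R) := forall s, D s -> g (- s) = g s.

Lemma derive1_even g : Sm J g -> even_on J g -> forall s, J s ->
  derive1 g (- s) = - derive1 g s.
Proof.
move=> sg eg s Js.
have dN : is_derive s (1 : R) (-%R) (-1 : R).
  by have := is_deriveN (is_derive_id s (1 : R)).
have dg : is_derive (- s) (1 : R) g (derive1 g (- s)).
  by split; [exact/(Sm_derivable sg)/sballN | rewrite derive1E].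
have [_] := is_derive1_comp dg dN.
have -> : 'D_1 (g \o -%R) s = 'D_1 g s.
  apply: near_eq_derive; apply: filterS (open_nbhs_nbhs (conj oJ Js)) => t.
  exact: eg.
by rewrite -derive1E mulrN1 => ->; rewrite opprK.
Qed.

(** For even g this is g'(s) / (2 s), the derivative of g with respect to s ^ 2, written as an
    average of g'' so that smoothness at 0 is visible. *)
Definition halfquot (g : R -> R) (s : R) : R :=
  segavg 0 (derive1 (derive1 g)) 0 s / 2.

Lemma halfquotE g : Sm J g -> even_on J g -> forall s, J s ->
  derive1 g s = 2 * s * halfquot g s.
Proof.
move=> sg eg s Js; have J0 := sball0 d0.
have g0 : derive1 g 0 = 0.
  have := derive1_even sg eg J0; rewrite oppr0 => /eqP.
  by rewrite -addr_eq0 -mulr2n mulrn_eq0/= => /eqP.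
have := segavg_taylor1 cJ (Sm_derive1 sg) J0 Js.
by rewrite g0 !subr0 => ->; rewrite /halfquot; field.
Qed.

Lemma Sm_segavg0 a g : Sm J g -> Sm J (fun s => segavg a g 0 s).
Proof.
move=> sg n; have := segavg_smooth oJ cJ a sg n.
move=> /(@Cn1_line _ n _ J i_pphi 0 _ oJ).
rewrite (_ : (fun t : R => _) = fun s => segavg a g 0 s).
  by apply=> t Jt; rewrite /= line0E /line add0r !mxE/= mulr0; split=> //; exact: sball0.
by apply/funext => t; rewrite line0E /line add0r !mxE/= mulr0.
Qed.

Lemma Sm_halfquot g : Sm J g -> Sm J (halfquot g).
Proof.
move=> sg n; apply: Cn1M => //; last exact: Cn1_cst.
by apply: Sm_segavg0; do 2!apply: Sm_derive1.
Qed.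

Lemma even_halfquot g : Sm J g -> even_on J g -> even_on J (halfquot g).
Proof.
move=> sg eg s Js; have [->|s0] := eqVneq s 0; first by rewrite oppr0.
have := derive1_even sg eg Js; rewrite (halfquotE sg eg Js) (halfquotE sg eg (sballN Js)).
rewrite mulrN mulNr => /oppr_inj/mulfI; apply.
by rewrite mulf_neq0.
Qed.

(** For t >= 0 the m-th derivative of g(sqrt t) is the m-th iterate of [halfquot], taken at sqrt t.
    For t < 0 any function with the same derivatives at 0 will do, and Borel's theorem supplies one;
    the two towers of derivatives are glued order by order. *)
Lemma whitney_even g : Sm J g -> even_on J g ->
  exists2 G, Sm (sball (d ^+ 2)) G & forall s, J s -> G (s ^+ 2) = g s.
Proof.
move=> sg eg.
pose gs n := iter n halfquot g.
have gsP n : Sm J (gs n) /\ even_on J (gs n).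
  elim: n => [//|n [sn en]]; split; first exact: Sm_halfquot.
  exact: even_halfquot.
have [B [dB B0]] := borel (fun n => gs n 0).
pose G m t := if 0 <= t then gs m (Num.sqrt t) else B m t.
have J0 := sball0 d0.
have sqJ t : sball (d ^+ 2) t -> J (Num.sqrt t).
  rewrite /J/sball/= => td; have [t0|t0] := leP 0 t; last first.
    by rewrite ler0_sqrtr ?normr0// ltW.
  rewrite ger0_norm ?sqrtr_ge0// -(@ltr_pXn2r _ 2) ?nnegrE ?sqrtr_ge0 ?(ltW d0)//.
  by rewrite sqr_sqrtr// -[t]ger0_norm.
have cP m t : sball (d ^+ 2) t -> {for t, continuous (fun u => gs m (Num.sqrt u))}.
  move=> /sqJ Jt; apply: (@continuous_comp R R R Num.sqrt (gs m)).
    exact: sqrt_continuous.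
  by apply: (Cn1_continuous ((gsP m).1 0%N)).
have cQ m t : {for t, continuous (B m)}.
  by have [/derivable1_diffP/differentiable_continuous] := dB m t.
have dpos m (t : R) : sball (d ^+ 2) t -> 0 < t -> is_derive t (1 : R) (G m) (G m.+1 t).
  move=> td t0; have Js := sqJ _ td.
  have dg : is_derive (Num.sqrt t) (1 : R) (gs m) (derive1 (gs m) (Num.sqrt t)).
    by split; [exact: (Sm_derivable (gsP m).1) | rewrite derive1E].
  apply: (@near_eq_is_derive _ _ _ (gs m \o Num.sqrt)).
    by near=> u; rewrite /G ifT//=; near: u; apply: filterS (lt_nbhsr t0) => u /ltW.
  apply: (is_derive_eq (is_derive1_comp dg (is_derive1_sqrt t0))).
  rewrite /G (ltW t0) (halfquotE (gsP m).1 (gsP m).2)//=.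
  by field; rewrite gt_eqF// sqrtr_gt0.
have dneg m (t : R) : t < 0 -> is_derive t (1 : R) (G m) (G m.+1 t).
  move=> t0; apply: (@near_eq_is_derive _ _ _ (B m)).
    near=> u; rewrite /G ifF//; apply/negbTE; rewrite -ltNge.
    by near: u; exact: lt_nbhsl.
  by rewrite /G leNgt t0/=; exact: dB.
have cG0 m : {for 0, continuous (G m)}.
  apply/cvgrPdist_le => e e0.
  have G0 : G m 0 = gs m 0 by rewrite /G lexx sqrtr0.
  have d20 : sball (d ^+ 2) 0 by apply: sball0; rewrite exprn_gt0.
  have /cvgrPdist_le/(_ e e0) := cP m 0 d20.
  have /cvgrPdist_le/(_ e e0) := cQ m 0.
  apply: filterS2 => u; rewrite G0 B0 sqrtr0 /G.
  by case: ifP.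
have dG m (t : R) : sball (d ^+ 2) t -> is_derive t (1 : R) (G m) (G m.+1 t).
  move=> td; have [t0|t0|->] := ltgtP t 0; [exact: dneg|exact: dpos|].
  (* At the junction both towers are continuous with common values, so the derivative known off 0
     extends to 0. *)
  apply: (@is_derive_removable (G m) (G m.+1) (d ^+ 2)); rewrite ?exprn_gt0//.
    move=> u ud; have [u0|u0|->//] := ltgtP u 0.
      by have [/derivable1_diffP/differentiable_continuous] := dneg m u u0.
    by have [/derivable1_diffP/differentiable_continuous] := dpos m u ud u0.
  move=> u ud u0; have [u1|u1|/eqP] := ltgtP u 0; [exact: dneg|exact: dpos|].
  by rewrite (negbTE u0).
exists (G 0%N); first by apply: Sm_family => //; exact: open_sball.
move=> s Js; rewrite /G sqr_ge0 sqrtr_sqr /gs/=.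
have [s0|s0] := leP 0 s; first by rewrite ger0_norm.
by rewrite ltr0_norm// eg.
Unshelve. all: by end_near. Qed.

End Whitney.

(** Applied to a coordinate change and to its inverse, this gives the two directions of the
    comparison of leaves. *)
Lemma connected_component_image (T S : topologicalType) (A : set T) (B : set S)
    (Phi : T -> S) a b :
  (forall z, A z -> {for z, continuous Phi}) -> (forall z, A z -> B (Phi z)) ->
  connected_component A a b -> connected_component B (Phi a) (Phi b).
Proof.
move=> cPhi AB [C [Ca CA cC] Cb]; exists (Phi @` C); last by exists b.
split; first by exists a.
  by move=> _ [z Cz <-]; exact/AB/CA.
apply: connected_continuous_connected => //.
by apply: continuous_in_subspaceT => z; rewrite inE => /CA/cPhi.
Qed.

(** * Coordinates for fibrewise quadratic Hamiltonians *)

Section Balls.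
Context {R : realType}.

Definition cball (c d : R) : set R := [set s | `|s - c| < d].

Lemma open_cball c d : open (cball c d).
Proof.
have -> : cball c d = (fun s => s - c) @^-1` sball d by [].
apply: open_comp; last exact: open_sball.
by move=> x _; apply: continuousB; [exact: cvg_id | exact: cst_continuous].
Qed.

Lemma cball_convex c d x y u : cball c d x -> cball c d y -> 0 <= u <= 1 ->
  cball c d ((1 - u) * x + u * y).
Proof.
move=> xd yd u01; rewrite /cball/=.
have -> : (1 - u) * x + u * y - c = (1 - u) * (x - c) + u * (y - c) by ring.
exact: sball_convex xd yd u01.
Qed.

Lemma cball_center c d : 0 < d -> cball c d c.
Proof. by rewrite /cball/= subrr normr0. Qed.

Lemma cballP c d s : cball c d s <-> c - d < s < c + d.
Proof.
rewrite /cball/= ltr_norml; split=> /andP[a b]; apply/andP; split; lra.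
Qed.

Lemma derive1_pos_mono (g : R -> R) c d :
  (forall s, cball c d s -> derivable g s 1) -> (forall s, cball c d s -> 0 < derive1 g s) ->
  forall x y, cball c d x -> cball c d y -> x < y -> g x < g y.
Proof.
move=> dg g0 x y cx cy xy.
have [t [ct _] E] := MVT_between (@cball_convex c d) dg cx cy.
by rewrite -subr_gt0 E mulr_gt0 ?subr_gt0//; exact: g0.
Qed.

Lemma incr_on_inj (g : R -> R) (D : set R) :
  (forall x y, D x -> D y -> x < y -> g x < g y) ->
  forall x y, D x -> D y -> g x = g y -> x = y.
Proof.
by move=> mg x y Dx Dy E; have [/(mg x y Dx Dy)|/(mg y x Dy Dx)|//] := ltgtP x y;
  rewrite E ltxx.
Qed.

Lemma incr_on_lt_inv (g : R -> R) (D : set R) :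
  (forall x y, D x -> D y -> x < y -> g x < g y) ->
  forall x y, D x -> D y -> g x < g y -> x < y.
Proof.
move=> mg x y Dx Dy; have [//|yx|->] := ltgtP x y; last by rewrite ltxx.
by move=> /lt_trans/(_ (mg y x Dy Dx yx)); rewrite ltxx.
Qed.

(** Monotonicity turns a < sec < b into the inequalities g a < q < g b, and these persist for nearby
    parameters. *)
Lemma parametric_inverse_continuous (T : topologicalType) (g : T -> R -> R)
    (sec : T -> R -> R) c d (p : T) (q : R) :
  0 < d -> cball c d (sec p q) ->
  (\forall p' \near p, forall x y, cball c d x -> cball c d y -> x < y -> g p' x < g p' y) ->
  (forall x, cball c d x -> {for p, continuous (g ^~ x)}) ->
  (\forall z \near (p, q), cball c d (sec z.1 z.2) /\ g z.1 (sec z.1 z.2) = z.2) ->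
  {for (p, q), continuous (fun z : T * R => sec z.1 z.2)}.
Proof.
move=> d0 cs mg cg secP; apply/cvgrPdist_lt => e e0 /=.
have /= [_ gpq] := nbhs_singleton secP; have mgp := nbhs_singleton mg.
set s := sec p q in cs gpq *.
(* Both points are taken within e of s and no farther out than halfway from s to the ends of the
   ball. *)
have [a [b [[ca cb as' sb] [ae be]]]] : exists a b,
    [/\ cball c d a, cball c d b, a < s & s < b] /\ s - e < a /\ b < s + e.
  move: cs => /cballP/andP[c1 c2].
  exists (Num.max (s - e / 2) ((c - d + s) / 2)), (Num.min (s + e / 2) ((c + d + s) / 2)).
  have e2 : 0 < e / 2 by rewrite divr_gt0.
  split; first split.
  - apply/cballP; rewrite lt_max gt_max; apply/andP; split; last first.
      by apply/andP; split; lra.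
    by apply/orP; right; lra.
  - apply/cballP; rewrite lt_min gt_min; apply/andP; split.
      by apply/andP; split; lra.
    by apply/orP; right; lra.
  - by rewrite gt_max; apply/andP; split; lra.
  - by rewrite lt_min; apply/andP; split; lra.
  by split; [rewrite lt_max; apply/orP; left; lra | rewrite gt_min; apply/orP; left; lra].
have gaq : g p a < q by rewrite -gpq; exact: mgp.
have gqb : q < g p b by rewrite -gpq; exact: mgp.
have na : \forall z \near (p, q), g z.1 a < z.2.
  have c1 : {for (p, q), continuous (fun z : T * R => z.2 - g z.1 a)}.
    apply: continuousB; first exact: cvg_snd.
    by apply: (@continuous_comp (T * R)%type T R fst (g ^~ a)); [exact: cvg_fst | exact: cg].
  have pos : 0 < q - g p a by rewrite subr_gt0.
  have H : nbhs (p, q) [set z : T * R | 0 < z.2 - g z.1 a].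
    exact: (c1 _ (open_nbhs_nbhs (conj (@open_gt R 0) pos))).
  by apply: filterS H => z /=; rewrite subr_gt0.
have nb : \forall z \near (p, q), z.2 < g z.1 b.
  have c1 : {for (p, q), continuous (fun z : T * R => g z.1 b - z.2)}.
    apply: continuousB; last exact: cvg_snd.
    by apply: (@continuous_comp (T * R)%type T R fst (g ^~ b)); [exact: cvg_fst | exact: cg].
  have pos : 0 < g p b - q by rewrite subr_gt0.
  have H : nbhs (p, q) [set z : T * R | 0 < g z.1 b - z.2].
    exact: (c1 _ (open_nbhs_nbhs (conj (@open_gt R 0) pos))).
  by apply: filterS H => z /=; rewrite subr_gt0.
have nm : \forall z \near (p, q), forall x y, cball c d x -> cball c d y -> x < y ->
    g z.1 x < g z.1 y.
  exists ([set p' | forall x y, cball c d x -> cball c d y -> x < y -> g p' x < g p' y],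
    setT) => /=; first by split=> //; exact: filterT.
  by move=> z [].
apply: filterS (filterI (filterI na nb) (filterI nm secP)) => z /= [[za zb] [mz [cz gz]]].
have az : a < sec z.1 z.2 by apply: (incr_on_lt_inv mz) => //; rewrite gz.
have bz : sec z.1 z.2 < b by apply: (incr_on_lt_inv mz) => //; rewrite gz.
by rewrite -/s ltr_norml; apply/andP; split; lra.
Qed.

End Balls.

Lemma ord4P (P : 'I_4 -> Prop) : P i_pr -> P i_pphi -> P i_r -> P i_phi -> forall i, P i.
Proof.
move=> P0 P1 P2 P3 [[|[|[|[|//]]]] j4].
- by rewrite (_ : Ordinal j4 = i_pr)//; exact: val_inj.
- by rewrite (_ : Ordinal j4 = i_pphi)//; exact: val_inj.
- by rewrite (_ : Ordinal j4 = i_r)//; exact: val_inj.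
- by rewrite (_ : Ordinal j4 = i_phi)//; exact: val_inj.
Qed.

Section PairContinuity.
Variables (T S S' : topologicalType).

Lemma continuous_fst_at (h : T -> S * S') z :
  {for z, continuous h} -> {for z, continuous (fun t => (h t).1)}.
Proof. by move=> ch; apply: (@continuous_comp T _ _ h fst) => //; exact: cvg_fst. Qed.

Lemma continuous_snd_at (h : T -> S * S') z :
  {for z, continuous h} -> {for z, continuous (fun t => (h t).2)}.
Proof. by move=> ch; apply: (@continuous_comp T _ _ h snd) => //; exact: cvg_snd. Qed.

Lemma continuous_pair_at (u : T -> S) (v : T -> S') z :
  {for z, continuous u} -> {for z, continuous v} ->
  {for z, continuous (fun t => (u t, v t))}.
Proof. by move=> cu cv; apply: cvg_pair. Qed.

End PairContinuity.

Section RowOfFour.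
Context {R : realType}.
Local Notation V4 := 'rV[R]_4.

Definition mk4 (a b c e : R) : V4 := \row_i tnth [tuple a; b; c; e] i.

Lemma mk4_0 a b c e : mk4 a b c e ord0 i_pr = a. Proof. by rewrite mxE. Qed.
Lemma mk4_1 a b c e : mk4 a b c e ord0 i_pphi = b. Proof. by rewrite mxE. Qed.
Lemma mk4_2 a b c e : mk4 a b c e ord0 i_r = c. Proof. by rewrite mxE. Qed.
Lemma mk4_3 a b c e : mk4 a b c e ord0 i_phi = e. Proof. by rewrite mxE. Qed.
Definition mk4E := (mk4_0, mk4_1, mk4_2, mk4_3).

Lemma Cn_on_mk4 n (U : set V4) (a b c e : V4 -> R) :
  Cn_on n U a -> Cn_on n U b -> Cn_on n U c -> Cn_on n U e ->
  forall j, Cn_on n U (fun x => mk4 (a x) (b x) (c x) (e x) ord0 j).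
Proof.
move=> ca cb cc ce; have ex (u v : V4 -> R) : u = v -> Cn_on n U v -> Cn_on n U u by move=> ->.
apply: ord4P.
- by apply: ex ca; apply/funext => x; rewrite mk4E.
- by apply: ex cb; apply/funext => x; rewrite mk4E.
- by apply: ex cc; apply/funext => x; rewrite mk4E.
- by apply: ex ce; apply/funext => x; rewrite mk4E.
Qed.

Lemma continuous_mk4 (T : topologicalType) (a b c e : T -> R) (z : T) :
  {for z, continuous a} -> {for z, continuous b} -> {for z, continuous c} ->
  {for z, continuous e} ->
  {for z, continuous (fun y => mk4 (a y) (b y) (c y) (e y))}.
Proof.
move=> ca cb cc ce; rewrite (_ : (fun y => _) = fun y =>
   a y *: (delta_mx ord0 i_pr : V4) + b y *: (delta_mx ord0 i_pphi : V4)
   + c y *: (delta_mx ord0 i_r : V4) + e y *: (delta_mx ord0 i_phi : V4)).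
  by do 3![apply: continuousD; last exact: continuousZr_tmp]; exact: continuousZr_tmp.
apply/funext => y; apply/rowP; apply: ord4P; rewrite mk4E !mxE /=;
  by rewrite !(mulr1, mulr0, addr0, add0r).
Qed.

End RowOfFour.

Section RowDifferentials.
Context {R : realType}.
Local Notation V4 := 'rV[R]_4.
Implicit Types (u w : V4 -> R) (x v : V4).

Lemma diff_mul u w x v : differentiable u x -> differentiable w x ->
  'd (fun y => u y * w y) x v = u x * 'd w x v + w x * 'd u x v.
Proof.
move=> du dw; have dm : differentiable (fun y => u y * w y) x by exact: differentiableM.
rewrite !diff_partial// !mulr_sumr -big_split/=; apply: eq_bigr => i _.
by rewrite partialM// mulrDl !mulrA.
Qed.

Lemma diff_comp1 (phi : R -> R) u x v : differentiable u x -> derivable phi (u x) 1 ->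
  'd (fun y => phi (u y)) x v = derive1 phi (u x) * 'd u x v.
Proof.
move=> du dphi; have [dc _] := partial_comp1 ord0 du dphi.
rewrite !diff_partial// mulr_sumr; apply: eq_bigr => i _.
by have [_ ->] := partial_comp1 i du dphi; rewrite mulrA.
Qed.

Lemma diff_comp_row (phi : V4 -> V4) u x v :
  (forall j, differentiable (fun y => phi y ord0 j) x) -> differentiable u (phi x) ->
  'd (fun y => u (phi y)) x v =
    \sum_j partial j u (phi x) * 'd (fun y => phi y ord0 j) x v.
Proof.
move=> dphi du; have [dc _] := partial_comp ord0 dphi du.
rewrite diff_partial//; under eq_bigr do rewrite (partial_comp _ dphi du).2 mulr_suml.
rewrite exchange_big/=; apply: eq_bigr => j _.
rewrite diff_partial// mulr_sumr; apply: eq_bigr => i _.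
by rewrite mulrA.
Qed.

Lemma diff_coordE x v i : 'd (fun y : V4 => y ord0 i) x v = v ord0 i.
Proof.
rewrite diff_partial; last exact: differentiable_coord.
rewrite (bigD1 i)//= partial_coord eqxx mul1r big1 ?addr0// => j /negbTE ji.
by rewrite partial_coord ji mul0r.
Qed.

Lemma diff_Kint (Lam : R -> R) x v : derivable Lam (x ord0 i_r) 1 ->
  differentiable (Kint Lam) x /\
  'd (Kint Lam) x v = v ord0 i_pphi + derive1 Lam (x ord0 i_r) * v ord0 i_r.
Proof.
move=> dL; pose c i (y : V4) := y ord0 i.
have dc i : differentiable (c i) x by exact: differentiable_coord.
have [dl _] := partial_comp1 ord0 (dc i_r) dL.
have dK : differentiable (Kint Lam) x.
  exact: (differentiableD (dc i_pphi) dl).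
split=> //; rewrite -(diff_coordE x v i_r) -(diff_comp1 _ (dc i_r) dL).
rewrite -(diff_coordE x v i_pphi) !diff_partial//; last exact: (dc i_pphi).
rewrite -big_split/=; apply: eq_bigr => i _; rewrite -mulrDl; congr (_ * _).
by rewrite -partialD//; exact: (dc i_pphi).
Qed.

Lemma smooth_on_Kint (Lam : R -> R) : Sm setT Lam -> smooth_on setT (@Kint R Lam).
Proof.
move=> sL n; apply: Cn_onD; [exact: openT|exact: Cn_on_coord|].
by apply: (@Cn_on_comp1 _ _ _ setT) => //; [exact: openT|exact: Cn_on_coord].
Qed.

End RowDifferentials.

(** * From a normal form of the potential to the germ of the foliation *)

Section Germ.
Context {R : realType}.
Local Notation V4 := 'rV[R]_4.
Variables (L : R) (f Lam : R -> R) (r0 k0 d : R) (P C A : R -> R) (Q : R -> R -> R).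
Variables (g : R -> R -> R) (G : V4 -> R * R) (sg tau : R).

(** Functions of (k, r) are encoded as functions on rows in order to reuse [Cn_on]; in this encoding
    the slot [i_pphi] holds k, not p_phi. *)
Let box := [set x : V4 | cball k0 d (x ord0 i_pphi) /\ cball r0 d (x ord0 i_r)].
Let Qx (x : V4) := Q (x ord0 i_pphi) (x ord0 i_r).

Hypothesis d0 : 0 < d.
Hypothesis sLam : Sm setT Lam.
Hypothesis phaseH : forall r, cball r0 d r -> 0 < r < L.
Hypothesis sP : Sm (cball k0 d) P.
Hypothesis sC : Sm (cball k0 d) C.
Hypothesis sQ : smooth_on box Qx.
Hypothesis P'0 : forall k, cball k0 d k -> 0 < derive1 P k.
Hypothesis C0 : forall k, cball k0 d k -> C k != 0.
Hypothesis Q'0 : forall x, box x -> 0 < partial i_r Qx x.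
Hypothesis Pk0 : P k0 = 0.
Hypothesis Qk0 : Q k0 r0 = 0.
(** The signs allow [P] and [Q k] to be increasing functions while the model coordinates are
    [sg * P] and [tau * Q]. *)
Hypothesis sg2 : sg * sg = 1.
Hypothesis tau2 : tau * tau = 1.
Hypothesis gE : forall k r, cball k0 d k -> cball r0 d r ->
  g (tau * Q k r) (sg * P k) = C k ^+ 2 * ((k - Lam r) ^+ 2 / f r ^+ 2) + A k.
Hypothesis GE : forall y, G y =
  ((y ord0 i_p1 ^+ 2 + g (y ord0 i_q1) (y ord0 i_p2)) / 2, y ord0 i_p2).

Let K := Kint Lam.

Let boxP k r : cball k0 d k -> cball r0 d r -> box (mk4 0 k r 0).
Proof. by move=> kd rd; rewrite /box/= !mk4E. Qed.

Let lineE (k r : R) : line i_r (@mk4 R 0 k 0 0) r = @mk4 R 0 k r 0.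
Proof.
by rewrite /line; apply/rowP; apply: ord4P; rewrite !mxE/= ?(mulr1, mulr0, addr0, add0r).
Qed.

Let Q_derive k r : cball k0 d k -> cball r0 d r ->
  is_derive r (1 : R) (Q k) (partial i_r Qx (mk4 0 k r 0)).
Proof.
move=> kd rd.
have dQ : differentiable Qx (line i_r (mk4 0 k 0 0) r).
  by rewrite lineE; have [+ _] := sQ 1%N; apply; exact: boxP.
have := is_derive_line dQ; rewrite lineE.
by rewrite (_ : (fun u => _) = Q k)//; apply/funext => u; rewrite lineE /Qx !mk4E.
Qed.

Let Pm : forall x y, cball k0 d x -> cball k0 d y -> x < y -> P x < P y.
Proof. by apply: derive1_pos_mono => // s; exact: (Sm_derivable sP). Qed.

Let Qm k : cball k0 d k ->
  forall x y, cball r0 d x -> cball r0 d y -> x < y -> Q k x < Q k y.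
Proof.
move=> kd; apply: derive1_pos_mono => s sd; first by have [] := Q_derive kd sd.
by have [_ E] := Q_derive kd sd; rewrite derive1E E; exact/Q'0/boxP.
Qed.

Let Qcont (T : topologicalType) (u v : T -> R) (z : T) :
  cball k0 d (u z) -> cball r0 d (v z) ->
  {for z, continuous u} -> {for z, continuous v} ->
  {for z, continuous (fun y => Q (u y) (v y))}.
Proof.
move=> kd rd cu cv.
rewrite (_ : (fun y => _) = fun y => Qx (mk4 0 (u y) (v y) 0)); last first.
  by apply/funext => y; rewrite /Qx !mk4E.
apply: (@continuous_comp T V4 R (fun y => mk4 0 (u y) (v y) 0) Qx).
  by apply: continuous_mk4 => //; exact: cst_continuous.
by have [+ _] := sQ 1%N => /(_ _ (boxP kd rd)); exact: differentiable_continuous.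
Qed.

Let comp_cont (T : topologicalType) (J : set R) (phi : R -> R) (u : T -> R) (z : T) :
  Sm J phi -> J (u z) -> {for z, continuous u} -> {for z, continuous (fun y => phi (u y))}.
Proof.
move=> sphi Ju cu; apply: (@continuous_comp T R R u phi) => //.
exact: (Cn1_continuous (sphi 0%N)).
Qed.

Let cball_sub (c d1 d2 s : R) : d1 <= d2 -> cball c d1 s -> cball c d2 s.
Proof. by move=> d12 /lt_le_trans; apply. Qed.

(** The radius e is so small that all values in (- e, e) are taken by [P] on the ball of radius
    [dk], and by each [Q k] on the ball of radius d / 2. This is what makes the image of the
    coordinates a full disc times the circle. *)
Let scale_data : exists dk e : R, [/\ 0 < dk, dk <= d / 2, 0 < e,
   e < P (k0 + dk) /\ P (k0 - dk) < - e &
   forall k : R, cball k0 dk k \/ `|k - k0| = dk ->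
     e < Q k (r0 + d / 2) /\ Q k (r0 - d / 2) < - e].
Proof.
have d2 : 0 < d / 2 by rewrite divr_gt0.
have kc := cball_center k0 d0; have rc := cball_center r0 d0.
have rp : cball r0 d (r0 + d / 2) by apply/cballP; apply/andP; split; lra.
have rm : cball r0 d (r0 - d / 2) by apply/cballP; apply/andP; split; lra.
have Qp : 0 < Q k0 (r0 + d / 2) by rewrite -Qk0; apply: Qm => //; lra.
have Qn : Q k0 (r0 - d / 2) < 0 by rewrite -[ltRHS]Qk0; apply: Qm => //; lra.
(* Half of the smaller gap at [k0], so that both strict inequalities survive for nearby k. *)
pose c := Num.min (Q k0 (r0 + d / 2)) (- Q k0 (r0 - d / 2)) / 2.
have c0 : 0 < c by rewrite divr_gt0// lt_min Qp oppr_gt0.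
have cp : c < Q k0 (r0 + d / 2).
  by rewrite ltr_pdivrMr// gt_min; apply/orP; left; lra.
have cn : c < - Q k0 (r0 - d / 2).
  by rewrite ltr_pdivrMr// gt_min; apply/orP; right; lra.
have np : \forall k \near k0, c < Q k (r0 + d / 2).
  have cQ : {for k0, continuous (fun k => Q k (r0 + d / 2))}.
    by apply: (@Qcont _ id (fun=> r0 + d / 2)) => //; exact: cst_continuous.
  exact: (cQ _ (open_nbhs_nbhs (conj (@open_gt R c) cp))).
have nn : \forall k \near k0, c < - Q k (r0 - d / 2).
  have cQ : {for k0, continuous (fun k => - Q k (r0 - d / 2))}.
    apply: continuousN.
    by apply: (@Qcont _ id (fun=> r0 - d / 2)) => //; exact: cst_continuous.
  exact: (cQ _ (open_nbhs_nbhs (conj (@open_gt R c) cn))).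
have H : nbhs k0 [set k | c < Q k (r0 + d / 2) /\ c < - Q k (r0 - d / 2)].
  exact: filterI np nn.
have /nbhs_ballP[eta /= eta0 etaH] := H.
pose dk := Num.min (d / 2) (eta / 2).
have dk0 : 0 < dk by rewrite lt_min d2 divr_gt0.
have dkd : dk <= d / 2 by rewrite ge_min lexx.
have dke : dk <= eta / 2 by rewrite ge_min lexx orbT.
have kp : cball k0 d (k0 + dk) by apply/cballP; apply/andP; split; lra.
have km : cball k0 d (k0 - dk) by apply/cballP; apply/andP; split; lra.
have Pp : 0 < P (k0 + dk) by rewrite -Pk0; apply: Pm => //; lra.
have Pn : P (k0 - dk) < 0 by rewrite -[ltRHS]Pk0; apply: Pm => //; lra.
pose e := Num.min c (Num.min (P (k0 + dk)) (- P (k0 - dk)) / 2).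
have e0 : 0 < e by rewrite lt_min c0 divr_gt0// lt_min Pp oppr_gt0.
have ec : e <= c by rewrite ge_min lexx.
exists dk, e; split=> //.
  split.
    rewrite gt_min; apply/orP; right.
    by rewrite ltr_pdivrMr// gt_min; apply/orP; left; lra.
  rewrite ltrNr gt_min; apply/orP; right.
  by rewrite ltr_pdivrMr// gt_min; apply/orP; right; lra.
move=> k kdk; have kk : `|k - k0| <= dk by case: kdk => [/ltW|->].
have [] := etaH k.
  by rewrite /ball/= distrC; apply: (le_lt_trans kk); lra.
by move=> h1 h2; split; [exact: le_lt_trans h1 | rewrite ltrNr; exact: le_lt_trans h2].
Qed.

Let psi (x : V4) : V4 :=
  mk4 (C (K x) * x ord0 i_pr) (sg * P (K x)) (tau * Q (K x) (x ord0 i_r)) (x ord0 i_phi).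

Let W := [set x : V4 | cball k0 d (K x) /\ cball r0 d (x ord0 i_r)].

Let Kcont : continuous K.
Proof. by move=> x; apply: (Cn_on_continuous (smooth_on_Kint sLam 0%N)). Qed.

Let oW : open W.
Proof.
apply: (@openI _ (K @^-1` cball k0 d) [set x : V4 | cball r0 d (x ord0 i_r)]).
  by apply: open_comp; [move=> x _; exact: Kcont|exact: open_cball].
by apply: open_coord; exact: open_cball.
Qed.

Let KW n : Cn_on n W K.
Proof. by apply: Cn_on_sub (smooth_on_Kint sLam n). Qed.

Let QW n : Cn_on n W (fun x => Q (K x) (x ord0 i_r)).
Proof.
rewrite (_ : (fun x => _) = fun x => Qx (mk4 0 (K x) (x ord0 i_r) 0)); last first.
  by apply/funext => y; rewrite /Qx !mk4E.
apply: (@Cn_on_comp _ _ _ box (fun x => mk4 0 (K x) (x ord0 i_r) 0)) => //.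
  by move=> x [xk xr]; exact: boxP.
apply: Cn_on_mk4 => //; try exact: Cn_on_cst.
exact: Cn_on_coord.
Qed.

Let psi_smooth i : smooth_on W (fun x => psi x ord0 i).
Proof.
move=> n; move: i; apply: Cn_on_mk4; last exact: Cn_on_coord.
- apply: Cn_onM => //; last exact: Cn_on_coord.
  by apply: (@Cn_on_comp1 _ _ _ (cball k0 d)) => // x [].
- apply: Cn_onM => //; first exact: Cn_on_cst.
  by apply: (@Cn_on_comp1 _ _ _ (cball k0 d)) => // x [].
- by apply: Cn_onM => //; exact: Cn_on_cst.
Qed.

Let sg0 : sg != 0.
Proof. by apply: contraTneq (oner_neq0 R) => sg0; rewrite -sg2 sg0 mul0r eqxx. Qed.

Let tau0 : tau != 0.
Proof. by apply: contraTneq (oner_neq0 R) => t0; rewrite -tau2 t0 mul0r eqxx. Qed.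

(** The differential is triangular in a suitable order: a vector v in its kernel has dK(v) = 0
    because P' > 0, then no p_r component because C does not vanish, no r component because Q
    increases in r, and finally no p_phi component because dK(v) = 0. *)
Let psi_jacobian x : W x -> jacobian psi x \in unitmx.
Proof.
move=> Wx; have [kx rx] := Wx.
rewrite -row_free_unit; apply/inj_row_free => v vJ.
have psi_diff i : differentiable (fun y => psi y ord0 i) x.
  by have [+ _] := psi_smooth i 1%N; apply.
have dpsi : differentiable psi x by exact: differentiable_row.
have D0 i : 'd (fun y => psi y ord0 i) x v = 0.
  by rewrite -diff_coord// -deriveE// deriveEjacobian// vJ mxE.
have dKx v' := diff_Kint v' (Sm_derivable sLam (I : setT (x ord0 i_r))).
have dK := (dKx v).1.
have ex (u w : V4 -> R) : u =1 w -> u = w by move/funext.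
have dP := Sm_derivable sP kx; have dC := Sm_derivable sC kx.
have dPK : differentiable (fun y => P (K y)) x by have [] := partial_comp1 ord0 dK dP.
have dCK : differentiable (fun y => C (K y)) x by have [] := partial_comp1 ord0 dK dC.
have dcst (c : R) : 'd (fun=> c : R) x v = 0.
  by rewrite diff_partial ?big1// => i _; rewrite partial_cst mul0r.
have K'v : 'd K x v = 0.
  have := D0 i_pphi; rewrite (ex (fun y => psi y ord0 i_pphi) (fun y => sg * P (K y))); last first.
    by move=> y; rewrite /psi mk4E.
  rewrite diff_mul// dcst mulr0 addr0 diff_comp1// => /eqP.
  by rewrite !mulf_eq0 (negbTE sg0) gt_eqF/= ?P'0// => /eqP.
have v3 : v ord0 i_phi = 0.
  have := D0 i_phi; rewrite (ex (fun y => psi y ord0 i_phi) (fun y => y ord0 i_phi)) ?diff_coordE//.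
  by move=> y; rewrite /psi mk4E.
have v0 : v ord0 i_pr = 0.
  have := D0 i_pr; rewrite (ex (fun y => psi y ord0 i_pr) (fun y => C (K y) * y ord0 i_pr)); last first.
    by move=> y; rewrite /psi mk4E.
  rewrite diff_mul//; last exact: differentiable_coord.
  rewrite diff_comp1// K'v !mulr0 addr0 diff_coordE => /eqP.
  by rewrite mulf_eq0 (negbTE (C0 kx)) => /eqP.
have v2 : v ord0 i_r = 0.
  have := D0 i_r; rewrite (ex (fun y => psi y ord0 i_r) (fun y => tau * Q (K y) (y ord0 i_r))); last first.
    by move=> y; rewrite /psi mk4E.
  rewrite diff_mul//; last by have [+ _] := QW 1%N; apply.
  rewrite dcst mulr0 addr0 => /eqP; rewrite mulf_eq0 (negbTE tau0) => /eqP.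
  pose phi y := mk4 0 (K y) (y ord0 i_r) 0.
  rewrite (ex (fun y => Q (K y) (y ord0 i_r)) (fun y => Qx (phi y))); last first.
    by move=> y; rewrite /Qx /phi !mk4E.
  have bx : box (phi x) by exact: boxP.
  have p0 : (fun y => phi y ord0 i_pr) = fun=> 0 by apply: ex => y; rewrite /phi mk4E.
  have p1 : (fun y => phi y ord0 i_pphi) = K by apply: ex => y; rewrite /phi mk4E.
  have p2 : (fun y => phi y ord0 i_r) = (fun y => y ord0 i_r) by apply: ex => y; rewrite /phi mk4E.
  have p3 : (fun y => phi y ord0 i_phi) = fun=> 0 by apply: ex => y; rewrite /phi mk4E.
  rewrite diff_comp_row; last 2 first.
  - apply: ord4P; rewrite ?p0 ?p1 ?p2 ?p3//; exact: differentiable_coord.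
  - by have [+ _] := sQ 1%N; apply.
  have q0 : 'd (fun y => phi y ord0 i_pr) x v = 0 by rewrite p0 dcst.
  have q1 : 'd (fun y => phi y ord0 i_pphi) x v = 0 by rewrite p1 K'v.
  have q2 : 'd (fun y => phi y ord0 i_r) x v = v ord0 i_r by rewrite p2 diff_coordE.
  have q3 : 'd (fun y => phi y ord0 i_phi) x v = 0 by rewrite p3 dcst.
  have lem (a b c c' w : R) : a * 0 + b * 0 + c * w + c' * 0 = 0 -> 0 < c -> w = 0.
    by rewrite !mulr0 !add0r addr0 => /eqP; rewrite mulf_eq0 => /orP[/eqP->|/eqP//]; rewrite ltxx.
  by rewrite sum4E q0 q1 q2 q3 => /lem; apply; exact: Q'0.
have v1 : v ord0 i_pphi = 0.
  by have := (dKx v).2; rewrite -/K K'v v2 mulr0 addr0.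
by apply/rowP; apply: ord4P; rewrite ?v0 ?v1 ?v2 ?v3 mxE.
Qed.

Let normsg : `|sg| = 1.
Proof.
apply/eqP; rewrite -(@eqrXn2 _ 2)// expr1n -normrX expr2 sg2 normr1//.
Qed.

Let normtau : `|tau| = 1.
Proof.
apply/eqP; rewrite -(@eqrXn2 _ 2)// expr1n -normrX expr2 tau2 normr1//.
Qed.

(** At fixed K the first model function is affine in [Ham] with slope C ^ 2, so the two maps have
    corresponding levels. *)
Let G_psi z : W z ->
  G (psi z) = (C (K z) ^+ 2 * Ham f z + A (K z) / 2, sg * P (K z)).
Proof.
move=> [kz rz]; rewrite GE /psi !mk4E gE//; congr (_, _).
have -> : K z - Lam (z ord0 i_r) = z ord0 i_pphi by rewrite /K /Kint addrK.
rewrite /Ham exprMn (invfM 2).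
by set w := (f (z ord0 i_r) ^+ 2)^-1; field.
Qed.

Let level_psi z x : W z -> W x ->
  momentum f Lam z = momentum f Lam x <-> G (psi z) = G (psi x).
Proof.
move=> Wz Wx; have [kz rz] := Wz; have [kx rx] := Wx; rewrite !G_psi//; split=> [[HE KE]|[HE KE]].
  by rewrite /K HE KE.
have {}KE : K z = K x.
  by apply: (incr_on_inj Pm kz kx); exact: (mulfI sg0).
rewrite KE in HE; have {}HE : Ham f z = Ham f x.
  by apply: (mulfI (expf_neq0 2 (C0 kx))); exact: addIr HE.
by rewrite /momentum HE -/K KE.
Qed.

Let psi_inj x y : W x -> W y -> Defs.unlift (psi x) = Defs.unlift (psi y) <-> Defs.unlift x = Defs.unlift y.
Proof.
move=> Wx Wy; have [kx rx] := Wx; have [ky ry] := Wy; rewrite /Defs.unlift /psi !mk4E; split=> -[E0 E1 E2 E3 E4].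
  have KE : K x = K y.
    by apply: (incr_on_inj Pm kx ky); exact: (mulfI sg0).
  rewrite KE in E0 E2; have x0 := mulfI (C0 ky) E0.
  have x2 : x ord0 i_r = y ord0 i_r.
    by apply: (incr_on_inj (Qm ky) rx ry); exact: (mulfI tau0).
  have x1 : x ord0 i_pphi = y ord0 i_pphi.
    by move: KE; rewrite /K /Kint x2 => /addIr.
  by rewrite x0 x1 x2 E3 E4.
have KE : K x = K y by rewrite /K /Kint E1 E2.
by rewrite KE E0 E2 E3 E4.
Qed.

Let core_psi x : W x -> orbit_set Lam r0 k0 x <-> core_circle (psi x).
Proof.
move=> Wx; have [kx rx] := Wx; rewrite /core_circle /psi /= !mk4E; split=> [[x0 Kx x2]|[E0 E1 E2]].
  by rewrite /K Kx x0 x2 Pk0 Qk0 !mulr0.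
have KE : K x = k0.
  apply: (incr_on_inj Pm kx (cball_center k0 d0)); rewrite Pk0.
  by apply: (mulfI sg0); rewrite mulr0.
split=> //.
  by move/eqP: E0; rewrite mulf_eq0 (negbTE (C0 kx)) => /eqP.
apply: (incr_on_inj (Qm (cball_center k0 d0)) rx (cball_center r0 d0)).
by rewrite Qk0; apply: (mulfI tau0); rewrite mulr0 -E2 KE.
Qed.

Let disc_coord (e : R) (y : V4) : 0 < e -> disc_circle e y ->
  [/\ `|y ord0 i_p1| < e, `|y ord0 i_p2| < e & `|y ord0 i_q1| < e].
Proof.
move=> e0; rewrite /disc_circle/= => ye.
have H (t : R) : t ^+ 2 < e ^+ 2 -> `|t| < e.
  by rewrite -[t ^+ 2]ger0_norm ?sqr_ge0// normrX ltr_pXn2r ?nnegrE// ltW.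
have := sqr_ge0 (y ord0 i_p1); have := sqr_ge0 (y ord0 i_p2); have := sqr_ge0 (y ord0 i_q1).
by move=> h2 h1 h0; split; apply: H; lra.
Qed.

(** The inverse coordinates come from the intermediate value theorem and monotonicity: k is
    recovered from p_2, then r from q_1 at this k. Since leaves are defined in the image of
    [unlift], the coordinate change and its inverse are rewritten as maps of 5-tuples, and
    continuous images of connected sets are used in both directions. *)
Lemma normal_form_germ : foliation_germ L f Lam (orbit_set Lam r0 k0) G.
Proof.
have [dk [e [dk0 dkd e0 [eP Pe] Qe]]] := scale_data.
have d2 : 0 < d / 2 by rewrite divr_gt0.
have kd k : cball k0 dk k -> cball k0 d k by apply: cball_sub; lra.
have rd r : cball r0 (d / 2) r -> cball r0 d r by apply: cball_sub; lra.
have ivt (h : R -> R) c b v : 0 < b ->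
    (forall s, c - b <= s <= c + b -> {for s, continuous h}) ->
    h (c - b) < - e -> e < h (c + b) -> `|v| < e -> exists2 s, cball c b s & h s = v.
  move=> b0 ch h1 h2; rewrite ltr_norml => /andP[v1 v2].
  have cw : {within `[c - b, c + b], continuous h}.
    by apply: continuous_in_subspaceT => s; rewrite inE/= ?in_itv/=; exact: ch.
  have [||s] := @IVT _ h (c - b) (c + b) v _ cw; first lra.
    by rewrite ge_min le_max; apply/andP; split; apply/orP; [left|right]; lra.
  rewrite in_itv/= => /andP[s1 s2] hs; exists s => //; apply/cballP.
  rewrite !lt_neqAle s1 s2 !andbT; apply/andP; split; apply/eqP => E.
    by move: h1; rewrite E hs; lra.
  by move: h2; rewrite -E hs; lra.
have Pcont s : cball k0 d s -> {for s, continuous P}.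
  by move=> ks; exact: (Cn1_continuous (sP 0%N)).
(* Outside the range of interest [k0] is a placeholder, which makes the relation total as [choice]
   requires; [r0] plays this part for r. *)
have exk p : exists k, `|p| < e -> cball k0 dk k /\ P k = p.
  have [pe|_] := ltP `|p| e; last by exists k0.
  have [|k kk Pk] := ivt P k0 dk p dk0 _ Pe eP pe; last by exists k.
  by move=> s ss; apply/Pcont/cballP; lra.
have exr (z : R * R) : exists r, cball k0 dk z.1 -> `|z.2| < e ->
    cball r0 (d / 2) r /\ Q z.1 r = z.2.
  have [zk|nzk] := pselect (cball k0 dk z.1); last by exists r0.
  have [pe|_] := ltP `|z.2| e; last by exists r0.
  have [Q1 Q2] := Qe _ (or_introl zk).
  have [|r rr Qr] := ivt (Q z.1) r0 (d / 2) z.2 d2 _ Q2 Q1 pe; last by exists r.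
  move=> s ss; have ks : cball r0 d s by apply/cballP; lra.
  by apply: (@Qcont _ (fun=> z.1) id s (kd _ zk) ks); [exact: cst_continuous|exact: cvg_id].
have [kap kapP] := choice exk; have [rr rrP] := choice exr.
have open_norm : open [set t : R | `|t| < e] by exact: open_sball.
have ck p : `|p| < e -> {for p, continuous kap}.
  move=> pe; apply: (@continuous_comp R (R * R)%type R (fun t => (0, t)) (fun z => kap z.2)).
    by apply: continuous_pair_at; [exact: cst_continuous|exact: cvg_id].
  apply: (@parametric_inverse_continuous _ _ (fun _ => P) (fun _ => kap) k0 d) => //.
  - by have [/kd] := kapP p pe.
  - by apply: (filterS _ filterT) => _ _; exact: Pm.
  - by move=> x _; exact: cst_continuous.
  have : \forall z \near ((0 : R), p), `|z.2| < e.
    have := @continuous_snd_at (R * R)%type R R id (0, p) cvg_id.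
    by move=> /(_ _ (open_nbhs_nbhs (conj open_norm pe))).
  by apply: filterS => z /= /kapP[/kd].
have cr k q : cball k0 dk k -> `|q| < e -> {for (k, q), continuous rr}.
  move=> kk qe.
  rewrite (_ : rr = fun z => rr (z.1, z.2)); last by apply/funext => -[].
  apply: (@parametric_inverse_continuous _ _ Q (fun k q => rr (k, q)) r0 d) => //.
  - by have [/rd] := rrP (k, q) kk qe.
  - have : \forall p' \near k, cball k0 dk p'.
      exact: (open_nbhs_nbhs (conj (@open_cball _ k0 dk) kk)).
    by apply: filterS => p' /kd; exact: Qm.
  - move=> x xr; apply: (@Qcont _ id (fun=> x)) => //; [exact: kd|exact: cst_continuous].
  have n1 : \forall z \near (k, q), cball k0 dk z.1.
    have := @continuous_fst_at (R * R)%type R R id (k, q) cvg_id.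
    by move=> /(_ _ (open_nbhs_nbhs (conj (@open_cball _ k0 dk) kk))).
  have n2 : \forall z \near (k, q), `|z.2| < e.
    have := @continuous_snd_at (R * R)%type R R id (k, q) cvg_id.
    by move=> /(_ _ (open_nbhs_nbhs (conj open_norm qe))).
  apply: filterS2 n1 n2 => z z1 z2; have [+ E] := rrP z z1 z2.
  by rewrite -(surjective_pairing z) E => /rd.
(* Restricting to the smaller box keeps [U] in the domain where [psi] is injective, and by the
   choice of e no point of the disc is lost. *)
pose U := [set x | [/\ cball k0 dk (K x), cball r0 (d / 2) (x ord0 i_r) & disc_circle e (psi x)]].
have UW x : U x -> W x by move=> [/kd ? /rd ?].
have norme (t s : R) : `|s| = 1 -> `|t| < e -> `|s * t| < e by move=> s1; rewrite normrM s1 mul1r.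
have inv y : disc_circle e y -> let k := kap (sg * y ord0 i_p2) in
    let r := rr (k, tau * y ord0 i_q1) in
    let x := mk4 (y ord0 i_p1 / C k) (k - Lam r) r (y ord0 i_q2) in U x /\ psi x = y.
  move=> ye k r x; have [y0 y1 y2] := disc_coord e0 ye.
  have [kk Pk] := kapP _ (norme _ _ normsg y1).
  have [kr Qr] := rrP (k, _) kk (norme _ _ normtau y2).
  have Kx : K x = k by rewrite /K /Kint /x !mk4E subrK.
  have px : psi x = y.
    rewrite /psi Kx /x !mk4E; apply/rowP; apply: ord4P; rewrite !mk4E//.
    - by rewrite mulrCA divff ?mulr1//; exact/C0/kd.
    - by rewrite Pk mulrA sg2 mul1r.
    - by rewrite Qr mulrA tau2 mul1r.
  by split=> //; split; rewrite ?Kx ?px ?/x ?mk4E.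
have img : psi @` U = disc_circle e.
  apply/seteqP; split=> [_ [x [_ _ px] <-]//|y ye].
  by have [Ux px] := inv y ye; eexists; [exact: Ux|].
have psic x i : W x -> {for x, continuous (fun y => psi y ord0 i ^+ 2)}.
  move=> Wx; apply: (@continuous_comp V4 R R (fun y => psi y ord0 i) (fun t => t ^+ 2)).
    exact: (Cn_on_continuous (psi_smooth i 0%N)).
  exact: exprn_continuous.
exists U, psi, e; split.
- split=> //.
  + rewrite openE => x Ux; have [kx rx px] := Ux; have Wx := UW x Ux.
    have o1 : open [set y : V4 | cball k0 dk (K y)].
      by apply: open_comp; [move=> y _; exact: Kcont|exact: open_cball].
    have o2 : open [set y : V4 | cball r0 (d / 2) (y ord0 i_r)].
      by apply: open_coord; exact: open_cball.
    have c3 : {for x, continuous (fun y => psi y ord0 i_p1 ^+ 2 + psi y ord0 i_p2 ^+ 2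
        + psi y ord0 i_q1 ^+ 2)}.
      by apply: continuousD; [apply: continuousD|]; exact: psic.
    have n3 : nbhs x [set y : V4 | disc_circle e (psi y)].
      exact: (c3 _ (open_nbhs_nbhs (conj (@open_lt R (e ^+ 2)) px))).
    have n1 : nbhs x [set y : V4 | cball k0 dk (K y)] by exact: open_nbhs_nbhs.
    have n2 : nbhs x [set y : V4 | cball r0 (d / 2) (y ord0 i_r)] by exact: open_nbhs_nbhs.
    change (nbhs x U).
    by apply: filterS (filterI (filterI n1 n2) n3) => y [[? ?] ?].
  + move=> x Ox; have Wx : W x.
      by have [_ Kx rx] := Ox; split; rewrite ?/K ?Kx ?rx; exact: cball_center.
    have [p0 p1 p2] := (core_psi Wx).1 Ox; have [_ Kx rx] := Ox.
    split; rewrite ?/K ?Kx ?rx; try exact: cball_center.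
    by rewrite /disc_circle/= p0 p1 p2 expr0n/= !addr0 exprn_gt0.
  + by move=> x [_ /rd/phaseH].
  + move=> x y xy; have [x0 x1 x2 _ _] := xy.
    have KE : K x = K y by rewrite /K /Kint x1 x2.
    by rewrite /U/= /disc_circle/= /psi !mk4E KE x0 x2.
- split=> //.
  + by move=> i n; apply: Cn_on_sub (psi_smooth i n); exact: UW.
  + by move=> x /UW; exact: psi_jacobian.
  + by move=> x y /UW Wx /UW Wy; exact: psi_inj.
- by move=> x /UW; exact: core_psi.
move=> x y Ux Uy; have Wx := UW x Ux; rewrite /same_leaf.
pose T5 := (R * R * R * (R * R))%type.
have cid (z : T5) : {for z, continuous (fun t : T5 => t)} by exact: cvg_id.
have c0 (z : T5) : {for z, continuous (fun t : T5 => t.1.1.1)}.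
  by do 3!apply: continuous_fst_at.
have c1 (z : T5) : {for z, continuous (fun t : T5 => t.1.1.2)}.
  by apply: continuous_snd_at; do 2!apply: continuous_fst_at.
have c2 (z : T5) : {for z, continuous (fun t : T5 => t.1.2)}.
  by apply: continuous_snd_at; apply: continuous_fst_at.
have c3 (z : T5) : {for z, continuous (fun t : T5 => t.2)}.
  exact: continuous_snd_at.
split.
  (* [psi] on the image of [unlift]: the last entry of the tuple is the pair (cos, sin) of the angle
     and is left unchanged. *)
  pose kk (t : T5) := t.1.1.2 + Lam t.1.2.
  pose Phi (t : T5) : T5 :=
    (C (kk t) * t.1.1.1, sg * P (kk t), tau * Q (kk t) t.1.2, t.2).
  have PhiE z : Phi (Defs.unlift z) = Defs.unlift (psi z) by rewrite /Phi /kk /Defs.unlift /psi !mk4E.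
  rewrite -!PhiE; apply: connected_component_image => [_ [z [Uz _] <-]|_ [z [Uz zE] <-]].
    have Wz := UW z Uz; have [kz0 rz] := Wz.
    have ckk : {for Defs.unlift z, continuous kk}.
      apply: continuousD; first exact: c1.
      by apply: (comp_cont sLam) => //; exact: c2.
    have kz : cball k0 d (kk (Defs.unlift z)) by exact: kz0.
    do 3?apply: continuous_pair_at; last exact: c3.
    - by apply: continuousM; [exact: (comp_cont sC)|exact: c0].
    - by apply: continuousM; [exact: cst_continuous|exact: (comp_cont sP)].
    - apply: continuousM; first exact: cst_continuous.
      by apply: Qcont => //; exact: rz.
  rewrite PhiE; exists (psi z) => //; split; first by have [] := Uz.
  by apply/level_psi => //; exact: UW.
(* The inverse of [psi] on 5-tuples, with k and r recovered by [kap] and [rr]. *)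
pose kk (t : T5) := kap (sg * t.1.1.2).
pose ww (t : T5) := rr (kk t, tau * t.1.2).
pose Psi (t : T5) : T5 := (t.1.1.1 / C (kk t), kk t - Lam (ww t), ww t, t.2).
have PsiE z : U z -> Psi (Defs.unlift (psi z)) = Defs.unlift z.
  move=> Uz; have [_ _ pz] := Uz; have [Ux' px'] := inv _ pz.
  have <- := (psi_inj (UW _ Ux') (UW _ Uz)).1 (congr1 (@Defs.unlift R) px').
  by rewrite /Psi /Defs.unlift /ww /kk !mk4E.
rewrite -(PsiE x Ux) -(PsiE y Uy).
apply: connected_component_image => [_ [w [we _] <-]|_ [w [we wE] <-]].
  have [y0 y1 y2] := disc_coord e0 we.
  have y1' := norme _ _ normsg y1; have y2' := norme _ _ normtau y2.
  have [kw _] := kapP _ y1'.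
  have ckk : {for Defs.unlift w, continuous kk}.
    apply: (@continuous_comp T5 R R (fun t => sg * t.1.1.2) kap); last exact: ck.
    by apply: continuousM; [exact: cst_continuous|exact: c1].
  have cww : {for Defs.unlift w, continuous ww}.
    apply: (@continuous_comp T5 (R * R)%type R (fun t => (kk t, tau * t.1.2)) rr).
      apply: continuous_pair_at => //.
      by apply: continuousM; [exact: cst_continuous|exact: c2].
    exact: cr.
  do 3?apply: continuous_pair_at; last exact: c3.
  - apply: continuousM; first exact: c0.
    by apply: continuousV; [exact/C0/kd|exact: (comp_cont sC (kd _ kw))].
  - apply: continuousB => //; exact: (comp_cont sLam).
  - exact: cww.
have [z Uz zw] : (psi @` U) w by rewrite img.
rewrite -zw in wE *; rewrite PsiE//; exists z => //; split=> //.
by apply/level_psi => //; exact: UW.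
Qed.

End Germ.

(** * Normal forms of the effective potential *)

Section CubicRoot.
Context {R : realType}.
Local Notation V4 := 'rV[R]_4.

(** Caratheodory's form of differentiability. It suits implicit functions, whose exact increments
    are obtained by dividing by a nonvanishing slope. *)
Lemma caratheodory (u : V4 -> R) (x : V4) (phi : 'I_4 -> V4 -> R) :
  (forall i, {for x, continuous (phi i)}) ->
  (\forall y \near x, u y - u x = \sum_i phi i y * (y - x) ord0 i) ->
  differentiable u x /\ forall i, partial i u x = phi i x.
Proof.
move=> cphi uE; apply: is_diff_eps => e e0.
have e4 : 0 < e / 4 by rewrite divr_gt0.
have near_phi i : \forall y \near x, `|phi i x - phi i y| <= e / 4.
  by have /cvgrPdist_le/(_ _ e4) := cphi i.
have N : \forall y \near x, `|u y - u x - \sum_i phi i x * (y - x) ord0 i| <= e * `|y - x|.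
  near=> y; have -> : u y - u x = \sum_i phi i y * (y - x) ord0 i by near: y.
  rewrite -sumrB; apply: (le_trans (ler_norm_sum _ _ _)).
  have -> : e * `|y - x| = \sum_(i < 4) (e / 4 * `|y - x|).
    by rewrite sumr_const card_ord -mulr_natr; field.
  apply: ler_sum => i _; rewrite -mulrBl normrM distrC.
  apply: ler_pM => //; last exact: ler_coord_norm.
  by move: i; apply: ord4P; near: y; exact: near_phi.
rewrite (near_shift 0 x)/= in N; move: N; apply: filterS => v /=.
by rewrite subr0 addrK.
Unshelve. all: by end_near. Qed.

Variable M : R.
Hypothesis M0 : 0 < M.

(** For |s|, |y| < [q0] the difference quotients of the cubic on [- B, B] are at least 1 - q0 (2 B +
    B ^ 2) = 1 / 2. As the cubic vanishes at 0, it is then at least M at B = 2 M and at most - M at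
    - B. *)
Let B := 2 * M.
Let q0 := (2 * (2 * B + B ^+ 2))^-1.

Definition cubic (s y eta : R) : R := eta + s * eta ^+ 2 + y * eta ^+ 3 / 3.

Let B0 : 0 < B. Proof. by rewrite mulr_gt0. Qed.
Let q0_gt0 : 0 < q0.
Proof. by rewrite invr_gt0 mulr_gt0// addr_gt0 ?exprn_gt0// mulr_gt0. Qed.

(** The divided difference of [cubic s y] at a and b, in polynomial form. *)
Let slope s y (a b : R) : R := 1 + s * (a + b) + y * (a ^+ 2 + a * b + b ^+ 2) / 3.

Let slope_pos s y a b : `|s| < q0 -> `|y| < q0 -> `|a| <= B -> `|b| <= B ->
  1 / 2 <= slope s y a b.
Proof.
move=> sq yq aB bB.
have h1 : `|s * (a + b)| <= q0 * (2 * B).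
  rewrite normrM; apply: ler_pM => //; first exact: ltW.
  by rewrite mulr2n mulrDl mul1r (le_trans (ler_normD _ _))// lerD.
have h2 : `|y * (a ^+ 2 + a * b + b ^+ 2) / 3| <= q0 * B ^+ 2.
  rewrite -mulrA normrM; apply: ler_pM => //; first exact: ltW.
  rewrite normrM [`|3^-1|]ger0_norm// ler_pdivrMr//.
  have -> : B ^+ 2 * 3 = B ^+ 2 + B * B + B ^+ 2 by ring.
  apply: (le_trans (ler_normD _ _)); apply: lerD; last first.
    by rewrite normrX lerXn2r ?nnegrE// ltW.
  apply: (le_trans (ler_normD _ _)); apply: lerD.
    by rewrite normrX lerXn2r ?nnegrE// ltW.
  by rewrite normrM ler_pM.
have E : q0 * (2 * B) + q0 * B ^+ 2 = 1 / 2.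
  rewrite /q0; field.
  by rewrite gt_eqF// addr_gt0// ?exprn_gt0// mulr_gt0.
move: h1 h2; rewrite !ler_norml /slope => /andP[h1 _] /andP[h2 _]; lra.
Qed.

Let cubic_diff s y a b : cubic s y b - cubic s y a = (b - a) * slope s y a b.
Proof. by rewrite /cubic /slope; field. Qed.

Let D : set V4 := [set x | [/\ `|x ord0 i_pr| < q0, `|x ord0 i_pphi| < q0 & `|x ord0 i_r| < M]].

(** The root exists by intermediate values and is unique in the ball by monotonicity. Its
    increments, divided by [slope], give partial derivatives that are rational in the root, and the
    bootstrap gives smoothness. *)
Lemma cubic_solution : exists eta : R -> R -> R -> R,
  (forall s y e, `|s| < q0 -> `|y| < q0 -> `|e| < M -> cubic s y (eta s y e) = e) /\
  smooth_on D (fun x => eta (x ord0 i_pr) (x ord0 i_pphi) (x ord0 i_r)).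
Proof.
have mono (s y : R) : `|s| < q0 -> `|y| < q0 ->
    forall a b, cball 0 B a -> cball 0 B b -> a < b -> cubic s y a < cubic s y b.
  move=> sq yq a b; rewrite /cball/= !subr0 => aB bB ab.
  rewrite -subr_gt0 cubic_diff mulr_gt0 ?subr_gt0//.
  by apply: lt_le_trans (slope_pos sq yq (ltW aB) (ltW bB)); rewrite divr_gt0.
have ccont (s y a : R) : {for a, continuous (cubic s y)}.
  rewrite (_ : cubic s y = fun t => t + s * t ^+ 2 + y * t ^+ 3 / 3)//.
  apply: continuousD.
    apply: continuousD; first exact: cvg_id.
    by apply: continuousM; [exact: cst_continuous|exact: exprn_continuous].
  apply: continuousM; last exact: cst_continuous.
  by apply: continuousM; [exact: cst_continuous|exact: exprn_continuous].
have ex (z : R * R * R) : exists t, `|z.1.1| < q0 -> `|z.1.2| < q0 -> `|z.2| < M ->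
    cball 0 B t /\ cubic z.1.1 z.1.2 t = z.2.
  case: z => [[s y] e] /=.
  have [sq|] := ltP `|s| q0; last by exists 0.
  have [yq|] := ltP `|y| q0; last by exists 0.
  have [eM|] := ltP `|e| M; last by exists 0.
  have NB : `|- B| <= B by rewrite normrN gtr0_norm.
  have PB : `|B| <= B by rewrite gtr0_norm.
  have Z : `|0 : R| <= B by rewrite normr0 ltW.
  have c0 : cubic s y 0 = 0 by rewrite /cubic !expr0n/= !mulr0 mul0r !addr0.
  have h1 := cubic_diff s y 0 B; have h2 := cubic_diff s y (- B) 0.
  rewrite c0 subr0 in h1; rewrite c0 sub0r opprK add0r in h2.
  have p1 : M <= cubic s y B.
    rewrite h1 -[leLHS](_ : B * (1 / 2) = _); last by rewrite /B; field.
    by rewrite ?subr0; apply: ler_wpM2l; [exact: ltW|exact: slope_pos].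
  have p2 : cubic s y (- B) <= - M.
    rewrite lerNr h2 -[leLHS](_ : B * (1 / 2) = _); last by rewrite /B; field.
    by apply: ler_wpM2l; [exact: ltW|exact: slope_pos].
  have cw : {within `[- B, B], continuous (cubic s y)}.
    by apply: continuous_subspaceT => a; exact: ccont.
  move: eM; rewrite ltr_norml => /andP[e1 e2].
  have [||t] := @IVT _ (cubic s y) (- B) B e _ cw; first by move: B0; lra.
    by rewrite ge_min le_max; apply/andP; split; apply/orP; [left|right]; lra.
  rewrite in_itv/= => /andP[t1 t2] te; exists t => _ _ _; split=> //.
  apply/cballP; rewrite sub0r add0r !lt_neqAle t1 t2 !andbT.
  by apply/andP; split; apply/eqP => E; move: p1 p2; rewrite ?E ?te -?E ?te; lra.
have [sol solP] := choice ex.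
pose eta s y e := sol (s, y, e); exists eta.
split; first by move=> s y e sq yq eM; have [] := solP (s, y, e) sq yq eM.
pose N (x : V4) := eta (x ord0 i_pr) (x ord0 i_pphi) (x ord0 i_r).
have NP x : D x -> `|N x| < B /\
    cubic (x ord0 i_pr) (x ord0 i_pphi) (N x) = x ord0 i_r.
  by case=> x0 x1 x2; have [] := solP (_, _, _) x0 x1 x2; rewrite /cball/= subr0.
have oD : open D.
  have o (i : 'I_4) (b : R) : open [set x : V4 | `|x ord0 i| < b].
    by apply: (@open_coord R (sball b) i); exact: open_sball.
  have -> : D = [set x : V4 | `|x ord0 i_pr| < q0] `&` [set x : V4 | `|x ord0 i_pphi| < q0]
      `&` [set x : V4 | `|x ord0 i_r| < M].
    by apply/seteqP; split=> x; [case|case=> -[]].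
  by do 2?apply: openI; exact: o.
have cN x : D x -> {for x, continuous N}.
  move=> Dx; have [x0 x1 x2] := Dx.
  apply: (@continuous_comp V4 (V4 * R)%type R (fun x => (x, x ord0 i_r))
     (fun z => eta (z.1 ord0 i_pr) (z.1 ord0 i_pphi) z.2)).
    by apply: continuous_pair_at; [exact: cvg_id|exact: coord_continuous].
  apply: (@parametric_inverse_continuous R V4
    (fun x t => cubic (x ord0 i_pr) (x ord0 i_pphi) t)
    (fun x e => eta (x ord0 i_pr) (x ord0 i_pphi) e) 0 B) => //.
  - by rewrite /cball/= subr0; have [] := NP x Dx.
  - have : \forall y \near x, D y by exact: open_nbhs_nbhs.
    by apply: filterS => y [y0 y1 _]; exact: mono.
  - move=> t _; rewrite /cubic; apply: continuousD.
      apply: continuousD; first exact: cst_continuous.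
      by apply: continuousM; [exact: coord_continuous|exact: cst_continuous].
    apply: continuousM; last exact: cst_continuous.
    by apply: continuousM; [exact: coord_continuous|exact: cst_continuous].
  have n1 : \forall z \near (x, x ord0 i_r), D z.1.
    have := @continuous_fst_at (V4 * R)%type V4 R id (x, x ord0 i_r) cvg_id.
    by move=> /(_ _ (open_nbhs_nbhs (conj oD Dx))).
  have n2 : \forall z \near (x, x ord0 i_r), `|z.2| < M.
    have := @continuous_snd_at (V4 * R)%type V4 R id (x, x ord0 i_r) cvg_id.
    by move=> /(_ _ (open_nbhs_nbhs (conj (@open_sball R M) x2))).
  apply: filterS2 n1 n2 => z [z0 z1 _] z2.
  exact: solP (_, _, _) z0 z1 z2.
pose A (x y : V4) : R := slope (x ord0 i_pr) (x ord0 i_pphi) (N x) (N y).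
have A_neq0 x y : D x -> D y -> A x y != 0.
  move=> Dx Dy; have [x0 x1 _] := Dx; have [Nx _] := NP x Dx; have [Ny _] := NP y Dy.
  by rewrite gt_eqF// (lt_le_trans _ (slope_pos x0 x1 (ltW Nx) (ltW Ny)))// divr_gt0.
(* Comparing the equations at x and y: (N y - N x) * A x y is the increment of the third coordinate,
   minus N y ^ 2 times that of the first, minus N y ^ 3 / 3 times that of the second. *)
pose phi (i : 'I_4) (x y : V4) : R := if i == i_pr then - N y ^+ 2 / A x y
  else if i == i_pphi then - N y ^+ 3 / (3 * A x y)
  else if i == i_r then (A x y)^-1 else 0.
have dN x : D x -> differentiable N x /\ forall i, partial i N x = phi i x x.
  move=> Dx; have [x0 x1 x2] := Dx; apply: (@caratheodory N x (fun i => phi i x)).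
    have cNk k : {for x, continuous (fun y => N y ^+ k)}.
      apply: (@continuous_comp V4 R R N (fun t => t ^+ k)); first exact: cN.
      exact: exprn_continuous.
    have cA : {for x, continuous (A x)}.
      rewrite /A /slope; apply: continuousD.
        apply: continuousD; first exact: cst_continuous.
        apply: continuousM; first exact: cst_continuous.
        by apply: continuousD; [exact: cst_continuous|exact: cN].
      apply: continuousM; last exact: cst_continuous.
      apply: continuousM; first exact: cst_continuous.
      apply: continuousD; last exact: cNk.
      apply: continuousD; first exact: cst_continuous.
      by apply: continuousM; [exact: cst_continuous|exact: cN].
    have A0 := A_neq0 x x Dx Dx.
    apply: ord4P; rewrite /phi/=.
    - apply: continuousM; last exact: continuousV.
      by apply: continuousN; exact: cNk.
    - apply: continuousM; first by apply: continuousN; exact: cNk.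
      apply: continuousV; first by rewrite mulf_neq0.
      by apply: continuousM; first exact: cst_continuous.
    - exact: continuousV.
    - exact: cst_continuous.
  have : \forall y \near x, D y by exact: open_nbhs_nbhs.
  apply: filterS => y Dy; rewrite sum4E /phi/= mul0r addr0 !mxE.
  have A0 := A_neq0 x y Dx Dy.
  have [_ Ex] := NP x Dx; have [_ Ey] := NP y Dy.
  rewrite -{1}Ex -{1}Ey.
  apply: (mulIf A0); rewrite -cubic_diff.
  by rewrite /cubic; field.
apply: Cn_on_bootstrap => [x /dN[]//|n i cn].
apply: (@Cn_on_eq _ _ _ (fun x => phi i x x)) => //.
  by move=> x /dN[_ ->].
have cA : Cn_on n D (fun x => A x x).
  pose p (x : V4) := x ord0 i_pr * (N x + N x) + 1 + 3^-1 * (x ord0 i_pphi * (N x * N x + N x * N x + N x * N x)).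
  apply: (@Cn_on_eq _ _ _ p) => // [x _|].
    by rewrite /p /A /slope; field.
  have cNN : Cn_on n D (fun x => N x * N x) by exact: Cn_onM.
  apply: Cn_onD => //; last first.
    apply: Cn_onM => //; first exact: Cn_on_cst.
    apply: Cn_onM => //; first exact: Cn_on_coord.
    by apply: Cn_onD => //; exact: Cn_onD.
  apply: Cn_onD => //; last exact: Cn_on_cst.
  by apply: Cn_onM => //; [exact: Cn_on_coord|exact: Cn_onD].
have cV : Cn_on n D (fun x => (A x x)^-1).
  apply: (@Cn_on_comp1 _ _ _ [set t | t != 0] GRing.inv (fun x => A x x)) => //.
    by move=> x Dx; exact: A_neq0.
  exact: Sm_inv.
have cX k : Cn_on n D (fun x => N x ^+ k).
  elim: k => [|k IHk]; first exact: Cn_on_cst.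
  apply: (@Cn_on_eq _ _ _ (fun x => N x * N x ^+ k)) => // [x _|]; first by rewrite exprS.
  exact: Cn_onM.
have cM c k : Cn_on n D (fun x => c * N x ^+ k * (A x x)^-1).
  by apply: Cn_onM => //; apply: Cn_onM => //; exact: Cn_on_cst.
move: i; apply: ord4P; rewrite /phi/= => {cn}.
- by apply: (@Cn_on_eq _ _ _ _ _ _ _ (cM (-1) 2%N)) => // x _; rewrite mulN1r.
- apply: (@Cn_on_eq _ _ _ _ _ _ _ (cM (- 3^-1) 3%N)) => // x Dx.
  by field; exact: A_neq0.
- exact: cV.
- exact: Cn_on_cst.
Qed.

End CubicRoot.

Section LocalInverse.
Context {R : realType}.

Lemma Int01_X : Int01 (fun u : R => u) = 1 / 2.
Proof.
have H (u : R) : 0 <= u <= 1 -> is_derive u (1 : R) (fun t : R => 2^-1 * t ^+ 2) u.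
  move=> _; have := is_deriveX 2 (is_derive_id u (1 : R)) => /(is_deriveZ 2^-1).
  rewrite /GRing.scale/= => h; apply: is_derive_eq h _.
  by rewrite expr1 mulr1; field.
rewrite (Int01_FTC H); last by move=> u _; exact: cvg_id.
by rewrite expr1n expr0n/= mulr0 subr0 mulr1; field.
Qed.

Lemma segavg_diag (g : R -> R) x : segavg 0 g x x = g x /\ segavg 1 g x x = g x / 2.
Proof.
have E u : (1 - u) * x + u * x = x by ring.
rewrite /segavg; split.
  by rewrite (Int01_ext (h := fun=> g x)) ?Int01_cst// => u _; rewrite E expr0 mul1r.
rewrite (Int01_ext (h := fun u => g x * u)); last by move=> u _; rewrite E expr1 mulrC.
rewrite Int01Z ?Int01_X; last by move=> u _; exact: cvg_id.
by field.
Qed.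

Lemma near_cball (c : R) (A : set R) : (\forall s \near c, A s) ->
  exists2 d, 0 < d & forall s, cball c d s -> A s.
Proof.
by move=> /nbhs_ballP[d /= d0 dA]; exists d => // s cs; apply: dA; rewrite /ball/= distrC.
Qed.

(** The derivative of the inverse is 1 / h' evaluated at the inverse itself, so continuity
    bootstraps to smoothness. *)
Lemma local_inverse_pos (h : R -> R) c d : 0 < d -> Sm (cball c d) h -> 0 < derive1 h c ->
  exists d' e (inv : R -> R), [/\ 0 < d', d' <= d, 0 < e, Sm (cball (h c) e) inv &
    [/\ forall y, cball (h c) e y -> cball c d' (inv y) /\ h (inv y) = y,
       forall x, cball c d' x -> cball (h c) e (h x) -> inv (h x) = x &
       forall x, cball c d' x -> 0 < derive1 h x]].
Proof.
move=> d0 sh h'c; have s1 := Sm_derive1 sh; have cc := cball_center c d0.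
have [d1 d10 H1] : exists2 d1, 0 < d1 & forall s, cball c d1 s -> 0 < derive1 h s.
  apply: near_cball; have c1 : {for c, continuous (derive1 h)}.
    exact: (Cn1_continuous (s1 0%N)).
  exact: (c1 _ (open_nbhs_nbhs (conj (@open_gt R 0) h'c))).
pose d' := Num.min d d1.
have d'0 : 0 < d' by rewrite lt_min d0 d10.
have d'd s : cball c d' s -> cball c d s by rewrite /cball/= lt_min => /andP[].
have h'0 s : cball c d' s -> 0 < derive1 h s by rewrite /cball/= lt_min => /andP[_ /H1].
have mh : forall x y, cball c d' x -> cball c d' y -> x < y -> h x < h y.
  by apply: derive1_pos_mono => // s /d'd; exact: (Sm_derivable sh).
have ch s : cball c d' s -> {for s, continuous h}.
  by move=> /d'd cs; exact: (Cn1_continuous (sh 0%N)).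
have cc' := cball_center c d'0.
have [b [b0 bp bm]] : exists b, [/\ 0 < b, cball c d' (c + b) & cball c d' (c - b)].
  by exists (d' / 2); split; [rewrite divr_gt0| |]; try (apply/cballP; apply/andP; split; lra).
have hp : h c < h (c + b) by apply: mh => //; lra.
have hm : h (c - b) < h c by apply: mh => //; lra.
(* The values of h at c - b and c + b lie at distance at least e from h c, on opposite sides, so
   intermediate values fill the ball. *)
pose e := Num.min (h (c + b) - h c) (h c - h (c - b)).
have e0 : 0 < e by rewrite lt_min !subr_gt0 hp.
have ex y : exists x, cball (h c) e y -> cball c d' x /\ h x = y.
  have [|yN] := pselect (cball (h c) e y); last by exists c.
  rewrite /cball/= lt_min => /andP[y1 y2].
  have bb t : c - b <= t <= c + b -> cball c d' t.
    by move: bp bm => /cballP/andP[? ?] /cballP/andP[? ?] /andP[? ?]; apply/cballP; lra.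
  have cw : {within `[c - b, c + b], continuous h}.
    by apply: continuous_in_subspaceT => s; rewrite inE/= ?in_itv/= => /bb/ch.
  move: y1 y2; rewrite !ltr_norml => /andP[y1 y2] /andP[y3 y4].
  have [||x] := @IVT _ h (c - b) (c + b) y _ cw; first by lra.
    by rewrite ge_min le_max; apply/andP; split; apply/orP; [left|right]; lra.
  by rewrite in_itv/= => /bb xx hx; exists x.
have [inv invP] := choice ex.
have invK x : cball c d' x -> cball (h c) e (h x) -> inv (h x) = x.
  move=> cx chx; have [ci hi] := invP _ chx.
  exact: (incr_on_inj mh ci cx hi).
exists d', e, inv; split=> //; first by rewrite ge_min lexx.
have dinv y : cball (h c) e y -> is_derive y (1 : R) inv (derive1 h (inv y))^-1.
  move=> cy; have [ci hi] := invP y cy.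
  rewrite -{1}hi; apply: is_derive_inverse.
  - have n1 : \forall t \near inv y, cball c d' t.
      exact: (open_nbhs_nbhs (conj (@open_cball R c d') ci)).
    have n2 : \forall t \near inv y, cball (h c) e (h t).
      apply: (ch _ ci); rewrite hi.
      exact: (open_nbhs_nbhs (conj (@open_cball R (h c) e) cy)).
    by apply: filterS2 n1 n2 => t; exact: invK.
  - have n1 : \forall t \near inv y, cball c d' t.
      exact: (open_nbhs_nbhs (conj (@open_cball R c d') ci)).
    by apply: filterS n1 => t /ch.
  - by split; [apply: (Sm_derivable sh); exact: d'd | rewrite derive1E].
  - by rewrite gt_eqF// h'0.
apply: Cn1_bootstrap => [y /dinv[]//|n cn].
apply: (@Cn1_eq _ _ _ (fun y => (derive1 h (inv y))^-1)) => //; first exact: open_cball.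
  by move=> y /dinv[_ <-]; rewrite derive1E.
apply: (@Cn1_comp _ _ _ [set t | t != 0] GRing.inv (fun y => derive1 h (inv y))).
- exact: open_cball.
- by move=> y /invP[ci _]; rewrite /= gt_eqF// h'0.
- exact: Sm_inv.
- apply: (@Cn1_comp _ _ _ (cball c d)) => //; first exact: open_cball.
  by move=> y /invP[/d'd].
Qed.

End LocalInverse.

(** * Even and odd parts of the critical value at a cusp *)

Section CuspCoefficients.
Context {R : realType}.
Implicit Types (J : set R) (u w : R -> R).

Lemma SmD J u w : open J -> Sm J u -> Sm J w -> Sm J (fun x => u x + w x).
Proof. by move=> oJ su sw n; exact: Cn1D. Qed.

Lemma SmM J u w : open J -> Sm J u -> Sm J w -> Sm J (fun x => u x * w x).
Proof. by move=> oJ su sw n; exact: Cn1M. Qed.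

Lemma Sm_cst J c : open J -> Sm J (fun=> c).
Proof. by move=> oJ n; exact: Cn1_cst. Qed.

Lemma Sm_id J : open J -> Sm J id.
Proof. by move=> oJ n; exact: Cn1_id. Qed.

Lemma Sm_eq J u w : open J -> (forall x, J x -> u x = w x) -> Sm J u -> Sm J w.
Proof. by move=> oJ uw su n; exact: Cn1_eq (su n). Qed.

Lemma Sm_sub J J' u : J' `<=` J -> Sm J u -> Sm J' u.
Proof. by move=> JJ su n; exact: Cn1_sub (su n). Qed.

Lemma Sm_comp J J' u w : open J -> (forall x, J x -> J' (w x)) -> Sm J' u -> Sm J w ->
  Sm J (fun x => u (w x)).
Proof. by move=> oJ JJ su sw n; exact: (Cn1_comp oJ JJ (su n) (sw n)). Qed.

Lemma SmN J u : open J -> Sm J u -> Sm J (fun x => - u x).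
Proof.
move=> oJ su; apply: (@Sm_eq _ (fun x => -1 * u x)) => // [x _|]; first by rewrite mulN1r.
by apply: SmM => //; exact: Sm_cst.
Qed.

Lemma SmB J u w : open J -> Sm J u -> Sm J w -> Sm J (fun x => u x - w x).
Proof. by move=> oJ su sw; apply: SmD => //; exact: SmN. Qed.

Lemma SmX J u k : open J -> Sm J u -> Sm J (fun x => u x ^+ k).
Proof.
move=> oJ su; elim: k => [|k IHk]; first exact: Sm_cst.
apply: (@Sm_eq _ (fun x => u x * u x ^+ k)) => // [x _|]; first by rewrite exprS.
exact: SmM.
Qed.

Lemma SmV J u : open J -> (forall x, J x -> u x != 0) -> Sm J u -> Sm J (fun x => (u x)^-1).
Proof. by move=> oJ u0 su; apply: (Sm_comp oJ u0) su; exact: Sm_inv. Qed.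

Lemma Sm_is_derive J u x : Sm J u -> J x -> is_derive x (1 : R) u (derive1 u x).
Proof. by move=> su Jx; split; [exact: (Sm_derivable su)|rewrite derive1E]. Qed.

Lemma Sm_cont J u x : Sm J u -> J x -> {for x, continuous u}.
Proof. by move=> su; exact: (Cn1_continuous (su 0%N)). Qed.

Lemma eq_punctured u w d : 0 < d -> {for 0, continuous u} -> {for 0, continuous w} ->
  (forall s, sball d s -> s != 0 -> u s = w s) -> u 0 = w 0.
Proof.
move=> d0 cu cw uw; apply/eqP; rewrite -subr_eq0; apply/negP => /negP h0.
have ch : {for 0, continuous (fun s => u s - w s)} by exact: continuousB.
have H0 : 0 < `|u 0 - w 0| by rewrite normr_gt0.
have /cvgrPdist_lt/(_ _ H0)/near_cball[e e0 He] := ch.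
pose s := Num.min d e / 2.
have s0 : 0 < s by rewrite divr_gt0// lt_min d0.
have sm : s < Num.min d e by rewrite ltr_pdivrMr// ltr_pMr ?ltr1n// lt_min d0.
move: sm; rewrite lt_min => /andP[sd se].
have := He s; rewrite /cball/= subr0 gtr0_norm// => /(_ se).
have -> : u s = w s by apply: uw; rewrite ?gt_eqF// /sball/= gtr0_norm.
by rewrite subrr subr0 ltxx.
Qed.

Lemma hadamard d u : 0 < d -> Sm (sball d) u -> u 0 = 0 ->
  exists2 w, Sm (sball d) w & forall s, sball d s -> u s = s * w s.
Proof.
move=> d0 su u0; exists (segavg 0 (derive1 u) 0).
  by apply: Sm_segavg0 => //; exact: Sm_derive1.
move=> s sd; have := segavg_taylor1 (@sball_convex R d) su (sball0 d0) sd.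
by rewrite u0 !subr0.
Qed.

Lemma is_derive_sqr s : is_derive s (1 : R) (fun t : R => t ^+ 2) (2 * s).
Proof.
have := is_deriveX 2 (is_derive_id s (1 : R)); rewrite /GRing.scale/= => h.
by apply: is_derive_eq h _; rewrite expr1 mulr1.
Qed.

Lemma is_derive_cube s : is_derive s (1 : R) (fun t : R => t ^+ 3) (3 * s ^+ 2).
Proof.
have := is_deriveX 3 (is_derive_id s (1 : R)); rewrite /GRing.scale/= => h.
by apply: is_derive_eq h _; rewrite mulr1.
Qed.

Lemma is_derive_comp_sqr u (s l : R) : is_derive (s ^+ 2) (1 : R) u l ->
  is_derive s (1 : R) (fun t => u (t ^+ 2)) (l * (2 * s)).
Proof. by move=> du; exact: (@is_derive1_comp _ u (fun t => t ^+ 2) s _ _ du (is_derive_sqr s)). Qed.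

(** The even part of v is a(s ^ 2). The odd part is s b(s ^ 2), and v'(0) = 0 forces b(0) = 0, so it
    is s ^ 3 times a function of s ^ 2. The factor - 2 / 3 is chosen so that dividing v' by 2 s
    leaves the term - c(s ^ 2) s, which gives c(0) = - mu'(0). *)
Lemma cusp_coefficients d (v mu : R -> R) : 0 < d -> Sm (sball d) v -> Sm (sball d) mu ->
  (forall s, sball d s -> derive1 v s = 2 * s * mu s) ->
  exists a c, [/\ Sm (sball (d ^+ 2)) a, Sm (sball (d ^+ 2)) c, c 0 = - derive1 mu 0,
   forall s, sball d s -> v s = a (s ^+ 2) - 2 / 3 * c (s ^+ 2) * s ^+ 3 &
   forall s, sball d s -> mu s = derive1 a (s ^+ 2)
     - 2 / 3 * derive1 c (s ^+ 2) * s ^+ 3 - c (s ^+ 2) * s].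
Proof.
move=> d0 sv smu v'.
have oJ := @open_sball R d; have oJ2 := @open_sball R (d ^+ 2).
have d20 : 0 < d ^+ 2 by rewrite exprn_gt0.
have J0 := sball0 d0; have J20 := sball0 d20.
have svN : Sm (sball d) (fun s => v (- s)).
  by apply: (Sm_comp oJ (@sballN _ _)) => //; apply: SmN => //; exact: Sm_id.
have sq s : sball d s -> sball (d ^+ 2) (s ^+ 2).
  by rewrite /sball/= => sd; rewrite normrX ltr_pXn2r// ?nnegrE// ltW.
have ssq : Sm (sball d) (fun s => s ^+ 2) by apply: SmX => //; exact: Sm_id.
have scube : Sm (sball d) (fun s => s ^+ 3) by apply: SmX => //; exact: Sm_id.
pose ve s := 2^-1 * (v s + v (- s)); pose vo s := 2^-1 * (v s - v (- s)).
have sve : Sm (sball d) ve by apply: SmM => //; [exact: Sm_cst|exact: SmD].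
have svo : Sm (sball d) vo by apply: SmM => //; [exact: Sm_cst|exact: SmB].
have eve : even_on (sball d) ve by move=> s _; rewrite /ve opprK addrC.
have [a sa aE] := whitney_even d0 sve eve.
have vo0 : vo 0 = 0 by rewrite /vo oppr0 subrr mulr0.
have [e1 se1 e1E] := hadamard d0 svo vo0.
have ee1 : even_on (sball d) e1.
  move=> s sd; have [->|s0] := eqVneq s 0; first by rewrite oppr0.
  apply: (mulfI s0); rewrite -e1E// -[LHS]opprK -mulNr -e1E; last exact: sballN.
  by rewrite /vo opprK; ring.
have [b sb bE] := whitney_even d0 se1 ee1.
have b0 : b 0 = 0.
  have -> : b 0 = e1 0 by rewrite -bE// expr0n.
  have h1 := is_derive_eq (is_deriveM (is_derive_id 0 (1 : R)) (Sm_is_derive se1 J0)) erefl.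
  have dN : is_derive (0 : R) (1 : R) (-%R) (-1 : R).
    by have := is_deriveN (is_derive_id 0 (1 : R)).
  have dv : is_derive (0 : R) (1 : R) v 0.
    by apply: (is_derive_eq (Sm_is_derive sv J0)); rewrite v'// mulr0 mul0r.
  have dvN : is_derive (0 : R) (1 : R) (fun s => v (- s)) 0.
    have dv' : is_derive (- 0 : R) (1 : R) v 0 by rewrite oppr0.
    by apply: (is_derive_eq (is_derive1_comp dv' dN)); rewrite mul0r.
  have h2 : is_derive (0 : R) (1 : R) vo 0.
    have := is_deriveZ 2^-1 (is_deriveB dv dvN).
    rewrite /GRing.scale/= subrr mulr0; exact.
  have h3 : is_derive (0 : R) (1 : R) vo (e1 0).
    apply: (@near_eq_is_derive _ _ _ (id * e1)).
      apply: filterS (open_nbhs_nbhs (conj oJ J0)) => s sd.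
      by rewrite e1E.
    by apply: (is_derive_eq h1); rewrite /GRing.scale/= mul0r add0r mulr1.
  by have [_ <-] := h3; have [_ ->] := h2.
have [c1 sc1 c1E] := hadamard d20 sb b0.
pose c t := - (3 / 2) * c1 t.
have sc : Sm (sball (d ^+ 2)) c by apply: SmM => //; exact: Sm_cst.
have vE s : sball d s -> v s = a (s ^+ 2) - 2 / 3 * c (s ^+ 2) * s ^+ 3.
  move=> sd; rewrite aE// /c.
  have -> : v s = ve s + vo s by rewrite /ve /vo; field.
  rewrite e1E// -bE// c1E; last exact: sq.
  by field.
have sac : Sm (sball d) (fun s => a (s ^+ 2)) by exact: (Sm_comp oJ sq).
have scc : Sm (sball d) (fun s => c (s ^+ 2)) by exact: (Sm_comp oJ sq).
have sa' : Sm (sball d) (fun s => derive1 a (s ^+ 2)).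
  by apply: (Sm_comp oJ sq) => //; exact: Sm_derive1.
have sc' : Sm (sball d) (fun s => derive1 c (s ^+ 2)).
  by apply: (Sm_comp oJ sq) => //; exact: Sm_derive1.
pose rhs s := derive1 a (s ^+ 2) - 2 / 3 * derive1 c (s ^+ 2) * s ^+ 3 - c (s ^+ 2) * s.
have srhs : Sm (sball d) rhs.
  apply: SmB => //; last by apply: SmM => //; exact: Sm_id.
  apply: SmB => //; apply: SmM => //; apply: SmM => //; exact: Sm_cst.
(* Off 0 the derivative of the expansion of v is divided by 2 s; the value at 0 then follows by
   continuity of both sides. *)
have muE s : sball d s -> s != 0 -> mu s = rhs s.
  move=> sd s0; have s20 : 2 * s != 0 by rewrite mulf_neq0.
  apply: (mulfI s20); rewrite -v'//.
  have h1 := is_derive_comp_sqr (Sm_is_derive sa (sq s sd)).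
  have h2 := is_derive_comp_sqr (Sm_is_derive sc (sq s sd)).
  have h3 := is_deriveB h1 (is_deriveM (is_deriveZ (2 / 3) h2) (is_derive_cube s)).
  have dv : is_derive s (1 : R) v (2 * s * rhs s).
    apply: (@near_eq_is_derive _ R R (fun t : R => a (t ^+ 2) - 2 / 3 * c (t ^+ 2) * t ^+ 3)).
      by apply: filterS (open_nbhs_nbhs (conj oJ sd)) => t /vE.
    apply: (is_derive_eq h3).
    rewrite /GRing.scale/= /rhs -[(2 / 3) *: c (s ^+ 2)]/(2 / 3 * c (s ^+ 2)).
    by field.
  by rewrite derive1E; case: dv.
have mu0 : mu 0 = rhs 0.
  exact: (eq_punctured d0 (Sm_cont smu J0) (Sm_cont srhs J0) muE).
have muE' s : sball d s -> mu s = rhs s.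
  by move=> sd; have [->//|s0] := eqVneq s 0; exact: muE.
exists a, c; split=> //.
have K0 : sball (d ^+ 2) (0 ^+ 2) by rewrite expr0n.
have h1 := is_derive_comp_sqr (Sm_is_derive (Sm_derive1 sa) K0).
have h2 := is_derive_comp_sqr (Sm_is_derive sc K0).
have h3 := is_derive_comp_sqr (Sm_is_derive (Sm_derive1 sc) K0).
have h4 := is_deriveB (is_deriveB h1 (is_deriveM (is_deriveZ (2 / 3) h3) (is_derive_cube 0)))
  (is_deriveM h2 (is_derive_id 0 (1 : R))).
have dmu : is_derive (0 : R) (1 : R) mu (- c 0).
  apply: (@near_eq_is_derive _ _ _ rhs).
    by apply: filterS (open_nbhs_nbhs (conj oJ J0)) => t /muE'.
  apply: (is_derive_eq h4); rewrite /GRing.scale/=.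
  rewrite -[(2 / 3) *: _]/(2 / 3 * derive1 c (0 ^+ 2)).
  rewrite !expr0n/=.
  move: (derive1 (derive1 a) 0) (derive1 c 0) (derive1 (derive1 c) 0) (c 0) => a2 c1' c2' c0'.
  by ring.
by rewrite derive1E; case: dmu => _ ->; rewrite opprK.
Qed.

End CuspCoefficients.

Section GermAtPoint.
Context {R : realType}.
Local Notation V4 := 'rV[R]_4.

(** Cylinders over the (k, r)-plane, with k again in the slot [i_pphi]: a neighbourhood of one point
    then contains a product of intervals in k and r, with p_r and phi free. *)
Definition depends_on_k_r (W : set V4) := forall x y : V4,
  x ord0 i_pphi = y ord0 i_pphi -> x ord0 i_r = y ord0 i_r -> W x -> W y.

Lemma nbhs_box (W : set V4) (k0 r0 : R) : depends_on_k_r W -> nbhs (mk4 0 k0 r0 0) W ->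
  exists2 d, 0 < d &
    forall x : V4, cball k0 d (x ord0 i_pphi) -> cball r0 d (x ord0 i_r) -> W x.
Proof.
move=> dW /nbhs_ballP[d /= d0 dB]; exists d => // x xk xr.
apply: (dW (mk4 0 (x ord0 i_pphi) (x ord0 i_r) 0)); rewrite ?mk4E//.
apply: dB; rewrite -ball_normE/=.
rewrite [X in X < _]/Num.Def.normr/= mx_normrE.
apply/bigmax_ltP; split=> // -[i j] _ /=; rewrite (ord1 i) !mxE.
by move: j; apply: ord4P; rewrite /= ?subrr ?normr0// distrC.
Qed.

Lemma partial_r_ext (Q : R -> R -> R) (x y : V4) :
  let Qx (z : V4) := Q (z ord0 i_pphi) (z ord0 i_r) in
  x ord0 i_pphi = y ord0 i_pphi -> x ord0 i_r = y ord0 i_r ->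
  partial i_r Qx x = partial i_r Qx y.
Proof.
move=> Qx E1 E2; rewrite /partial /derive.
have -> : (fun h : R => h^-1 *: ((Qx \o shift x) (h *: delta_mx ord0 i_r) - Qx x)) =
    (fun h : R => h^-1 *: ((Qx \o shift y) (h *: delta_mx ord0 i_r) - Qx y)).
  by apply/funext => h; rewrite /= /Qx !mxE E1 E2.
by [].
Qed.

(** Positivity of the r-derivative of [Q] is asked at the base point alone and the domain is any
    open cylinder; continuity provides the box on which the normal form is applied. *)
Lemma germ_of_normal_form (L : R) (f Lam : R -> R) (r0 k0 d : R) (P C A : R -> R)
    (Q g : R -> R -> R) (G : V4 -> R * R) (sg tau : R) (W : set V4) :
  let Qx (x : V4) := Q (x ord0 i_pphi) (x ord0 i_r) in
  let z0 : V4 := mk4 0 k0 r0 0 in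
  0 < d -> Sm setT Lam -> open W -> depends_on_k_r W -> W z0 ->
  (forall x : V4, W x -> 0 < x ord0 i_r < L) ->
  Sm (cball k0 d) P -> Sm (cball k0 d) C -> smooth_on W Qx ->
  (forall k, cball k0 d k -> 0 < derive1 P k) -> (forall k, cball k0 d k -> C k != 0) ->
  0 < partial i_r Qx z0 -> P k0 = 0 -> Q k0 r0 = 0 -> sg * sg = 1 -> tau * tau = 1 ->
  (forall x : V4, W x -> let k := x ord0 i_pphi in let r := x ord0 i_r in
    g (tau * Q k r) (sg * P k) = C k ^+ 2 * ((k - Lam r) ^+ 2 / f r ^+ 2) + A k) ->
  (forall y, G y = ((y ord0 i_p1 ^+ 2 + g (y ord0 i_q1) (y ord0 i_p2)) / 2, y ord0 i_p2)) ->
  foliation_germ L f Lam (orbit_set Lam r0 k0) G.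
Proof.
move=> Qx z0 d0 sLam oW dW Wz0 WL sP sC sQ P'0 C0 Q'0 Pk0 Qk0 sg2 tau2 gE GE.
pose W' := [set x : V4 | W x /\ 0 < partial i_r Qx x].
have dW' : depends_on_k_r W'.
  move=> x y E1 E2 [Wx px]; split; first exact: dW Wx.
  by rewrite -(partial_r_ext Q E1 E2).
have nW' : nbhs z0 W'.
  have [_ /(_ i_r) cp] := sQ 1%N.
  have n1 : nbhs z0 W by exact: open_nbhs_nbhs.
  have cpz : {for z0, continuous (partial i_r Qx)} by exact: cp.
  have n2 : nbhs z0 [set x | 0 < partial i_r Qx x].
    exact: (cpz _ (open_nbhs_nbhs (conj (@open_gt R 0) Q'0))).
  exact: (filterI n1 n2).
have [d1 d10 box1] := nbhs_box dW' nW'.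
pose d' := Num.min d d1.
have d'0 : 0 < d' by rewrite lt_min d0.
have d'd c s : cball c d' s -> cball c d s by rewrite /cball/= lt_min => /andP[].
have d'd1 c s : cball c d' s -> cball c d1 s by rewrite /cball/= lt_min => /andP[].
have bx (x : V4) : cball k0 d' (x ord0 i_pphi) -> cball r0 d' (x ord0 i_r) -> W' x.
  by move=> /d'd1 h1 /d'd1 h2; exact: box1.
apply: (@normal_form_germ R L f Lam r0 k0 d' P C A Q g G sg tau) => //.
- move=> r rd; have [] := bx (mk4 0 k0 r 0); rewrite ?mk4E//; first exact: cball_center.
  by move=> /WL; rewrite mk4E.
- by apply: Sm_sub sP => s /d'd.
- by apply: Sm_sub sC => s /d'd.
- by move=> n; apply: Cn_on_sub (sQ n) => x [h1 h2]; have [] := bx x h1 h2.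
- by move=> k /d'd; exact: P'0.
- by move=> k /d'd; exact: C0.
- by move=> x [h1 h2]; have [] := bx x h1 h2.
- move=> k r kd rd; have [|//|Wx _] := bx (mk4 0 k r 0); rewrite ?mk4E//.
  by have := gE _ Wx; rewrite /= !mk4E.
Qed.

End GermAtPoint.

(** * Derivatives along the curve of critical circles *)

Section Curve.
Context {R : realType}.
Variables (f Lam : R -> R).
Hypothesis sf : Sm setT f.
Hypothesis sL : Sm setT Lam.

Definition slope (r : R) : R := - derive1 Lam r / derive1 f r.

Lemma kfunE r : kfun f Lam r = Lam r + f r * slope r.
Proof. by rewrite /kfun /slope mulNr mulrN. Qed.

Lemma hfunE r : hfun f Lam r = slope r ^+ 2 / 2.
Proof. by rewrite /hfun /slope mulNr sqrrN. Qed.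

Lemma open_immersed : open [set r | derive1 f r != 0].
Proof.
have -> : [set r | derive1 f r != 0] = derive1 f @^-1` [set y : R | y != 0] by [].
apply: open_comp; last exact: open_neq.
by move=> r _; apply: (Sm_cont (Sm_derive1 sf)).
Qed.

Let D := [set r | derive1 f r != 0].
Let oD : open D := open_immersed.
Let sub u : Sm setT u -> Sm D u. Proof. exact: Sm_sub. Qed.
Let sf1 := Sm_derive1 sf.
Let sL1 := Sm_derive1 sL.

Lemma Sm_slope : Sm D slope.
Proof.
apply: SmM => //; first by apply: SmN => //; exact: sub.
by apply: SmV => //; exact: sub.
Qed.

Lemma Sm_kfun : Sm D (kfun f Lam).
Proof.
apply: (@Sm_eq _ _ (fun r => Lam r + f r * slope r)) => // [r _|]; first by rewrite kfunE.
by apply: SmD => //; [exact: sub|apply: SmM => //; [exact: sub|exact: Sm_slope]].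
Qed.

Lemma Sm_hfun : Sm D (hfun f Lam).
Proof.
apply: (@Sm_eq _ _ (fun r => slope r ^+ 2 * 2^-1)) => // [r _|]; first by rewrite hfunE.
by apply: SmM => //; [apply: SmX => //; exact: Sm_slope|exact: Sm_cst].
Qed.

Lemma Sm_inflection : Sm setT (inflection f Lam).
Proof.
apply: SmB; [exact: openT| |]; apply: SmM; do ?exact: openT; do ?exact: Sm_derive1.
Qed.

Lemma derive1_slope r : D r -> derive1 slope r = - inflection f Lam r / derive1 f r ^+ 2.
Proof.
move=> Dr; have h1 := Sm_is_derive sL1 (I : setT r); have h2 := Sm_is_derive sf1 (I : setT r).
have [_] := is_deriveM (is_deriveN h1) (is_deriveV Dr h2).
move=> H; rewrite [LHS]derive1E; transitivity (- derive1 Lam r * (- derive1 f r ^- 2 * derive1 (derive1 f) r) +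
  (derive1 f r)^-1 * - derive1 (derive1 Lam) r); first exact: H.
rewrite /inflection.
rewrite -[derive1n 2 Lam r]/(derive1 (derive1 Lam) r) -[derive1n 2 f r]/(derive1 (derive1 f) r).
have : derive1 f r != 0 := Dr.
move: (derive1 (derive1 Lam) r) (derive1 (derive1 f) r) (derive1 Lam r) (derive1 f r) => a b c d d0.
by field.
Qed.

(** Lam' + f' m = 0 by the definition of m, so only f m' remains. *)
Lemma derive1_kfun r : D r -> derive1 (kfun f Lam) r = f r * derive1 slope r.
Proof.
move=> Dr; have h0 := Sm_is_derive Sm_slope Dr.
have hL := Sm_is_derive sL (I : setT r); have hf := Sm_is_derive sf (I : setT r).
have [_] := is_deriveD hL (is_deriveM hf h0).
rewrite (_ : Lam + f * slope = kfun f Lam); last by apply/funext => s; rewrite kfunE.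
move=> H; rewrite [LHS]derive1E H /GRing.scale/=.
by rewrite addrCA {2}/slope; field.
Qed.

Lemma derive1_hfun r : D r -> derive1 (hfun f Lam) r = slope r * derive1 slope r.
Proof.
move=> Dr; have h0 := Sm_is_derive Sm_slope Dr.
have [_] := is_deriveZ 2^-1 (is_deriveX 2 h0).
rewrite (_ : 2^-1 \*: slope ^+ 2 = hfun f Lam); last first.
  by apply/funext => s; rewrite hfunE [RHS]mulrC.
move=> H; rewrite [LHS]derive1E H /GRing.scale/= expr1.
by field.
Qed.

End Curve.

Section Parabolic.
Context {R : realType}.
Local Notation V4 := 'rV[R]_4.

Lemma Sm_segavg (J : set R) a (g : R -> R) x0 : open J ->
  (forall x y u, J x -> J y -> 0 <= u <= 1 -> J ((1 - u) * x + u * y)) -> J x0 ->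
  Sm J g -> Sm J (segavg a g x0).
Proof.
move=> oJ cJ Jx0 sg n; have := segavg_smooth oJ cJ a sg n.
have E t : line i_pphi (@mk4 R x0 0 0 0) t = mk4 x0 t 0 0.
  by rewrite /line; apply/rowP; apply: ord4P; rewrite !mxE/= ?(mulr1, mulr0, addr0, add0r).
move=> /(@Cn1_line _ n _ J i_pphi (mk4 x0 0 0 0) _ oJ).
rewrite (_ : (fun t : R => _) = segavg a g x0).
  by apply=> t Jt; rewrite E /= !mk4E.
by apply/funext => t; rewrite E !mk4E.
Qed.

Lemma Cn_on_N n (U : set V4) (u : V4 -> R) : open U -> Cn_on n U u -> Cn_on n U (fun x => - u x).
Proof.
move=> oU cu; apply: (@Cn_on_eq _ _ _ (fun x => -1 * u x)) => // [x _|].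
  by rewrite mulN1r.
by apply: Cn_onM => //; exact: Cn_on_cst.
Qed.

Lemma Cn_on_B n (U : set V4) (u w : V4 -> R) : open U -> Cn_on n U u -> Cn_on n U w ->
  Cn_on n U (fun x => u x - w x).
Proof. by move=> oU cu cw; apply: Cn_onD => //; exact: Cn_on_N. Qed.

Lemma Cn_on_ext n (U : set V4) (u w : V4 -> R) : u =1 w -> Cn_on n U u -> Cn_on n U w.
Proof. by move=> /funext ->. Qed.

Lemma Cn_on_comp_mk4 n (U U' : set V4) (u a b c e : V4 -> R) : open U ->
  (forall x, U x -> U' (mk4 (a x) (b x) (c x) (e x))) -> Cn_on n U' u ->
  Cn_on n U a -> Cn_on n U b -> Cn_on n U c -> Cn_on n U e ->
  Cn_on n U (fun x => u (mk4 (a x) (b x) (c x) (e x))).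
Proof.
move=> oU UU' cu ca cb cc ce.
exact: (Cn_on_comp (phi := fun x => mk4 (a x) (b x) (c x) (e x)) oU UU' cu
  (Cn_on_mk4 ca cb cc ce)).
Qed.

Lemma open_setI_preimage (U : set V4) (u : V4 -> R) (J : set R) :
  open U -> open J -> Cn_on 0 U u -> open (U `&` u @^-1` J).
Proof.
move=> oU oJ cu; rewrite openE => x [Ux Jx].
have n1 : nbhs x U by exact: open_nbhs_nbhs.
have n2 : nbhs x (u @^-1` J) by exact: (cu x Ux _ (open_nbhs_nbhs (conj oJ Jx))).
exact: (filterI n1 n2).
Qed.

(** The Morse lemma on the line: s = (r - r0) sqrt q, where q is the second-order Taylor factor,
    positive near r0. *)
Lemma morse1 (h : R -> R) r0 d : 0 < d -> Sm (cball r0 d) h -> derive1 h r0 = 0 ->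
  0 < derive1 (derive1 h) r0 ->
  exists d' s, [/\ 0 < d', d' <= d, Sm (cball r0 d') s, 0 < derive1 s r0 &
    s r0 = 0 /\ forall r, cball r0 d' r -> h r = h r0 + s r ^+ 2].
Proof.
move=> d0 sh h1 h2; have oJ := @open_cball R r0 d; have cJ := @cball_convex R r0 d.
have cc := cball_center r0 d0.
pose q r := segavg 0 (derive1 (derive1 h)) r0 r - segavg 1 (derive1 (derive1 h)) r0 r.
have sq : Sm (cball r0 d) q.
  by apply: SmB => //; apply: Sm_segavg => //; do 2!apply: Sm_derive1.
have q0 : 0 < q r0.
  by rewrite /q !(segavg_diag _ _).1 (segavg_diag _ _).2; lra.
have [d1 d10 H1] : exists2 d1, 0 < d1 & forall s, cball r0 d1 s -> 0 < q s.
  apply: near_cball; have cq : {for r0, continuous q} := Sm_cont sq cc.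
  exact: (cq _ (open_nbhs_nbhs (conj (@open_gt R 0) q0))).
pose d' := Num.min d d1.
have d'0 : 0 < d' by rewrite lt_min d0 d10.
have d'd s : cball r0 d' s -> cball r0 d s by rewrite /cball/= lt_min => /andP[].
have d'd1 s : cball r0 d' s -> cball r0 d1 s by rewrite /cball/= lt_min => /andP[].
have oJ' := @open_cball R r0 d'.
exists d', (fun r => (r - r0) * Num.sqrt (q r)).
have sS : Sm (cball r0 d') (fun r => Num.sqrt (q r)).
  have sq' : Sm (cball r0 d') q by apply: Sm_sub sq => r /d'd.
  have qpos r : cball r0 d' r -> [set t : R | 0 < t] (q r) by move=> /d'd1/H1.
  exact: (Sm_comp oJ' qpos (@Sm_sqrt R) sq').
have cc' := cball_center r0 d'0.
have ds : is_derive r0 (1 : R) (fun r => (r - r0) * Num.sqrt (q r)) (Num.sqrt (q r0)).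
  have h3 := is_deriveM (is_deriveB (is_derive_id r0 (1 : R)) (is_derive_cst r0 r0 (1 : R)))
     (Sm_is_derive sS cc').
  apply: (is_derive_eq h3); rewrite /GRing.scale/= !fctE/=.
  by rewrite subrr mul0r add0r subr0 mulr1.
split=> //.
- by rewrite ge_min lexx.
- apply: SmM => //; apply: SmB => //; [exact: Sm_id|exact: Sm_cst].
- by rewrite derive1E; case: ds => _ ->; rewrite sqrtr_gt0.
split; first by rewrite subrr mul0r.
move=> r cr; rewrite exprMn sqr_sqrtr; last by apply: ltW; exact/H1/d'd1.
have := segavg_taylor2 cJ sh cc (d'd _ cr); rewrite h1 mulr0 subr0 => <-.
by rewrite addrC subrK.
Qed.

End Parabolic.

(** * The parabolic germ at a simple inflection *)

Section ParabolicGerm.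
Context {R : realType}.
Local Notation V4 := 'rV[R]_4.
Variables (L : R) (f Lam : R -> R) (r0 : R).
Hypothesis sf : Sm setT f.
Hypothesis sL : Sm setT Lam.
Hypothesis r0L : 0 < r0 < L.
Hypothesis f0 : forall r, 0 < r < L -> 0 < f r.
Hypothesis f'0 : derive1 f r0 != 0.

Let D := [set r | derive1 f r != 0].
Let oD : open D := open_immersed sf.
Let kap := kfun f Lam.
Let m := slope f Lam.
Let k0 := kap r0.

Let good_radius : exists2 d, 0 < d & forall r, cball r0 d r -> 0 < r < L /\ D r.
Proof.
apply: near_cball; have h1 : nbhs r0 [set r | 0 < r < L].
  have -> : [set r | 0 < r < L] = `]0, L[ by apply/seteqP; split=> r /=; rewrite in_itv.
  by apply: open_nbhs_nbhs; split; [exact: itv_open|rewrite /= in_itv].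
have h2 : nbhs r0 D by exact: open_nbhs_nbhs.
exact: (filterI h1 h2).
Qed.

Hypothesis inflection0 : inflection f Lam r0 = 0.
Hypothesis inflection1 : derive1 (inflection f Lam) r0 != 0.
Hypothesis Lam'0 : derive1 Lam r0 != 0.

Let m'0 : derive1 m r0 = 0.
Proof. by rewrite derive1_slope// inflection0 oppr0 mul0r. Qed.

(** m' is a nonvanishing multiple of the inflection function, so at a zero of the latter only its
    derivative contributes, and the zero is simple. *)
Let m''0 : derive1 (derive1 m) r0 != 0.
Proof.
pose u r := (- inflection f Lam r) * (derive1 f r ^+ 2)^-1.
have -> : derive1 (derive1 m) r0 = derive1 u r0.
  rewrite !derive1E; apply: near_eq_derive.
  by apply: filterS (open_nbhs_nbhs (conj oD f'0)) => r Dr; rewrite derive1_slope.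
have f20 : (derive1 f ^+ 2 : R -> R) r0 != 0 by rewrite !fctE expf_neq0.
have h1 := is_deriveN (Sm_is_derive (Sm_inflection sf sL) (I : setT r0)).
have h2 := @is_deriveV R (derive1 f ^+ 2) _ _ _ f20 (is_deriveX 2 (Sm_is_derive (Sm_derive1 sf) (I : setT r0))).
have [_] := is_deriveM h1 h2 => H.
have -> : derive1 u r0 = (derive1 f r0 ^+ 2)^-1 * - derive1 (inflection f Lam) r0.
  rewrite derive1E; etransitivity; first exact: H.
  by rewrite /GRing.scale/= !fctE inflection0 oppr0 mul0r add0r.
by rewrite mulf_neq0 ?invr_eq0// oppr_eq0.
Qed.

Let kap'0 : derive1 kap r0 = 0.
Proof. by rewrite derive1_kfun// m'0 mulr0. Qed.

Let kap''E : derive1 (derive1 kap) r0 = f r0 * derive1 (derive1 m) r0.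
Proof.
pose u r := f r * derive1 m r.
have -> : derive1 (derive1 kap) r0 = derive1 u r0.
  rewrite !derive1E; apply: near_eq_derive.
  by apply: filterS (open_nbhs_nbhs (conj oD f'0)) => r Dr; rewrite derive1_kfun.
have h1 := Sm_is_derive sf (I : setT r0).
have h2 := Sm_is_derive (Sm_derive1 (Sm_slope sf sL)) f'0.
have [_] := is_deriveM h1 h2 => H.
rewrite [LHS]derive1E; etransitivity; first exact: H.
by rewrite /GRing.scale/= m'0 mul0r addr0.
Qed.

Let kap''0 : derive1 (derive1 kap) r0 != 0.
Proof. by rewrite kap''E mulf_neq0// gt_eqF// f0. Qed.

Lemma curvature_kfun : derive1 kap r0 = 0 /\ derive1 (derive1 kap) r0 != 0.
Proof. by []. Qed.

Let m0 : m r0 != 0.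
Proof. by rewrite /m /slope mulf_neq0 ?oppr_eq0 ?invr_eq0. Qed.

(** Makes r0 a minimum of eps k(r), so that k(r) - k0 = eps s ^ 2 with s a Morse coordinate. *)
Let eps := Num.sg (derive1 (derive1 kap) r0).
Let eps2 : eps * eps = 1.
Proof. by rewrite -expr2 sqr_sg kap''0. Qed.

Let square_coordinate : exists d s,
  [/\ 0 < d, forall r, cball r0 d r -> 0 < r < L /\ D r, Sm (cball r0 d) s,
   0 < derive1 s r0 & s r0 = 0 /\ forall r, cball r0 d r -> kap r = k0 + eps * s r ^+ 2].
Proof.
have [d d0 dD] := good_radius; have oJ := @open_cball R r0 d.
have skap : Sm (cball r0 d) kap by apply: Sm_sub (Sm_kfun sf sL) => r /dD[].
have cc := cball_center r0 d0.
have sh : Sm (cball r0 d) (fun r => eps * kap r) by apply: SmM => //; exact: Sm_cst.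
have h1 r : cball r0 d r -> is_derive r (1 : R) (fun r => eps * kap r) (eps * derive1 kap r).
  by move=> cr; exact: is_deriveZ (Sm_is_derive skap cr).
have E1 : derive1 (fun r => eps * kap r) r0 = 0.
  by rewrite derive1E; have [_ ->] := h1 _ cc; rewrite kap'0 mulr0.
have E2 : derive1 (derive1 (fun r => eps * kap r)) r0 = eps * derive1 (derive1 kap) r0.
  have h2 : is_derive r0 (1 : R) (fun r => eps * derive1 kap r) (eps * derive1 (derive1 kap) r0).
    exact: is_deriveZ (Sm_is_derive (Sm_derive1 skap) cc).
  have [_ <-] : is_derive r0 (1 : R) (derive1 (fun r => eps * kap r))
      (eps * derive1 (derive1 kap) r0).
    apply: near_eq_is_derive h2.
    apply: filterS (open_nbhs_nbhs (conj oJ cc)) => r cr.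
    by rewrite [RHS]derive1E; have [_ ->] := h1 _ cr.
  by rewrite derive1E.
have p2 : 0 < derive1 (derive1 (fun r => eps * kap r)) r0.
  by rewrite E2 /eps -normrEsg normr_gt0.
have [d' [s [d'0 d'd ss s'0 [s0 sE]]]] := morse1 d0 sh E1 p2.
exists d', s; split=> //.
  by move=> r rd; apply: dD; exact: lt_le_trans d'd.
split=> // r cr; have := sE r cr; rewrite /k0 => E.
by rewrite -[kap r]mul1r -[kap r0]mul1r -eps2 -!mulrA E mulrDr.
Qed.

(** Along the curve h' = m m' = (m / f) k', and k = k0 + eps s ^ 2, so h has s-derivative 2 s mu
    with mu = eps m / f. As m' = 0 at the inflection, m / f has there the derivative - m f' / f ^ 2,
    which is nonzero; hence c(0) is nonzero. *)
Let cusp_data : exists d e s rho a c,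
  [/\ [/\ 0 < d, 0 < e & forall r, cball r0 d r -> 0 < r < L /\ D r],
   [/\ Sm (cball r0 d) s, 0 < derive1 s r0, s r0 = 0 &
     forall r, cball r0 d r -> kap r = k0 + eps * s r ^+ 2],
   forall r, cball r0 d r -> sball e (s r) -> rho (s r) = r,
   [/\ Sm (sball (e ^+ 2)) a, Sm (sball (e ^+ 2)) c & c 0 != 0] &
   forall r, cball r0 d r -> sball e (s r) ->
     hfun f Lam r = a (s r ^+ 2) - 2 / 3 * c (s r ^+ 2) * s r ^+ 3 /\
     eps * (m r / f r) = derive1 a (s r ^+ 2)
       - 2 / 3 * derive1 c (s r ^+ 2) * s r ^+ 3 - c (s r ^+ 2) * s r].
Proof.
have [d [s [d0 dD ss s'0 [s0 sE]]]] := square_coordinate.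
have [d' [e [rho [d'0 d'd e0 srho [rhoP rhoK s'pos]]]]] := local_inverse_pos d0 ss s'0.
have cbs : cball (s r0) e = sball e.
  by apply/seteqP; split=> y; rewrite /cball /sball/= s0 subr0.
rewrite cbs in srho rhoP rhoK.
have d'dr r : cball r0 d' r -> cball r0 d r by move=> h; exact: lt_le_trans d'd.
have oJ := @open_sball R e; have J0 := sball0 e0.
pose v y := hfun f Lam (rho y); pose w r := m r * (f r)^-1.
pose mu y := eps * w (rho y).
have rD y : sball e y -> D (rho y) by move=> /rhoP[/d'dr/dD[]].
have sw : Sm (cball r0 d) w.
  have oJd := @open_cball R r0 d.
  apply: SmM => //; first by apply: Sm_sub (Sm_slope sf sL) => r /dD[].
  apply: SmV => //; first by move=> r /dD[rL _]; rewrite gt_eqF// f0.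
  exact: Sm_sub sf.
have sv : Sm (sball e) v by exact: (Sm_comp oJ rD (Sm_hfun sf sL) srho).
have swr : Sm (sball e) (fun y => w (rho y)).
  by apply: (Sm_comp oJ _ sw srho) => y /rhoP[/d'dr].
have smu : Sm (sball e) mu by apply: SmM => //; exact: Sm_cst.
have krho y : sball e y -> f (rho y) * derive1 m (rho y) * derive1 rho y = eps * (2 * y).
  move=> ye; have Dr := rD y ye.
  have h1 := is_derive1_comp (Sm_is_derive (Sm_kfun sf sL) Dr) (Sm_is_derive srho ye).
  have h2 : is_derive y (1 : R) (fun y => k0 + eps * y ^+ 2) (eps * (2 * y)).
    have := is_deriveD (is_derive_cst k0 y (1 : R)) (is_deriveZ eps (is_derive_sqr y)).
    by rewrite add0r.
  have h3 : is_derive y (1 : R) (fun y => k0 + eps * y ^+ 2) (derive1 kap (rho y) * derive1 rho y).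
    apply: near_eq_is_derive h1; apply: filterS (open_nbhs_nbhs (conj oJ ye)) => t te.
    by rewrite /= -/kap sE ?(rhoP t te).2//; apply: d'dr; exact: (rhoP t te).1.
  by rewrite -derive1_kfun//; have [_ <-] := h2; have [_ ->] := h3.
have v' y : sball e y -> derive1 v y = 2 * y * mu y.
  move=> ye; have Dr := rD y ye.
  have h1 := is_derive1_comp (Sm_is_derive (Sm_hfun sf sL) Dr) (Sm_is_derive srho ye).
  rewrite derive1E; have [_ ->] := h1; rewrite derive1_hfun// -/m.
  have fr : f (rho y) != 0.
    by rewrite gt_eqF// f0//; have [/d'dr/dD[]] := rhoP y ye.
  apply: (mulfI fr); have := krho y ye => E.
  transitivity (m (rho y) * (f (rho y) * derive1 m (rho y) * derive1 rho y)); first by ring.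
  by rewrite E /mu /w; field.
have rho0 : rho 0 = r0 by rewrite -s0 rhoK ?s0//; exact: cball_center.
have mu'0 : derive1 mu 0 != 0.
  have cc := cball_center r0 d0; have fr0 : f r0 != 0 by rewrite gt_eqF// f0.
  have h1 : is_derive (rho 0) (1 : R) w (derive1 w r0).
    by rewrite rho0; exact: Sm_is_derive sw cc.
  have h2 := is_deriveZ eps (is_derive1_comp h1 (Sm_is_derive srho J0)).
  rewrite derive1E; have [_ ->] : is_derive (0 : R) (1 : R) mu
    (eps * (derive1 w r0 * derive1 rho 0)) by exact: h2.
  have h3 : is_derive (rho 0) (1 : R) s (derive1 s r0).
    by rewrite rho0; exact: Sm_is_derive ss cc.
  have h4 := is_derive1_comp h3 (Sm_is_derive srho J0).
  have h5 : is_derive (0 : R) (1 : R) id (derive1 s r0 * derive1 rho 0).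
    apply: near_eq_is_derive h4; apply: filterS (open_nbhs_nbhs (conj oJ J0)) => t te.
    by rewrite /= (rhoP t te).2.
  have E1 : derive1 s r0 * derive1 rho 0 = 1 by have [_ <-] := h5; rewrite derive_id.
  have w' : derive1 w r0 = m r0 * (- f r0 ^- 2 * derive1 f r0).
    have hm := Sm_is_derive (Sm_slope sf sL) f'0.
    have hf := is_deriveV fr0 (Sm_is_derive sf (I : setT r0)).
    have [_ H] := is_deriveM hm hf; rewrite derive1E; etransitivity; first exact: H.
    by rewrite /GRing.scale/= -/m m'0 mulr0 addr0.
  have eps0 : eps != 0 by rewrite sgr_eq0.
  rewrite w' !mulf_neq0// ?oppr_eq0 ?invr_eq0 ?expf_neq0//.
  by apply: contra_eq_neq E1 => ->; rewrite mulr0 eq_sym oner_neq0.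
have [a [c [sa sc c0E vE muE]]] := cusp_coefficients e0 sv smu v'.
exists d', e, s, rho, a, c; split=> //.
- by split=> // r /d'dr/dD.
- split=> //; first by apply: Sm_sub ss => r /d'dr.
  by move=> r /d'dr/sE.
- by split=> //; rewrite c0E oppr_eq0.
move=> r cr er; have := vE _ er; have := muE _ er.
by rewrite /v /mu rhoK.
Qed.

Lemma parabolic_germ : foliation_germ L f Lam (orbit_set Lam r0 k0) (@parabolic_model R).
Proof.
have [d [e [s [rho [a [c [[d0 e0 dD] [ss s'0 s0 sE] rhoK [sa sc c0] vmu]]]]]]] := cusp_data.
have cc := cball_center r0 d0; have e20 : 0 < e ^+ 2 by rewrite exprn_gt0.
pose sigma := Num.sg (c 0).
have sigma2 : sigma * sigma = 1 by rewrite -expr2 sqr_sg c0.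
have [e1 e10 ce1] : exists2 e1, 0 < e1 & forall t, sball e1 t -> sball (e ^+ 2) t /\ 0 < sigma * c t.
  have J0 := sball0 e20.
  have n1 : nbhs (0 : R) (sball (e ^+ 2)) by apply: open_nbhs_nbhs; split => //; exact: open_sball.
  have n2 : nbhs (0 : R) [set t | 0 < sigma * c t].
    have cs : {for 0, continuous (fun t => sigma * c t)}.
      by apply: continuousM; [exact: cst_continuous|exact: Sm_cont sc J0].
    have pos : 0 < sigma * c 0 by rewrite -normrEsg normr_gt0.
    exact: (cs _ (open_nbhs_nbhs (conj (@open_gt R 0) pos))).
  have [e1 e10 H] := near_cball (filterI n1 n2); exists e1 => // t te.
  by apply: H; rewrite /cball/= subr0.
pose t k := eps * (k - k0).
pose y k r := s r ^+ 2 - t k.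
(* The second-order Taylor factor of u from s ^ 2 to t: u(t) = u(s ^ 2) - y u'(s ^ 2) + y ^ 2 D2. *)
pose D2 (u : R -> R) k r := segavg 0 (derive1 (derive1 u)) (s r ^+ 2) (t k) -
  segavg 1 (derive1 (derive1 u)) (s r ^+ 2) (t k).
(* What remains of U_k after subtracting a(t) + c(t) (s ^ 3 / 3 - t s), divided by y ^ 2; the
   expression has no denominator except f. *)
pose E k r := (2 * f r ^+ 2)^-1 - D2 a k r
  - D2 c k r * (- (2 / 3) * s r ^+ 3 + y k r * s r) + derive1 c (s r ^+ 2) * s r.
pose ee k r := E k r / c (t k).
(* An a priori bound on E / c is required to solve the cubic equation; the margin 1 makes it hold on
   a neighbourhood of the base point. *)
pose M := `|ee k0 r0| + 1.
have M0 : 0 < M by rewrite ltr_wpDl.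
have [eta [etaE seta]] := cubic_solution M0.
set q := (2 * (2 * (2 * M) + (2 * M) ^+ 2))^-1 in etaE seta.
have q0 : 0 < q by rewrite invr_gt0 mulr_gt0// addr_gt0 ?exprn_gt0// !mulr_gt0.
pose Q k r := s r + y k r * eta (s r) (y k r) (ee k r).
pose K (x : V4) := x ord0 i_pphi; pose X (x : V4) := x ord0 i_r.
pose V0 := [set x : V4 | cball r0 d (X x)].
have oV0 : open V0 by apply: open_coord; exact: open_cball.
have cS n : Cn_on n V0 (fun x => s (X x)).
  by apply: (@Cn_on_comp1 _ _ _ (cball r0 d) s X) => //; exact: Cn_on_coord.
have cT n U : open U -> Cn_on n U (fun x => t (K x)).
  move=> oU; apply: Cn_onM => //; first exact: Cn_on_cst.
  by apply: Cn_on_B => //; [exact: Cn_on_coord|exact: Cn_on_cst].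
pose W0 := (V0 `&` (fun x => s (X x)) @^-1` sball e) `&` (fun x => t (K x)) @^-1` sball e1.
have oW00 : open (V0 `&` (fun x => s (X x)) @^-1` sball e).
  exact: (open_setI_preimage oV0 (@open_sball R e) (cS 0%N)).
have oW0 : open W0.
  exact: (open_setI_preimage oW00 (@open_sball R e1) (cT 0%N _ oW00)).
have W0V x : W0 x -> V0 x by case=> -[].
have cSW n : Cn_on n W0 (fun x => s (X x)) by apply: Cn_on_sub (cS n).
have cXk n (u : V4 -> R) k U : open U -> Cn_on n U u -> Cn_on n U (fun x => u x ^+ k).
  move=> oU cu; elim: k => [|k IHk]; first exact: Cn_on_cst.
  apply: (@Cn_on_eq _ _ _ (fun x => u x * u x ^+ k)) => // [x _|]; first by rewrite exprS.
  exact: Cn_onM.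
have sqe u : sball e u -> sball (e ^+ 2) (u ^+ 2).
  by rewrite /sball/= => ue; rewrite normrX ltr_pXn2r// ?nnegrE// ltW.
have oe2 := @open_sball R (e ^+ 2); have ce2 := @sball_convex R (e ^+ 2).
have cY n : Cn_on n W0 (fun x => y (K x) (X x)).
  by apply: Cn_on_B => //; [exact: cXk|exact: cT].
have cD2 n u : Sm (sball (e ^+ 2)) u -> Cn_on n W0 (fun x => D2 u (K x) (X x)).
  move=> su; have su2 := Sm_derive1 (Sm_derive1 su).
  have cseg k : Cn_on n W0 (fun x => segavg k (derive1 (derive1 u)) (s (X x) ^+ 2) (t (K x))).
    have U'x x : W0 x -> [set p : V4 | sball (e ^+ 2) (p ord0 i_pr) /\
        sball (e ^+ 2) (p ord0 i_pphi)] (mk4 (s (X x) ^+ 2) (t (K x)) 0 0).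
      move=> [[_ sx] tx]; rewrite /= !mk4E; split; first exact: sqe.
      by have [] := ce1 _ tx.
    have H := Cn_on_comp_mk4 oW0 U'x (segavg_smooth oe2 ce2 k su2 n) (cXk _ _ 2%N _ oW0 (cSW n))
      (cT n _ oW0) (Cn_on_cst n W0 0) (Cn_on_cst n W0 0).
    apply: (Cn_on_ext _ H) => x.
    by rewrite mk4_0 mk4_1.
  by apply: Cn_on_B.
have cE n : Cn_on n W0 (fun x => E (K x) (X x)).
  have cf : Cn_on n W0 (fun x => (2 * f (X x) ^+ 2)^-1).
    apply: (@Cn_on_comp1 _ _ _ [set u | u != 0] GRing.inv (fun x => 2 * f (X x) ^+ 2)) => //.
    - move=> x /W0V/dD[xL _] /=.
      by rewrite mulf_neq0 ?expf_neq0// gt_eqF// f0.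
    - exact: Sm_inv.
    - apply: Cn_onM => //; first exact: Cn_on_cst.
      apply: cXk => //; apply: (@Cn_on_comp1 _ _ _ setT f X) => //; exact: Cn_on_coord.
  have cc' : Cn_on n W0 (fun x => derive1 c (s (X x) ^+ 2)).
    apply: (@Cn_on_comp1 _ _ _ (sball (e ^+ 2)) (derive1 c) (fun x => s (X x) ^+ 2)) => //.
    - by move=> x [[_ sx] _]; exact: sqe.
    - exact: (Sm_derive1 sc).
    - exact: cXk.
  apply: Cn_onD => //; last exact: Cn_onM.
  apply: Cn_on_B => //; first by apply: Cn_on_B => //; exact: cD2.
  apply: Cn_onM => //; first exact: cD2.
  apply: Cn_onD => //; last exact: Cn_onM.
  by apply: Cn_onM => //; [exact: Cn_on_cst|exact: cXk].
have cne u : sball e1 u -> c u != 0.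
  by move=> /ce1[_ /lt0r_neq0]; apply: contraNneq => ->; rewrite mulr0.
have sce1 : Sm (sball e1) c by apply: Sm_sub sc => u /ce1[].
have sae1 : Sm (sball e1) a by apply: Sm_sub sa => u /ce1[].
have cee n : Cn_on n W0 (fun x => ee (K x) (X x)).
  apply: Cn_onM => //.
  apply: (@Cn_on_comp1 _ _ _ [set u | u != 0] GRing.inv (fun x => c (t (K x)))) => //.
  - by move=> x [_ /cne].
  - exact: Sm_inv.
  - by apply: (@Cn_on_comp1 _ _ _ (sball e1) c (fun x => t (K x))) => // [x []//|]; exact: cT.
pose W1 := W0 `&` (fun x => s (X x)) @^-1` sball q.
have oW1 : open W1 by exact: (open_setI_preimage oW0 (@open_sball R q) (cSW 0%N)).
pose W2 := W1 `&` (fun x => y (K x) (X x)) @^-1` sball q.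
have oW2 : open W2.
  apply: (open_setI_preimage oW1 (@open_sball R q)).
  by apply: Cn_on_sub (cY 0%N) => x [].
pose W := W2 `&` (fun x => ee (K x) (X x)) @^-1` sball M.
have oW : open W.
  apply: (open_setI_preimage oW2 (@open_sball R M)).
  by apply: Cn_on_sub (cee 0%N) => x [[]].
have WW0 x : W x -> W0 x by case=> -[[]].
pose Qx (x : V4) := Q (K x) (X x).
pose nx (x : V4) := eta (s (X x)) (y (K x) (X x)) (ee (K x) (X x)).
have snx : smooth_on W nx.
  move=> n; have D'x x : W x -> [set p : V4 | [/\ `|p ord0 i_pr| < q, `|p ord0 i_pphi| < q &
      `|p ord0 i_r| < M]] (mk4 (s (X x)) (y (K x) (X x)) (ee (K x) (X x)) 0).
    by move=> [[[_ h1] h2] h3]; rewrite /= !mk4E.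
  have cS' : Cn_on n W (fun x => s (X x)) by apply: Cn_on_sub (cSW n).
  have cY' : Cn_on n W (fun x => y (K x) (X x)) by apply: Cn_on_sub (cY n).
  have cee' : Cn_on n W (fun x => ee (K x) (X x)) by apply: Cn_on_sub (cee n).
  have H := Cn_on_comp_mk4 oW D'x (seta n) cS' cY' cee' (Cn_on_cst n W 0).
  apply: (Cn_on_ext _ H) => x.
  by rewrite mk4_0 mk4_1 mk4_2.
have sQ : smooth_on W Qx.
  move=> n; apply: Cn_onD => //; first by apply: Cn_on_sub (cSW n).
  by apply: (Cn_onM oW _ (snx n)); apply: Cn_on_sub (cY n).
pose z0 : V4 := mk4 0 k0 r0 0.
have [Kz Xz] : K z0 = k0 /\ X z0 = r0 by rewrite /K /X !mk4E.
have t0 : t k0 = 0 by rewrite /t subrr mulr0.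
have y0 : y k0 r0 = 0 by rewrite /y s0 t0 expr0n subr0.
have Wz0 : W z0.
  rewrite /W /W2 /W1 /W0 /V0 /= Kz Xz s0 t0 y0; do ![split] => //; try exact: sball0.
  by rewrite /sball/= /M ltrDl.
have dW : depends_on_k_r W.
  move=> x1 x2 E1 E2; rewrite /W /W2 /W1 /W0 /V0 /=.
  by rewrite /K /X E1 E2.
(* Since 3 (q ^ 3 / 3 - t q) = q ^ 3 - 3 t q, the second model coordinate is 3 t = eps P, and C ^ 2
   = 3 / (2 |c(t)|) normalizes the leading coefficient up to the sign sigma of c. This sign is
   absorbed by taking sigma q as coordinate. *)
pose P k := 3 * (k - k0).
pose C k := Num.sqrt (3 / (2 * (sigma * c (t k)))).
pose A k := - (C k ^+ 2 * (2 * a (t k))).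
have tk k : cball k0 e1 k -> sball e1 (t k).
  by rewrite /cball/sball/t/= normrM normr_sg kap''0 mul1r.
have cpos k : cball k0 e1 k -> 0 < 3 / (2 * (sigma * c (t k))).
  by move=> /tk/ce1[_ h]; rewrite divr_gt0// mulr_gt0.
have ok := @open_cball R k0 e1.
have sT : Sm (cball k0 e1) t.
  by apply: SmM => //; [exact: Sm_cst|apply: SmB => //; [exact: Sm_id|exact: Sm_cst]].
apply: (@germ_of_normal_form R L f Lam r0 k0 e1 P C A Q (fun u p => u ^+ 3 - p * u)
   (@parabolic_model R) eps sigma W) => //.
- by move=> x /WW0/W0V/dD[].
- apply: SmM => //; first exact: Sm_cst.
  by apply: SmB => //; [exact: Sm_id|exact: Sm_cst].
- have sin : Sm (cball k0 e1) (fun k => 3 / (2 * (sigma * c (t k)))).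
    apply: SmM => //; first exact: Sm_cst.
    apply: SmV => //.
      by move=> k /tk/ce1[_ h]; rewrite gt_eqF// mulr_gt0.
    do 2![apply: SmM => //; first exact: Sm_cst].
    exact: (Sm_comp ok tk sce1 sT).
  exact: (Sm_comp ok cpos (@Sm_sqrt R) sin).
- move=> k _; have := is_deriveZ 3 (is_deriveB (is_derive_id k (1 : R)) (is_derive_cst k0 k (1 : R))).
  by rewrite derive1E => -[_ ->]; rewrite /GRing.scale/= subr0 mulr1.
- by move=> k kk; rewrite gt_eqF// sqrtr_gt0; exact: cpos.
(* At the base point y vanishes together with its r-derivative 2 s s', so Q has the same
   r-derivative as s. *)
- have dS : differentiable (fun x => s (X x)) z0 by have [+ _] := cSW 1%N; apply; exact: WW0.
  have dY : differentiable (fun x => y (K x) (X x)) z0 by have [+ _] := cY 1%N; apply; exact: WW0.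
  have dn : differentiable nx z0 by have [+ _] := snx 1%N; apply.
  have dYn : differentiable (fun x => y (K x) (X x) * nx x) z0 by exact: differentiableM.
  rewrite (_ : (fun x => _) = fun x => s (X x) + y (K x) (X x) * nx x)//.
  have dXz : differentiable X z0 by exact: differentiable_coord.
  have ds : derivable s (X z0) 1 by rewrite Xz; exact: (Sm_derivable ss).
  have pS : partial i_r (fun x => s (X x)) z0 = derive1 s r0.
    by have [_ ->] := partial_comp1 i_r dXz ds; rewrite Xz partial_coord eqxx mulr1.
  have dS2 : differentiable (fun x => s (X x) * s (X x)) z0 by exact: differentiableM.
  have dT : differentiable (fun x => - t (K x)) z0.
    by have [+ _] := Cn_on_N openT (cT 1%N setT openT); apply.
  have pT : partial i_r (fun x => - t (K x)) z0 = 0.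
    rewrite /partial /derive (_ : (fun h => _) = fun=> 0) ?lim_cst//.
    by apply/funext => h; rewrite /= /t /K !mxE/= mulr0 add0r subrr scaler0.
  have pY : partial i_r (fun x => y (K x) (X x)) z0 = 0.
    rewrite (_ : (fun x => _) = fun x => s (X x) * s (X x) + - t (K x)); last first.
      by apply/funext => x; rewrite /y expr2.
    by rewrite partialD// partialM// Xz s0 !mul0r pT !addr0.
  rewrite partialD// partialM// pS pY Kz Xz y0 mul0r mulr0 !addr0.
  exact: s'0.
- by rewrite /P subrr mulr0.
- by rewrite /Q y0 mul0r addr0.
- move=> x Wx /=; have W0x := WW0 _ Wx; have [[Vx sx] tx] := W0x.
  have [[[_ hs] hy] he] := Wx; rewrite /= in hs hy he.
  rewrite -/(K x) -/(X x); set k := K x in tx hy he *; set r := X x in Vx sx hs hy he *.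
  have [rL Dr] := dD _ Vx; have fr : f r != 0 by rewrite gt_eqF// f0.
  have [vE muE] := vmu _ Vx sx; have kE := sE _ Vx.
  have := etaE _ _ _ hs hy he; set et := eta _ _ _ => cub.
  have te2 : sball (e ^+ 2) (t k) by have [] := ce1 _ tx.
  have Ta := segavg_taylor2 ce2 sa (sqe _ sx) te2.
  have Tc := segavg_taylor2 ce2 sc (sqe _ sx) te2.
  rewrite -/(D2 a k r) in Ta; rewrite -/(D2 c k r) in Tc.
  have ctn : c (t k) != 0 by exact: cne.
  have Ec : E k r = c (t k) * cubic (s r) (y k r) et by rewrite cub /ee; field.
  (* Combines k(r) - k = eps y with k(r) - Lam = f m. *)
  have kL : k - Lam r = f r * m r - eps * y k r.
    have E1 : kap r = Lam r + f r * m r by rewrite /kap kfunE.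
    have E2 : k = k0 + eps * t k by rewrite /t mulrA eps2 mul1r addrC subrK.
    rewrite E1 in kE; rewrite {1}E2 /y mulrBr.
    by move/eqP: kE; rewrite -subr_eq => /eqP <-; ring.
  have VE : (k - Lam r) ^+ 2 / f r ^+ 2 =
      2 * (hfun f Lam r - eps * (m r / f r) * y k r + (2 * f r ^+ 2)^-1 * y k r ^+ 2).
    rewrite kL hfunE -/m.
    transitivity ((f r ^+ 2 * m r ^+ 2 - 2 * (eps * y k r) * f r * m r
       + (eps * eps) * y k r ^+ 2) / f r ^+ 2); first by congr (_ / _); ring.
    by rewrite eps2; field.
  (* Because s ^ 2 - t = y, the first-order change of q ^ 3 / 3 - t q under q = s + y eta already
     carries the factor y ^ 2. *)
  have QE : Q k r ^+ 3 / 3 - t k * Q k r = s r ^+ 3 / 3 - t k * s r +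
      y k r ^+ 2 * cubic (s r) (y k r) et.
    by rewrite /Q -/et /cubic /y; field.
  have key : (k - Lam r) ^+ 2 / f r ^+ 2 =
      2 * (a (t k) + c (t k) * (Q k r ^+ 3 / 3 - t k * Q k r)).
    have -> : c (t k) * (Q k r ^+ 3 / 3 - t k * Q k r) =
        c (t k) * (s r ^+ 3 / 3 - t k * s r) + y k r ^+ 2 * E k r.
      by rewrite QE Ec; ring.
    rewrite VE vE muE /E.
    have at' : a (t k) = a (s r ^+ 2) - y k r * derive1 a (s r ^+ 2) + y k r ^+ 2 * D2 a k r.
      move: Ta; rewrite /y => /eqP; rewrite subr_eq => /eqP; move=> /eqP; rewrite subr_eq => /eqP ->.
      by ring.
    have ct' : c (t k) = c (s r ^+ 2) - y k r * derive1 c (s r ^+ 2) + y k r ^+ 2 * D2 c k r.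
      move: Tc; rewrite /y => /eqP; rewrite subr_eq => /eqP; move=> /eqP; rewrite subr_eq => /eqP ->.
      by ring.
    have tE : t k = s r ^+ 2 - y k r by rewrite /y; ring.
    rewrite at' ct'; rewrite {1}tE.
    move: (D2 a k r) (D2 c k r) (derive1 a _) (derive1 c _) (a _) (c _) => u1 u2 u3 u4 u5 u6.
    by move: (y k r) (s r) => y1 s1; field.
  have kk : cball k0 e1 k.
    by move: tx; rewrite /= /sball /t/= normrM normr_sg kap''0 mul1r.
  have C2 : C k ^+ 2 = 3 / (2 * (sigma * c (t k))) by rewrite sqr_sqrtr// ltW// cpos.
  have sn0 : sigma != 0 by rewrite sgr_eq0.
  rewrite key /A C2.
  have -> : eps * P k = 3 * t k by rewrite /P /t; ring.
  transitivity (sigma * (Q k r ^+ 3 - 3 * t k * Q k r)).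
    transitivity (sigma * sigma * sigma * Q k r ^+ 3 - 3 * t k * (sigma * Q k r)); first by ring.
    by rewrite sigma2; ring.
  have sE1 : sigma = sigma^-1 by apply: (mulfI sn0); rewrite sigma2 divff.
  by rewrite {1}sE1; field; rewrite ctn sn0.
- move=> z; rewrite /parabolic_model; congr (_ / _, _).
  by rewrite addrA.
Qed.

End ParabolicGerm.

(** Read with r1 = rho(k), l = Lam(r), a = f(r), l1 and a1 their values at r1, and b = f'(r1). As
    Lam' = - m f' at r1, the first-order terms of the Taylor formulas for Lam and for m f cancel,
    and w differs from m by a second-order term. *)
Lemma fork_algebra (F : fieldType) (s k m r r1 l l1 a a1 b dl da : F) : a != 0 ->
  l - l1 - (r - r1) * - (m * b) = (r - r1) ^+ 2 * dl ->
  a - a1 - (r - r1) * b = (r - r1) ^+ 2 * da -> k = l1 + a1 * m ->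
  s * ((k - l) / a) = s * m - (r - r1) ^+ 2 * (s * ((dl + m * da) / a)).
Proof.
move=> a0 E1 E2 ->.
have -> : s * m - (r - r1) ^+ 2 * (s * ((dl + m * da) / a)) =
  (s * m * a - s * ((r - r1) ^+ 2 * dl + m * ((r - r1) ^+ 2 * da))) / a by field.
by rewrite -E1 -E2; field.
Qed.

(** * The elliptic fork at a horizontal tangent *)

Section ForkGerm.
Context {R : realType}.
Local Notation V4 := 'rV[R]_4.
Variables (L : R) (f Lam : R -> R) (r0 : R).
Hypothesis sf : Sm setT f.
Hypothesis sL : Sm setT Lam.
Hypothesis r0L : 0 < r0 < L.
Hypothesis f0 : forall r, 0 < r < L -> 0 < f r.
Hypothesis f'0 : derive1 f r0 != 0.
Hypothesis Lam'0 : derive1 Lam r0 = 0.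
Hypothesis Lam''0 : derive1 (derive1 Lam) r0 != 0.

Let D := [set r | derive1 f r != 0].
Let oD : open D := open_immersed sf.
Let kap := kfun f Lam.
Let m := slope f Lam.
Let k0 := kap r0.

Let good_radius : exists2 d, 0 < d & forall r, cball r0 d r -> 0 < r < L /\ D r.
Proof.
apply: near_cball; have h1 : nbhs r0 [set r | 0 < r < L].
  have -> : [set r | 0 < r < L] = `]0, L[ by apply/seteqP; split=> r /=; rewrite in_itv.
  by apply: open_nbhs_nbhs; split; [exact: itv_open|rewrite /= in_itv].
have h2 : nbhs r0 D by exact: open_nbhs_nbhs.
exact: (filterI h1 h2).
Qed.

Let m0 : m r0 = 0. Proof. by rewrite /m /slope Lam'0 oppr0 mul0r. Qed.

(** Where Lam' = 0 the inflection function reduces to f' Lam''. *)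
Let kap'0 : derive1 kap r0 != 0.
Proof.
rewrite derive1_kfun// derive1_slope// /inflection Lam'0 mulr0 subr0.
rewrite -[derive1n 2 Lam r0]/(derive1 (derive1 Lam) r0).
by rewrite !mulf_neq0// ?oppr_eq0 ?mulf_neq0// ?invr_eq0 ?expf_neq0// gt_eqF// f0.
Qed.

Let inverse_data : exists d e rho, [/\ 0 < d, 0 < e & forall r, cball r0 d r -> 0 < r < L /\ D r] /\
  [/\ Sm (cball k0 e) rho, rho k0 = r0 &
     forall k, cball k0 e k -> cball r0 d (rho k) /\ kap (rho k) = k].
Proof.
have [d d0 dD] := good_radius; have oJ := @open_cball R r0 d.
have cc := cball_center r0 d0.
have skap : Sm (cball r0 d) kap by apply: Sm_sub (Sm_kfun sf sL) => r /dD[].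
pose del := Num.sg (derive1 kap r0).
have del2 : del * del = 1 by rewrite -expr2 sqr_sg kap'0.
have sh : Sm (cball r0 d) (fun r => del * kap r) by apply: SmM => //; exact: Sm_cst.
have h'0 : 0 < derive1 (fun r => del * kap r) r0.
  have [_ H] := is_deriveZ del (Sm_is_derive skap cc).
  rewrite derive1E (_ : 'D_1 _ r0 = del * derive1 kap r0); last exact: H.
  by rewrite -normrEsg normr_gt0.
have [d' [e [inv [d'0 d'd e0 sinv [invP invK _]]]]] := local_inverse_pos d0 sh h'0.
have dk k : cball k0 e k -> cball (del * kap r0) e (del * k).
  by rewrite /cball/= -mulrBr normrM normr_sg kap'0 mul1r.
have kc := cball_center k0 e0.
have d'dr r : cball r0 d' r -> cball r0 d r by move=> h; exact: lt_le_trans d'd.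
exists d, e, (fun k => inv (del * k)); split; first by split.
have ok := @open_cball R k0 e.
have sdel : Sm (cball k0 e) (fun k => del * k).
  by apply: SmM; [exact: ok|exact: Sm_cst|exact: Sm_id].
split.
- exact: (Sm_comp ok dk sinv sdel).
- by apply: invK; [exact: cball_center|exact: cball_center].
- move=> k /dk/invP[ci hi]; split; first exact: d'dr.
  have del0 : del != 0 by rewrite sgr_eq0.
  exact: (mulfI del0).
Qed.

Lemma fork_germ : foliation_germ L f Lam (orbit_set Lam r0 k0) (@fork_model R).
Proof.
have [d [e [rho [[d0 e0 dD] [srho rho0 rhoP]]]]] := inverse_data.
(* With this sign g(k0, r0) = |Lam''(r0)| / (2 f(r0)) is positive, so g has a smooth square root
   nearby. *)
pose sigma := Num.sg (derive1 (derive1 Lam) r0).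
have sigma2 : sigma * sigma = 1 by rewrite -expr2 sqr_sg Lam''0.
have oT : open [set: R] by exact: openT.
have cvT (x y u : R) : setT x -> setT y -> 0 <= u <= 1 ->
  (setT : set R) ((1 - u) * x + u * y) by [].
pose D2 (u : R -> R) k r := segavg 0 (derive1 (derive1 u)) (rho k) r -
  segavg 1 (derive1 (derive1 u)) (rho k) r.
pose g k r := sigma * ((D2 Lam k r + m (rho k) * D2 f k r) / f r).
pose Q k r := (r - rho k) * Num.sqrt (g k r).
pose K (x : V4) := x ord0 i_pphi; pose X (x : V4) := x ord0 i_r.
pose V0 := [set x : V4 | cball r0 d (X x)] `&` [set x : V4 | cball k0 e (K x)].
have oV0 : open V0.
  by apply: openI; apply: open_coord; exact: open_cball.
have cX n U : Cn_on n U X by exact: Cn_on_coord.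
have crho n : Cn_on n V0 (fun x => rho (K x)).
  apply: (@Cn_on_comp1 _ _ _ (cball k0 e) rho K oV0 _ (srho n)); last exact: Cn_on_coord.
  by move=> x [].
have cD2 n u : Sm setT u -> Cn_on n V0 (fun x => D2 u (K x) (X x)).
  move=> su; have su2 := Sm_derive1 (Sm_derive1 su).
  have cseg k : Cn_on n V0 (fun x => segavg k (derive1 (derive1 u)) (rho (K x)) (X x)).
    have U'x x : V0 x -> [set p : V4 | (setT : set R) (p ord0 i_pr) /\
        (setT : set R) (p ord0 i_pphi)] (mk4 (rho (K x)) (X x) 0 0) by [].
    have H := Cn_on_comp_mk4 oV0 U'x (segavg_smooth oT cvT k su2 n) (crho n) (cX n V0)
      (Cn_on_cst n V0 0) (Cn_on_cst n V0 0).
    by apply: (Cn_on_ext _ H) => x; rewrite mk4_0 mk4_1.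
  by apply: (Cn_on_B oV0); exact: cseg.
have fX0 x : V0 x -> f (X x) != 0 by move=> [/dD[xL _] _]; rewrite gt_eqF// f0.
have cf n : Cn_on n V0 (fun x => (f (X x))^-1).
  apply: (@Cn_on_comp1 _ _ _ [set u | u != 0] GRing.inv (fun x => f (X x)) oV0 fX0 (@Sm_inv R n)).
  exact: (@Cn_on_comp1 _ _ _ setT f X oV0 (fun _ _ => I) (sf n) (cX n V0)).
have rhoD x : V0 x -> D (rho (K x)) by move=> [_ /rhoP[/dD[]]].
have cm n : Cn_on n V0 (fun x => m (rho (K x))).
  exact: (@Cn_on_comp1 _ _ _ D m (fun x => rho (K x)) oV0 rhoD (Sm_slope sf sL n) (crho n)).
have cg n : Cn_on n V0 (fun x => g (K x) (X x)).
  apply: (Cn_onM oV0 (Cn_on_cst n V0 sigma)); apply: (Cn_onM oV0 _ (cf n)).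
  apply: (Cn_onD oV0 (cD2 n Lam sL)); exact: (Cn_onM oV0 (cm n) (cD2 n f sf)).
pose W := V0 `&` (fun x => g (K x) (X x)) @^-1` [set t | 0 < t].
have oW : open W by exact: (open_setI_preimage oV0 (@open_gt R 0) (cg 0%N)).
have WV x : W x -> V0 x by case.
have cgW n : Cn_on n W (fun x => Num.sqrt (g (K x) (X x))).
  apply: (@Cn_on_comp1 _ _ _ [set t | 0 < t] Num.sqrt (fun x => g (K x) (X x)) oW _ (@Sm_sqrt R n)).
    by move=> x [].
  by apply: Cn_on_sub (cg n).
have crW n : Cn_on n W (fun x => X x - rho (K x)).
  by apply: (Cn_on_B oW (cX n W)); apply: Cn_on_sub (crho n).
pose z0 : V4 := mk4 0 k0 r0 0.
have [Kz Xz] : K z0 = k0 /\ X z0 = r0 by rewrite /K /X !mk4E.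
have g0 : 0 < g k0 r0.
  rewrite /g /D2 rho0 m0 mul0r addr0 (segavg_diag _ _).1 (segavg_diag _ _).2.
  have -> : sigma * ((derive1 (derive1 Lam) r0 - derive1 (derive1 Lam) r0 / 2) / f r0) =
    (sigma * derive1 (derive1 Lam) r0) / (2 * f r0).
    by field; rewrite gt_eqF// f0.
  by rewrite -normrEsg divr_gt0 ?normr_gt0// mulr_gt0// f0.
have Wz0 : W z0.
  rewrite /W /V0 /= Kz Xz; split; last exact: g0.
  by split; exact: cball_center.
have dW : depends_on_k_r W.
  by move=> x1 x2 E1 E2; rewrite /W /V0 /= /K /X E1 E2.
(* Since k' = f m', the derivative of m along the inverse of k(r) is m' / k' = 1 / f > 0; hence
   m(rho(k)) can serve as the second coordinate up to sign. *)
have mrho k : cball k0 e k -> is_derive k (1 : R) (fun k => m (rho k)) (f (rho k))^-1.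
  move=> ke; have [/dD[rL Dr] kr] := rhoP k ke.
  have h1 := is_derive1_comp (Sm_is_derive (Sm_slope sf sL) Dr) (Sm_is_derive srho ke).
  apply: (is_derive_eq h1).
  have h2 := is_derive1_comp (Sm_is_derive (Sm_kfun sf sL) Dr) (Sm_is_derive srho ke).
  have h3 : is_derive k (1 : R) id (derive1 kap (rho k) * derive1 rho k).
    apply: near_eq_is_derive h2.
    apply: filterS (open_nbhs_nbhs (conj (@open_cball R k0 e) ke)) => t te.
    exact: (rhoP t te).2.
  have E : derive1 kap (rho k) * derive1 rho k = 1 by have [_ <-] := h3; rewrite derive_id.
  have fr : f (rho k) != 0 by rewrite gt_eqF// f0.
  apply: (mulfI fr); rewrite divff// -[RHS]E (derive1_kfun sf sL Dr).
  by rewrite mulrA.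
apply: (@germ_of_normal_form R L f Lam r0 k0 e (fun k => m (rho k)) (fun=> 1)
   (fun k => - (m (rho k) ^+ 2)) Q (fun u p => u ^+ 4 - 2 * p * u ^+ 2)
   (@fork_model R) sigma 1 W e0 sL oW dW Wz0).
- by move=> x [[/dD[]]].
- have ok := @open_cball R k0 e.
  have rhoD' k : cball k0 e k -> D (rho k) by move=> /rhoP[/dD[]].
  exact: (Sm_comp ok rhoD' (Sm_slope sf sL) srho).
- by apply: Sm_cst; exact: open_cball.
- by move=> n; exact: (Cn_onM oW (crW n) (cgW n)).
- move=> k ke; have [_ H] := mrho k ke; rewrite derive1E H invr_gt0 f0//.
  by have [/dD[]] := rhoP k ke.
- by move=> k _; exact: oner_neq0.
- have dS : differentiable (fun x => X x - rho (K x)) z0 by have [+ _] := crW 1%N; apply.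
  have dg : differentiable (fun x => Num.sqrt (g (K x) (X x))) z0 by have [+ _] := cgW 1%N; apply.
  rewrite (_ : (fun x => _) = fun x => (X x - rho (K x)) * Num.sqrt (g (K x) (X x)))//.
  have dX : differentiable X z0 by exact: differentiable_coord.
  have drk : differentiable (fun x => - rho (K x)) z0.
    have [+ _] := Cn_on_N oV0 (crho 1%N); apply; exact: WV.
  have prk : partial i_r (fun x => - rho (K x)) z0 = 0.
    rewrite /partial /derive (_ : (fun h => _) = fun=> 0) ?lim_cst//.
    by apply/funext => h; rewrite /= /K !mxE/= mulr0 add0r subrr scaler0.
  have pS : partial i_r (fun x => X x - rho (K x)) z0 = 1.
    by rewrite (partialD i_r dX drk) prk partial_coord eqxx addr0.
  rewrite (partialM i_r dS dg) pS Kz Xz rho0 subrr mul0r add0r mulr1 sqrtr_gt0.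
  exact: g0.
- by rewrite rho0.
- by rewrite /Q rho0 subrr mul0r.
- exact: sigma2.
- exact: mulr1.
- move=> x Wx /=; have [[_ kx] gpos] := Wx.
  rewrite -/(K x) -/(X x); set k := K x in kx gpos *; set r := X x in gpos *.
  have [/dD[_ Dr] kE] := rhoP k kx.
  have fr : f r != 0 by apply: fX0; exact: WV.
  have TL := segavg_taylor2 cvT sL (I : setT (rho k)) (I : setT r).
  have Tf := segavg_taylor2 cvT sf (I : setT (rho k)) (I : setT r).
  rewrite -/(D2 Lam k r) in TL; rewrite -/(D2 f k r) in Tf.
  have mE : derive1 Lam (rho k) = - (m (rho k) * derive1 f (rho k)).
    have -> : m (rho k) = - derive1 Lam (rho k) / derive1 f (rho k) by [].
    by rewrite divfK// opprK.
  rewrite mE in TL; have kE2 : k = Lam (rho k) + f (rho k) * m (rho k).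
    by rewrite -[LHS]kE /kap kfunE.
  have wE : sigma * ((k - Lam r) / f r) = sigma * m (rho k) - (r - rho k) ^+ 2 * g k r.
    exact: (fork_algebra sigma fr TL Tf kE2).
  have q2 : Q k r ^+ 2 = (r - rho k) ^+ 2 * g k r by rewrite /Q exprMn sqr_sqrtr// ltW.
  have wsq : (k - Lam r) ^+ 2 / f r ^+ 2 = (Q k r ^+ 2 - sigma * m (rho k)) ^+ 2.
    have -> : Q k r ^+ 2 - sigma * m (rho k) = - (sigma * ((k - Lam r) / f r)).
      by rewrite wE q2 opprB.
    by rewrite sqrrN !exprMn exprVn [sigma ^+ 2]expr2 sigma2 mul1r.
  rewrite expr1n !mul1r wsq.
  have -> : m (rho k) ^+ 2 = (sigma * m (rho k)) ^+ 2.
    by rewrite [RHS]exprMn [sigma ^+ 2]expr2 sigma2 mul1r.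
  by ring.
- by move=> z; rewrite /fork_model; congr (_ / _, _); rewrite addrA.
Qed.

End ForkGerm.

(** * Singularities of the bifurcation curves *)

Section CurveSingularities.
Context {R : realType}.

(** Used with u = h, w = k and c = m / f. By these formulas the determinant of the second and third
    derivatives of (u, w) at x is - 2 c'(x) w''(x) ^ 2, which reduces the cusp condition to c' and
    k'' being nonzero. *)
Lemma derive123_proportional (J : set R) (u w c : R -> R) x : open J ->
  Sm J w -> Sm J c -> (forall t, J t -> derive1 u t = c t * derive1 w t) -> J x ->
  derive1 w x = 0 ->
  [/\ derive1 u x = 0, derive1n 2 u x = c x * derive1n 2 w x &
   derive1n 3 u x = 2 * derive1 c x * derive1n 2 w x + c x * derive1n 3 w x].
Proof.
move=> oJ sw sc uE Jx w0.
have D1 (a b : R -> R) : Sm J a -> Sm J b -> forall t, J t ->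
    derive1 (fun s => a s * b s) t = derive1 a t * b t + a t * derive1 b t.
  move=> sa sb t Jt; have [_ H] := is_deriveM (Sm_is_derive sa Jt) (Sm_is_derive sb Jt).
  by rewrite derive1E; etransitivity; [exact: H|rewrite addrC; congr (_ + _); exact: mulrC].
have loc (a b : R -> R) : (forall t, J t -> a t = b t) -> forall t, J t -> derive1 a t = derive1 b t.
  move=> ab t Jt; rewrite !derive1E; apply: near_eq_derive.
  by apply: filterS ab _; exact: (open_nbhs_nbhs (conj oJ Jt)).
have sw1 := Sm_derive1 sw; have sw2 := Sm_derive1 sw1; have sc1 := Sm_derive1 sc.
have u2 t : J t -> derive1 (derive1 u) t = derive1 c t * derive1 w t + c t * derive1 (derive1 w) t.
  by move=> Jt; rewrite (loc _ _ uE t Jt); exact: D1.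
have u3 : derive1 (derive1 (derive1 u)) x = derive1 (derive1 c) x * derive1 w x +
    derive1 c x * derive1 (derive1 w) x + (derive1 c x * derive1 (derive1 w) x +
    c x * derive1 (derive1 (derive1 w)) x).
  have d1 := Sm_derivable (SmM oJ sc1 sw1) Jx.
  have d2 := Sm_derivable (SmM oJ sc sw2) Jx.
  have e := deriveD d1 d2; rewrite -!derive1E in e.
  etransitivity; first exact: (loc _ _ u2 x Jx).
  etransitivity; first exact: e.
  by congr (_ + _); [exact: (D1 _ _ sc1 sw1 x Jx)|exact: (D1 _ _ sc sw2 x Jx)].
rewrite /derive1n /=; split; first by rewrite uE// w0 mulr0.
  by rewrite u2// w0 mulr0 add0r.
etransitivity; first exact: u3.
rewrite w0; move: (derive1 (derive1 c) x) (derive1 c x) (derive1 (derive1 w) x)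
  (derive1 (derive1 (derive1 w)) x) (c x) => c2 c1 w2 w3 c0.
by ring.
Qed.

Variables (L : R) (f Lam : R -> R) (r : R).
Hypothesis sf : Sm setT f.
Hypothesis sL : Sm setT Lam.
Hypothesis rL : 0 < r < L.
Hypothesis f0 : forall r, 0 < r < L -> 0 < f r.
Hypothesis f'0 : derive1 f r != 0.

Lemma gamma1_ordinary_cusp : inflection f Lam r = 0 -> derive1 (inflection f Lam) r != 0 ->
  derive1 Lam r != 0 -> ordinary_cusp (gamma1 f Lam) r.
Proof.
move=> i0 i1 L1; have [k1 k2] := curvature_kfun sf sL rL f0 f'0 i0 i1.
have fr : f r != 0 by rewrite gt_eqF// f0.
pose J := [set t | derive1 f t != 0] `&` (f @^-1` [set y : R | y != 0]).
have oJ : open J.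
  apply: openI; first exact: open_immersed.
  by apply: open_comp; [move=> t _; exact: (Sm_cont sf)|exact: open_neq].
have Jr : J r by split.
have JD : J `<=` [set t | derive1 f t != 0] by move=> t [].
pose c t := slope f Lam t * (f t)^-1.
have ssl := Sm_sub JD (Sm_slope sf sL).
have sc : Sm J c.
  apply: (SmM oJ ssl); apply: (SmV oJ); first by move=> t [].
  exact: Sm_sub sf.
have hk t : J t -> derive1 (hfun f Lam) t = c t * derive1 (kfun f Lam) t.
  move=> [Dt ft]; rewrite (derive1_hfun sf sL Dt) (derive1_kfun sf sL Dt) /c.
  by rewrite mulrA divfK.
have [h1 h2 h3] := derive123_proportional oJ (Sm_sub JD (Sm_kfun sf sL)) sc hk Jr k1.
(* As m' vanishes at the inflection, the derivative of m / f is - m f' / f ^ 2. *)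
have c'0 : derive1 c r != 0.
  have [_ H] := is_deriveM (Sm_is_derive ssl Jr) (is_deriveV fr (Sm_is_derive sf (I : setT r))).
  rewrite derive1E; have -> : 'D_1 c r = - slope f Lam r * (derive1 f r / f r ^+ 2).
    etransitivity; first exact: H.
    rewrite (derive1_slope sf sL f'0) i0 oppr0 mul0r scaler0 addr0 /GRing.scale/=.
    by rewrite mulNr mulrN mulNr [_^-1 * _]mulrC.
  have sl0 : slope f Lam r != 0 by rewrite mulf_neq0 ?oppr_eq0 ?invr_eq0.
  by rewrite mulf_neq0 ?oppr_eq0// mulf_neq0 ?invr_eq0 ?expf_neq0.
rewrite -[derive1 (derive1 _) r]/(derive1n 2 (kfun f Lam) r) in k2.
have cd n : curve_deriv (gamma1 f Lam) n r =
  (derive1n n (hfun f Lam) r, derive1n n (kfun f Lam) r) by [].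
split=> [|a b].
  by rewrite /curve_deriv; congr (_, _); [exact: h1|exact: k1].
move=> H.
have E1 : a * derive1n 2 (hfun f Lam) r + b * derive1n 3 (hfun f Lam) r = 0 := congr1 fst H.
have E2 : a * derive1n 2 (kfun f Lam) r + b * derive1n 3 (kfun f Lam) r = 0 := congr1 snd H.
rewrite h2 h3 in E1.
move: E1 E2 k2 c'0; generalize (derive1n 2 (kfun f Lam) r) (derive1n 3 (kfun f Lam) r)
  (c r) (derive1 c r) => K2 K3 C C' E1 E2 k2 c'0.
have b0 : b = 0.
  have : b * (2 * C' * K2) = 0.
    have -> : b * (2 * C' * K2) = a * (C * K2) + b * (2 * C' * K2 + C * K3) - C * (a * K2 + b * K3).
      by ring.
    by rewrite E1 E2 mulr0 subr0.
  by move/eqP; rewrite !mulf_eq0 (negbTE c'0) (negbTE k2) pnatr_eq0/= !orbF => /eqP.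
split=> //; move: E2; rewrite b0 mul0r addr0 => /eqP.
by rewrite mulf_eq0 (negbTE k2) orbF => /eqP.
Qed.

(** The common tangent is the axis h = 0: it contains [gamma2], and on [gamma1] one has h' = m m' =
    0 while k' is nonzero. *)
Lemma tangent_gamma1_gamma2 : derive1 Lam r = 0 -> derive1 (derive1 Lam) r != 0 ->
  tangent_at (gamma1 f Lam) r (gamma2 Lam) r.
Proof.
move=> L1 L2.
have fr : f r != 0 by rewrite gt_eqF// f0.
have s0 : slope f Lam r = 0 by rewrite /slope L1 oppr0 mul0r.
have k'0 : derive1 (kfun f Lam) r != 0.
  rewrite (derive1_kfun sf sL f'0) (derive1_slope sf sL f'0) /inflection L1 mulr0 subr0.
  rewrite -[derive1n 2 Lam r]/(derive1 (derive1 Lam) r).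
  by rewrite !mulf_neq0 ?oppr_eq0 ?mulf_neq0 ?invr_eq0 ?expf_neq0.
have h'0 : derive1 (hfun f Lam) r = 0 by rewrite (derive1_hfun sf sL f'0) s0 mul0r.
have hh := Sm_is_derive (Sm_hfun sf sL) f'0; have kk := Sm_is_derive (Sm_kfun sf sL) f'0.
rewrite h'0 in hh; set l := derive1 (kfun f Lam) r in kk k'0.
have eps (F : R -> R) a : is_derive r (1 : R) F a -> forall e, 0 < e ->
    \forall s \near r, `|F s - F r - (s - r) * a| <= e * `|s - r|.
  move=> [/derivable1_diffP dF aE] e e0.
  have /diff_locally/eqaddoP/(_ e e0) := dF.
  rewrite (near_shift 0 r); apply: filterS => v /=.
  rewrite !fctE /= subr0 addrK -aE opprD addrA.
  have -> : 'd F r v = v * 'D_1 F r.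
    by rewrite deriveE// -[in LHS](mulr1 v) -[v * 1]/(v *: (1 : R)) linearZ.
  by [].
(* k leaves k(r) at least linearly, so a variation of h that is o(s - r) is negligible against the
   length of the secant. *)
have kfar : \forall s \near r, `|l| / 2 * `|s - r| <= `|kfun f Lam s - kfun f Lam r|.
  have l2 : 0 < `|l| / 2 by rewrite divr_gt0 ?normr_gt0.
  apply: filterS (eps _ _ kk _ l2) => s.
  rewrite distrC => /(le_trans (lerB_dist _ _)).
  by rewrite normrM; lra.
split; first by rewrite /gamma1 /gamma2 hfunE kfunE s0 mulr0 addr0 expr0n mul0r.
exists (0, 1); split; split=> /=.
- by rewrite xpair_eqE oner_eq0 andbF.
- near=> s; apply/negP => /eqP[_ E].
  have : `|l| / 2 * `|s - r| <= `|kfun f Lam s - kfun f Lam r| by near: s; exact: nbhs_dnbhs kfar.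
  rewrite E subrr normr0 leNgt mulr_gt0 ?divr_gt0 ?normr_gt0// ?subr_eq0.
  by near: s; exact: nbhs_dnbhs_neq.
- move=> e e0; have e'0 : 0 < e * (`|l| / 2) by rewrite mulr_gt0 ?divr_gt0 ?normr_gt0.
  apply: (nbhs_dnbhs (x := r)); apply: filterS2 kfar (eps _ _ hh _ e'0) => s H2.
  rewrite mul0r sub0r mul1r normrN mulr0 subr0 => H1; apply: (le_trans H1).
  rewrite -mulrA ler_pM2l//; apply: (le_trans H2).
  by rewrite [leRHS]prod_normE le_max lexx orbT.
- by rewrite xpair_eqE oner_eq0 andbF.
(* [gamma2] has velocity zero at r, but Lam'' is nonzero, so Lam(s) differs from Lam(r) for nearby s
   and the secants are defined. *)
- have cvT (x y u : R) : setT x -> setT y -> 0 <= u <= 1 ->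
    (setT : set R) ((1 - u) * x + u * y) by [].
  have oT : open [set: R] by exact: openT.
  have s2 := Sm_derive1 (Sm_derive1 sL).
  pose g s := segavg 0 (derive1 (derive1 Lam)) r s - segavg 1 (derive1 (derive1 Lam)) r s.
  have cg : {for r, continuous g}.
    by apply: continuousB; exact: (Sm_cont (Sm_segavg _ oT cvT I s2)).
  have g0 : g r != 0.
    rewrite /g (segavg_diag _ _).1 (segavg_diag _ _).2; set y := derive1 _ _ in L2 *.
    by rewrite (_ : y - y / 2 = y / 2) ?mulf_neq0 ?invr_eq0//; field.
  have gn : \forall s \near r, g s != 0.
    exact: (cg _ (open_nbhs_nbhs (conj (@open_neq R 0) g0))).
  near=> s; apply/negP => /eqP[E].
  have := segavg_taylor2 cvT sL (I : setT r) (I : setT s).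
  rewrite L1 mulr0 E subrr subr0 -/(g s) => /esym/eqP.
  rewrite mulf_eq0 expf_eq0/= subr_eq0; apply/negP; rewrite negb_or; apply/andP; split.
    by near: s; exact: nbhs_dnbhs_neq.
  by near: s; exact: nbhs_dnbhs gn.
- by move=> e e0; near=> s; rewrite subrr mul0r mulr0 subr0 normr0 mulr_ge0// ltW.
Unshelve. all: by end_near.
Qed.

End CurveSingularities.

(** * Linearization at a critical circle *)

Section QuotientOperator.
Variables (F : fieldType) (Om A : 'M[F]_4) (a l c p1 p2 d1 d2 : F).

(** The field is arbitrary so that one computation serves both the real linearization and its
    complexification. Here a is the coefficient of H and l stands for Lam'; as operators act on row
    vectors, the rows of [A] are indexed by the coordinate of differentiation. *)
Hypothesis Om3 : forall i, Om i i_phi = [:: 0; 1; l; 0]`_i.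
Hypothesis AE : forall i j, A i j = (nth [::] [:: [:: 0; - (l * a); a; 0]; [:: a * p1; 0; 0; d1];
  [:: a * p2; 0; 0; d2]; [:: 0; 0; 0; 0]] i)`_j.

Let e3 : 'rV[F]_4 := delta_mx ord0 i_phi.
(** At a critical point both Hamiltonian fields are multiples of the angular direction. *)
Let W : 'M[F]_(1 + 1, 4) := col_mx (c *: e3) e3.
Let V := kermx (Om *m W^T).

Let sub_W (u : 'rV[F]_4) : (u <= W)%MS <-> [/\ u ord0 i_pr = 0, u ord0 i_pphi = 0 & u ord0 i_r = 0].
Proof.
have -> : (u <= W)%MS = (u <= e3)%MS.
  rewrite -addsmxE; apply/idP/idP => [/submx_trans->//|/submx_trans->//]; last exact: addsmxSr.
  by rewrite addsmx_sub submx_refl scalemx_sub.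
split=> [/sub_rVP[t ->]|[u0 u1 u2]]; first by rewrite !mxE/= !mulr0.
apply/sub_rVP; exists (u ord0 i_phi); apply/rowP; apply: ord4P; rewrite !mxE/=;
  by rewrite ?mulr0 ?mulr1.
Qed.

Let sub_V (u : 'rV[F]_4) : (u <= V)%MS <-> u ord0 i_pphi = - (l * u ord0 i_r).
Proof.
have uE : (u *m Om) ord0 i_phi = u ord0 i_pphi + l * u ord0 i_r.
  by rewrite mxE sum4E !Om3/= !mulr0 mulr1 add0r addr0 [l * _]mulrC.
have E3 : u *m Om *m e3^T = (u ord0 i_pphi + l * u ord0 i_r)%:M.
  apply/matrixP => i j; rewrite !ord1 [RHS]mxE mulr1n -uE trmx_delta.
  rewrite mxE (bigD1 i_phi)//= big1 ?addr0 => [|k kn]; rewrite [delta_mx _ _ _ _]mxE.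
    by rewrite !eqxx mulr1.
  by rewrite (negbTE kn) mulr0.
rewrite sub_kermx mulmxA tr_col_mx mul_mx_row row_mx_eq0 linearZ/= -scalemxAr E3.
split=> [/andP[_ /eqP/matrixP/(_ ord0 ord0)]|->].
  by rewrite !mxE mulr1n => /eqP; rewrite addr_eq0 => /eqP.
by rewrite addNr !raddf0 eqxx.
Qed.

Let actE (u : 'rV[F]_4) : [/\ (u *m A) ord0 i_pr = a * (p1 * u ord0 i_pphi + p2 * u ord0 i_r),
  (u *m A) ord0 i_pphi = - (l * a) * u ord0 i_pr,
  (u *m A) ord0 i_r = a * u ord0 i_pr &
  (u *m A) ord0 i_phi = d1 * u ord0 i_pphi + d2 * u ord0 i_r].
Proof.
have E j : (u *m A) ord0 j = u ord0 i_pr * A i_pr j + u ord0 i_pphi * A i_pphi j +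
    u ord0 i_r * A i_r j + u ord0 i_phi * A i_phi j.
  by rewrite mxE sum4E.
by rewrite !E !AE/=; split; ring.
Qed.

Variable U : F.
Hypothesis a0 : a != 0.
Hypothesis UE : p2 - l * p1 = - U.

Let act0 (u : 'rV[F]_4) : (u <= V)%MS -> (u *m A) ord0 i_pr = - (a * U * u ord0 i_r).
Proof.
move=> /sub_V E; have [-> _ _ _] := actE u.
have -> : U = l * p1 - p2 by rewrite -[U]opprK -UE opprB.
by rewrite E; ring.
Qed.

Lemma invertible_on_quotientP : invertible_on_quotient W V A <-> U != 0.
Proof.
split=> [[_ _ inj _]|U0].
  apply/negP => /eqP U0.
  (* The radial direction corrected so that K stays constant; it spans the kernel on the quotient
     when U = 0. *)
  pose u : 'rV[F]_4 := \row_i [:: 0; - l; 1; 0]`_i.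
  have uV : (u <= V)%MS by apply/sub_V; rewrite !mxE/= mulr1.
  have /inj : (u *m A <= W)%MS.
    apply/sub_W; rewrite (act0 uV) U0; have [_ -> -> _] := actE u.
    by rewrite !mxE/= !mulr0 mul0r oppr0.
  by move=> /(_ uV)/sub_W[_ _]; rewrite mxE/= => /eqP; rewrite oner_eq0.
split.
- apply/row_subP => i; rewrite row_mul; apply/sub_V.
  by have [_ -> -> _] := actE (row i V); rewrite mulNr mulrA.
- apply/row_subP => i; rewrite row_mul; apply/sub_W.
  have /sub_W[w0 w1 w2] : (row i W <= W)%MS by exact: row_sub.
  by have [-> -> -> _] := actE (row i W); rewrite w0 w1 w2 !mulr0 addr0 mulr0.
- move=> u uV /sub_W[]; rewrite (act0 uV); have [_ _ -> _] := actE u.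
  move=> /eqP; rewrite oppr_eq0 !mulf_eq0 (negbTE a0) (negbTE U0)/= => /eqP u2 _.
  move=> /eqP; rewrite mulf_eq0 (negbTE a0)/= => /eqP u0.
  by apply/sub_W; split=> //; have /sub_V-> := uV; rewrite u2 mulr0 oppr0.
- move=> v /sub_V vV.
  (* The p_r and r entries invert (x, y) |-> (- a U y, a x); the p_phi entry is then forced by
     membership in V. *)
  pose u : 'rV[F]_4 := \row_i [:: v ord0 i_r / a; l * v ord0 i_pr / (a * U);
    - v ord0 i_pr / (a * U); 0]`_i.
  have uV : (u <= V)%MS by apply/sub_V; rewrite !mxE/= mulrA mulrN mulNr opprK.
  exists u => //; apply/sub_W; have := act0 uV; have [_] := actE u.
  rewrite ![(_ - v) _ _]mxE ![(- v) _ _]mxE => -> -> _ ->; rewrite !mxE/= vV; split; field;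
  by rewrite ?a0 ?U0.
Qed.

Lemma quotient_eigenvalue_sqr t : quotient_eigenvalue W V A t -> t ^+ 2 = - (a ^+ 2 * U).
Proof.
move=> [u [uV /negP uW /sub_W[]]].
have := act0 uV; have [_ _] := actE u.
rewrite ![(_ - _ *: u) _ _]mxE ![(- (_ *: u)) _ _]mxE ![(_ *: u) _ _]mxE => -> _ ->.
move=> /eqP; rewrite subr_eq0 => /eqP E0 _ /eqP; rewrite subr_eq0 => /eqP E2.
have u2 : u ord0 i_r != 0.
  apply/negP => /eqP u2; apply: uW; apply/sub_W.
  move: E2; rewrite u2 mulr0 => /eqP; rewrite mulf_eq0 (negbTE a0)/= => /eqP u0.
  by split=> //; have /sub_V-> := uV; rewrite u2 mulr0 oppr0.
apply: (mulIf u2); rewrite expr2 -mulrA -E2 mulrCA -E0; ring.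
Qed.

End QuotientOperator.

Section CriticalCircles.
Context {R : realType}.
Local Notation V4 := 'rV[R]_4.

(** The Hamiltonians and the entries of their vector fields are sums of products of one-variable
    functions of two coordinates; a missing factor is taken to be 1. *)
Lemma partial_coord_mul (P Q : R -> R) j k (x : V4) p q :
  is_derive (x ord0 j) (1 : R) P p -> is_derive (x ord0 k) (1 : R) Q q ->
  differentiable (fun y : V4 => P (y ord0 j) * Q (y ord0 k)) x /\
  forall i, partial i (fun y : V4 => P (y ord0 j) * Q (y ord0 k)) x =
    (i == j)%:R * p * Q (x ord0 k) + P (x ord0 j) * ((i == k)%:R * q).
Proof.
move=> dP dQ; pose c i (y : V4) := y ord0 i.
have dc i : differentiable (c i) x by exact: differentiable_coord.
have H i := @partial_comp1 R P (c j) x i (dc j) (@ex_derive _ _ _ _ _ _ _ dP).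
have H' i := @partial_comp1 R Q (c k) x i (dc k) (@ex_derive _ _ _ _ _ _ _ dQ).
have dPc := (H ord0).1; have dQc := (H' ord0).1.
split; first exact: (differentiableM dPc dQc).
move=> i; rewrite (partialM i dPc dQc) (H i).2 (H' i).2 !partial_coord !derive1E.
rewrite (derive_val (is_derive := dP)) (derive_val (is_derive := dQ)) /= /c; ring.
Qed.

Variables (f Lam : R -> R).
Hypothesis sf : Sm setT f.
Hypothesis sL : Sm setT Lam.

Let f' := Sm_derive1 sf.
Let L' := Sm_derive1 sL.

Lemma mul_Omega (u x : V4) : u *m Omega Lam x =
  mk4 (- u ord0 i_r) (- u ord0 i_phi) (u ord0 i_pr - derive1 Lam (x ord0 i_r) * u ord0 i_phi)
    (u ord0 i_pphi + derive1 Lam (x ord0 i_r) * u ord0 i_r).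
Proof.
apply/rowP; apply: ord4P; rewrite mxE sum4E mk4E !mxE/=; ring.
Qed.

Lemma Omega_unit x : Omega Lam x \in unitmx.
Proof.
rewrite -row_free_unit; apply: inj_row_free => v /rowP H.
have := H i_pr; have := H i_pphi; have := H i_r; have := H i_phi.
rewrite mul_Omega !mk4E !mxE => H3 H2 /eqP; rewrite oppr_eq0 => /eqP v3 /eqP.
rewrite oppr_eq0 => /eqP v2; move: H3 H2; rewrite v2 v3 !mulr0 subr0 addr0 => v1 v0.
by apply/rowP; apply: ord4P; rewrite ?v0 ?v1 ?v2 ?v3 mxE.
Qed.

Lemma hamvfE (G : V4 -> R) x : hamvf Lam G x =
  mk4 (- partial i_r G x + derive1 Lam (x ord0 i_r) * partial i_pphi G x)
    (- partial i_phi G x - derive1 Lam (x ord0 i_r) * partial i_pr G x)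
    (partial i_pr G x) (partial i_pphi G x).
Proof.
set X := mk4 _ _ _ _; rewrite /hamvf.
suff -> : - grad G x = X *m Omega Lam x by rewrite mulmxK// Omega_unit.
apply/rowP => j; rewrite mul_Omega; move: j; apply: ord4P;
  by rewrite mk4E /X !mk4E ![(- grad G x) _ _]mxE ![grad _ _ _ _]mxE; ring.
Qed.

(** With p = k - Lam, which is p_phi on the phase space, U_k' = - (p ^ 2 F1 + p F2), and p F3 is the
    angular velocity of the flow of H. *)
Let F1 (r : R) : R := derive1 f r / f r ^+ 3.
Let F2 (r : R) : R := derive1 Lam r / f r ^+ 2.
Let F3 (r : R) : R := (f r ^+ 2)^-1.

Let J := [set r | f r != 0].
Let oJ : open J.
Proof.
have -> : J = f @^-1` [set y : R | y != 0] by [].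
by apply: open_comp; [move=> t _; exact: (Sm_cont sf)|exact: open_neq].
Qed.

Let sub u : Sm setT u -> Sm J u. Proof. exact: Sm_sub. Qed.

Let sFn n : Sm J (fun r => (f r ^+ n)^-1).
Proof.
apply: (SmV oJ); first by move=> r Jr; exact: expf_neq0.
exact: (SmX _ oJ (sub sf)).
Qed.

Let sF1 : Sm J F1. Proof. exact: (SmM oJ (sub f') (sFn 3)). Qed.
Let sF2 : Sm J F2. Proof. exact: (SmM oJ (sub L') (sFn 2)). Qed.
Let sF3 : Sm J F3. Proof. exact: sFn. Qed.

Lemma partial_combination a b (x : V4) : f (x ord0 i_r) != 0 ->
  differentiable (fun y => a * Ham f y + b * Kint Lam y) x /\
  forall i, partial i (fun y => a * Ham f y + b * Kint Lam y) x =
    mk4 (a * x ord0 i_pr) (a * (x ord0 i_pphi * F3 (x ord0 i_r)) + b)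
      (- (a * (x ord0 i_pphi ^+ 2 * F1 (x ord0 i_r))) + b * derive1 Lam (x ord0 i_r)) 0 ord0 i.
Proof.
move=> fx; set r := x ord0 i_r in fx *.
have d0 : is_derive (x ord0 i_pr) (1 : R) (fun t => a * (t ^+ 2 / 2)) (a * x ord0 i_pr).
  have := is_deriveZ a (is_deriveZ 2^-1 (is_derive_sqr (x ord0 i_pr))) => h.
  rewrite (_ : (fun _ => _) = a \*: (2^-1 \*: (fun t : R => t ^+ 2))); last first.
    by apply/funext => t /=; congr (_ * _); exact: mulrC.
  by apply: (is_derive_eq h); rewrite /GRing.scale/=; field.
have d1 : is_derive (x ord0 i_pr) (1 : R) (fun=> 1 : R) 0 by exact: is_derive_cst.
have d2 : is_derive (x ord0 i_pphi) (1 : R) (fun t => a * t ^+ 2) (2 * a * x ord0 i_pphi).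
  have h := is_deriveZ a (is_derive_sqr (x ord0 i_pphi)).
  by apply: (is_derive_eq h); rewrite /GRing.scale/=; ring.
have d3 : is_derive r (1 : R) (fun r => (2 * f r ^+ 2)^-1) (- F1 r).
  have fx2 : (f ^+ 2) r != 0 by exact: (expf_neq0 2 fx).
  have h := is_deriveV fx2 (is_deriveX 2 (Sm_is_derive sf (I : setT r))).
  have h' := is_deriveZ 2^-1 h.
  rewrite (_ : (fun _ => _) = 2^-1 \*: (fun y => ((f ^+ 2) y)^-1)); last first.
    by apply/funext => t /=; rewrite invfM.
  apply: (is_derive_eq h'); rewrite /GRing.scale/= expr1 /F1.
  have -> : (f ^+ 2) r = f r ^+ 2 by [].
  by field.
have dL := Sm_is_derive sL (I : setT r).
have d4 : is_derive r (1 : R) (fun t => b * Lam t) (b * derive1 Lam r) by exact: is_deriveZ.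
have d5 : is_derive (x ord0 i_pphi) (1 : R) (fun t => b * t) b.
  by have h := is_deriveZ b (is_derive_id (x ord0 i_pphi) (1 : R));
    apply: (is_derive_eq h); exact: mulr1.
have [D0 P0] := partial_coord_mul (j := i_pr) (k := i_pr) d0 d1.
have [D1 P1] := partial_coord_mul (j := i_pphi) (k := i_r) d2 d3.
have c1 : is_derive r (1 : R) (fun=> 1 : R) 0 by exact: is_derive_cst.
have c2 : is_derive (x ord0 i_pphi) (1 : R) (fun=> 1 : R) 0 by exact: is_derive_cst.
have [D2 P2] := partial_coord_mul (j := i_pphi) (k := i_pphi) d5 c2.
have [D3 P3] := partial_coord_mul (j := i_r) (k := i_r) d4 c1.
have D01 := differentiableD D0 D1; have D012 := differentiableD D01 D2.
rewrite (_ : (fun y => a * Ham f y + b * Kint Lam y) = fun y : V4 =>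
   a * (y ord0 i_pr ^+ 2 / 2) * 1 + a * y ord0 i_pphi ^+ 2 * (2 * f (y ord0 i_r) ^+ 2)^-1 +
   b * y ord0 i_pphi * 1 + b * Lam (y ord0 i_r) * 1); last first.
  by apply/funext => y; rewrite /Ham /Kint !mulr1 !mulrDr !mulrA !addrA.
split; first exact: (differentiableD D012 D3).
move=> i; rewrite (partialD i D012 D3) (partialD i D01 D2) (partialD i D0 D1).
rewrite P0 P1 P2 P3; move: i; apply: ord4P; rewrite mk4E/=.
- by ring.
- by rewrite /F3; field.
- by ring.
- by ring.
Qed.

Let is_derive_quadratic (w : R -> R) r (w' : R) : J r -> is_derive r (1 : R) w w' ->
  is_derive r (1 : R) (fun t => w t ^+ 2 * F1 t + w t * F2 t)
    ((2 * w r * F1 r + F2 r) * w' + (w r ^+ 2 * derive1 F1 r + w r * derive1 F2 r)).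
Proof.
move=> Jr dw; have d1 := Sm_is_derive sF1 Jr; have d2 := Sm_is_derive sF2 Jr.
have h := is_deriveD (is_deriveM (is_deriveX 2 dw) d1) (is_deriveM dw d2).
apply: (is_derive_eq h); rewrite /GRing.scale/= expr1.
by rewrite -[(w ^+ 2) r]/(w r ^+ 2); ring.
Qed.

Lemma linearizationE a b (x : V4) : f (x ord0 i_r) != 0 -> x ord0 i_pr = 0 ->
  let r := x ord0 i_r in let p := x ord0 i_pphi in
  forall i j, linearization f Lam a b x i j =
    (nth [::] [:: [:: 0; - (derive1 Lam r * a); a; 0];
       [:: a * (2 * p * F1 r + F2 r); 0; 0; a * F3 r];
       [:: a * (p ^+ 2 * derive1 F1 r + p * derive1 F2 r); 0; 0; a * p * derive1 F3 r];
       [:: 0; 0; 0; 0]] i)`_j.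
Proof.
move=> fx x0 r p; pose X := hamvf Lam (fun y => a * Ham f y + b * Kint Lam y).
(* The Hamiltonian field where f does not vanish, with each entry arranged for
   [partial_coord_mul]. *)
pose E (y : V4) : V4 := mk4
  (a * y ord0 i_pphi ^+ 2 * F1 (y ord0 i_r) + a * y ord0 i_pphi * F2 (y ord0 i_r))
  (- a * y ord0 i_pr * derive1 Lam (y ord0 i_r)) (a * y ord0 i_pr * 1)
  (a * y ord0 i_pphi * F3 (y ord0 i_r) + b * 1).
have nJ : nbhs x [set y : V4 | J (y ord0 i_r)].
  by apply: open_nbhs_nbhs; split=> //; exact: open_coord.
have XE j : \forall y \near x, E y ord0 j = X y ord0 j.
  apply: filterS nJ => y /= fy; rewrite /X hamvfE; have [_ P] := partial_combination a b fy.
  rewrite !P !mk4E /E; congr (_ _ _); congr mk4; rewrite /F1 /F2 /F3; (field; by rewrite ?fy).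
pose T := (nth [::] [:: [:: 0; - (derive1 Lam r * a); a; 0];
       [:: a * (2 * p * F1 r + F2 r); 0; 0; a * F3 r];
       [:: a * (p ^+ 2 * derive1 F1 r + p * derive1 F2 r); 0; 0; a * p * derive1 F3 r];
       [:: 0; 0; 0; 0]]).
have HE j : differentiable (fun y => E y ord0 j) x /\
    forall i, partial i (fun y => E y ord0 j) x = (T i)`_j.
  have ext (u w : V4 -> R) (t : 'I_4 -> R) : u = w -> differentiable w x /\ (forall i, partial i w x = t i) ->
    differentiable u x /\ (forall i, partial i u x = t i) by move=> ->.
  have dl c s : is_derive s (1 : R) (fun t : R => c * t) c.
    by have h := is_deriveZ c (is_derive_id s (1 : R)); apply: (is_derive_eq h); exact: mulr1.
  have d2 : is_derive p (1 : R) (fun t => a * t ^+ 2) (2 * a * p).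
    have h := is_deriveZ a (is_derive_sqr p).
    by apply: (is_derive_eq h); rewrite /GRing.scale/=; ring.
  have c1 c s : is_derive s (1 : R) (fun=> c : R) 0 by exact: is_derive_cst.
  move: j; apply: ord4P.
  - have [D0 P0] := partial_coord_mul (j := i_pphi) (k := i_r) d2 (Sm_is_derive sF1 fx).
    have [D1 P1] := partial_coord_mul (j := i_pphi) (k := i_r) (dl a p) (Sm_is_derive sF2 fx).
    apply: (ext _ (fun y : V4 => a * y ord0 i_pphi ^+ 2 * F1 (y ord0 i_r) +
      a * y ord0 i_pphi * F2 (y ord0 i_r))).
      by apply/funext => y; rewrite mk4E.
    split; first exact: (differentiableD D0 D1).
    move=> i; rewrite (partialD i D0 D1) P0 P1; move: i; apply: ord4P; rewrite /T/= -/r -/p; ring.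
  - have [D0 P0] := partial_coord_mul (j := i_pr) (k := i_r) (dl (- a) _) (Sm_is_derive L' (I : setT r)).
    apply: (ext _ (fun y : V4 => - a * y ord0 i_pr * derive1 Lam (y ord0 i_r))).
      by apply/funext => y; rewrite mk4E.
    split=> // i; rewrite P0 x0; move: i; apply: ord4P; rewrite /T/= -/r; ring.
  - have [D0 P0] := partial_coord_mul (j := i_pr) (k := i_pr) (dl a _) (c1 1 (x ord0 i_pr)).
    apply: (ext _ (fun y : V4 => a * y ord0 i_pr * 1)).
      by apply/funext => y; rewrite mk4E.
    split=> // i; rewrite P0; move: i; apply: ord4P; rewrite /T/=; ring.
  - have [D0 P0] := partial_coord_mul (j := i_pphi) (k := i_r) (dl a p) (Sm_is_derive sF3 fx).
    have [D1 P1] := partial_coord_mul (j := i_pphi) (k := i_r) (c1 b p) (c1 1 r).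
    apply: (ext _ (fun y : V4 => a * y ord0 i_pphi * F3 (y ord0 i_r) + b * 1)).
      by apply/funext => y; rewrite mk4E.
    split; first exact: (differentiableD D0 D1).
    move=> i; rewrite (partialD i D0 D1) P0 P1; move: i; apply: ord4P; rewrite /T/= -/r -/p; ring.
have HX j := near_eq_differentiable (XE j) (HE j).1.
have dX : differentiable X x by apply: differentiable_row => j; exact: (HX j).1.
move=> i j; rewrite /linearization -/X /jacobian mxE diff_coord//.
by rewrite -deriveE; [rewrite -/(partial i _ x) (HX j).2 (HE j).2|exact: (HX j).1].
Qed.

Let derive1_Ueff k r : J r ->
  derive1 (Ueff f Lam k) r = - ((k - Lam r) ^+ 2 * F1 r + (k - Lam r) * F2 r).
Proof.
move=> fr; have dL := Sm_is_derive sL (I : setT r); have df := Sm_is_derive sf (I : setT r).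
have fx2 : (f ^+ 2) r != 0 by exact: (expf_neq0 2 fr).
have dw := is_deriveX 2 (is_deriveB (is_derive_cst k r (1 : R)) dL).
have [_ H] := is_deriveM dw (is_deriveZ 2^-1 (is_deriveV fx2 (is_deriveX 2 df))).
rewrite (_ : Ueff f Lam k = (cst k - Lam) ^+ 2 * (2^-1 \*: (fun y => ((f ^+ 2) y)^-1))); last first.
  by apply/funext => t; rewrite /Ueff invfM.
rewrite derive1E H /GRing.scale/= !expr1 sub0r /F1 /F2.
have -> : ((cst k - Lam) ^+ 2) r = (k - Lam r) ^+ 2 by [].
have -> : (cst k - Lam) r = k - Lam r by [].
have -> : (f ^+ 2) r = f r ^+ 2 by [].
rewrite /GRing.scale/=; by field.
Qed.

Let derive2_Ueff k r : J r -> derive1 (derive1 (Ueff f Lam k)) r =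
  (2 * (k - Lam r) * F1 r + F2 r) * derive1 Lam r -
  ((k - Lam r) ^+ 2 * derive1 F1 r + (k - Lam r) * derive1 F2 r).
Proof.
move=> Jr; have dL := Sm_is_derive sL (I : setT r).
have [_ H] := is_deriveN (is_derive_quadratic Jr (is_deriveB (is_derive_cst k r (1 : R)) dL)).
transitivity ('D_1 (- (fun t => (cst k - Lam) t ^+ 2 * F1 t + (cst k - Lam) t * F2 t)) r).
  rewrite derive1E; apply: near_eq_derive.
  by apply: filterS (open_nbhs_nbhs (conj oJ Jr)) => t Jt; exact: derive1_Ueff.
rewrite H -[(cst k - Lam) r]/(k - Lam r); ring.
Qed.

Let kfunB r : kfun f Lam r - Lam r = f r * slope f Lam r.
Proof. by rewrite kfunE addrC addKr. Qed.

Lemma derive1_Ueff_kfun r : derive1 f r != 0 -> f r != 0 -> derive1 (Ueff f Lam (kfun f Lam r)) r = 0.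
Proof.
move=> Dr fr; rewrite derive1_Ueff// kfunB /F1 /F2 /slope; field.
by rewrite fr Dr.
Qed.

Lemma derive2_Ueff_kfun r : derive1 f r != 0 -> f r != 0 ->
  derive1 (derive1 (Ueff f Lam (kfun f Lam r))) r =
  - derive1 (kfun f Lam) r * derive1 Lam r / f r ^+ 2.
Proof.
move=> Dr fr; have dL := Sm_is_derive sL (I : setT r).
have dk := Sm_is_derive (Sm_kfun sf sL) Dr.
have [_ H] := is_derive_quadratic fr (is_deriveB dk dL).
(* This expression is - U_{k(r)}'(r), zero for all nearby r. Comparing its derivative along the
   curve with the one at fixed k leaves only the term in k'(r). *)
have H0 : 'D_1 (fun t => (kfun f Lam - Lam) t ^+ 2 * F1 t + (kfun f Lam - Lam) t * F2 t) r = 0.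
  rewrite -(derive_cst (0 : R) r (1 : R)); apply: near_eq_derive.
  have oDJ : open ([set t | derive1 f t != 0] `&` J) by apply: openI oJ; exact: open_immersed.
  apply: filterS (open_nbhs_nbhs (conj oDJ (conj Dr fr))) => t [Dt ft].
  have := derive1_Ueff (kfun f Lam t) ft.
  rewrite (derive1_Ueff_kfun Dt ft) => /esym/eqP; rewrite oppr_eq0 => /eqP E0.
  exact: E0.
rewrite derive2_Ueff//; move: H; rewrite H0 => /esym/eqP.
rewrite -[(kfun f Lam - Lam) r]/(kfun f Lam r - Lam r) addrC addr_eq0 => /eqP ->.
rewrite opprK -mulrDr [derive1 Lam r + _]addrC subrK kfunB /F1 /F2 /slope; field.
by rewrite fr Dr.
Qed.

Lemma Ueff_Lam r : f r != 0 -> derive1 (Ueff f Lam (Lam r)) r = 0 /\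
  derive1 (derive1 (Ueff f Lam (Lam r))) r = derive1 Lam r ^+ 2 / f r ^+ 2.
Proof.
move=> fr; rewrite derive2_Ueff// derive1_Ueff// subrr; split; first by ring.
by rewrite /F2; field.
Qed.

(** The p_phi component of dH = c dK forces c = p_phi / f ^ 2, and the r component then becomes the
    condition U' = 0. *)
Let Wmx_critical (x : V4) : f (x ord0 i_r) != 0 -> x ord0 i_pr = 0 ->
  derive1 (Ueff f Lam (Kint Lam x)) (x ord0 i_r) = 0 ->
  let c := x ord0 i_pphi * F3 (x ord0 i_r) in
  [/\ Wmx f Lam x = col_mx (c *: delta_mx ord0 i_phi) (delta_mx ord0 i_phi),
   grad (Ham f) x = c *: grad (Kint Lam) x & grad (Kint Lam) x ord0 i_pphi = 1].
Proof.
move=> fx x0; rewrite derive1_Ueff// [Kint _ _]/Kint addrK => /eqP; rewrite oppr_eq0 => /eqP U0; set c := _ * F3 _.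
have [_ PH] := partial_combination 1 0 fx; have [_ PK] := partial_combination 0 1 fx.
rewrite (_ : (fun y => _) = Ham f) in PH; last by apply/funext => y; rewrite mul1r mul0r addr0.
rewrite (_ : (fun y => _) = Kint Lam) in PK; last by apply/funext => y; rewrite mul1r mul0r add0r.
rewrite /Wmx !hamvfE !PH !PK !mk4E; split.
- congr col_mx; apply/rowP; apply: ord4P; rewrite mk4E !mxE/= ?x0 ?mulr0 ?mulr1; try ring.
  + by rewrite -U0 /F1 /F2 /F3; field.
  + by rewrite /c; ring.
- apply/rowP => i; rewrite !mxE PH PK; move: i; apply: ord4P; rewrite !mk4E ?x0; try (rewrite /c; ring).
  apply/eqP; rewrite -subr_eq0 -oppr_eq0; apply/eqP; rewrite -[RHS]U0 /c /F1 /F2 /F3; by field.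
- by rewrite mxE PK mk4E mul0r add0r.
Qed.

Lemma nondegenerate_criterion (x : V4) : f (x ord0 i_r) != 0 -> x ord0 i_pr = 0 ->
  derive1 (Ueff f Lam (Kint Lam x)) (x ord0 i_r) = 0 ->
  let U := derive1 (derive1 (Ueff f Lam (Kint Lam x))) (x ord0 i_r) in
  [/\ Defs.nondegenerate f Lam x <-> U != 0, 0 < U -> elliptic f Lam x & U < 0 -> hyperbolic f Lam x].
Proof.
move=> fx x0 U'0 U; have [WE gE gK] := Wmx_critical fx x0 U'0.
set r := x ord0 i_r in fx U'0 U *; set c := _ * _ in WE gE.
pose p := x ord0 i_pphi.
have gK0 : grad (Kint Lam) x != 0.
  by apply/eqP => /rowP/(_ i_pphi); rewrite gK mxE => /eqP; rewrite oner_eq0.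
have rk : rank_dF f Lam x = 1%N.
  rewrite /rank_dF gE -addsmxE (_ : (_ + _ :=: grad (Kint Lam) x)%MS); last first.
    by apply: addsmx_idPr; exact: scalemx_sub.
  by rewrite rank_rV gK0.
pose l := derive1 Lam r.
pose p1 := 2 * p * F1 r + F2 r; pose p2 := p ^+ 2 * derive1 F1 r + p * derive1 F2 r.
have pE : Kint Lam x - Lam r = p by rewrite /Kint addrK.
have UE : p2 - l * p1 = - U.
  by rewrite /U derive2_Ueff// pE opprB mulrC.
have Om3 i : Omega Lam x i i_phi = [:: 0; 1; l; 0]`_i.
  by move: i; apply: ord4P; rewrite !mxE/= /l -/r; ring.
have lin a b := @linearizationE a b x fx x0.
(* Since dK is nonzero, every admissible pair has a nonzero, so the criterion is the same for all of
   them. *)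
have ab a b : (a, b) != (0, 0) -> a *: grad (Ham f) x + b *: grad (Kint Lam) x = 0 -> a != 0.
  rewrite gE scalerA -scalerDl => n0 /eqP; rewrite scaler_eq0 (negbTE gK0) orbF => /eqP E.
  apply: contraNneq n0 => a0; move: E; rewrite a0 mul0r add0r => ->.
  by rewrite eqxx.
have inv a b : a != 0 ->
    invertible_on_quotient (Wmx f Lam x) (Wperp f Lam x) (linearization f Lam a b x) <-> U != 0.
  move=> a0; rewrite /Wperp WE; exact: (invertible_on_quotientP c Om3 (lin a b) a0 UE).
have c10 : (1, - c) != (0, 0) :> R * R by rewrite xpair_eqE oner_eq0.
have nd : U != 0 -> nondegenerate_for f Lam x 1 (- c).
  move=> U0; split=> //; last by apply/inv; rewrite ?oner_eq0.
  by rewrite gE scale1r scaleNr subrr.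
have ev t : eigenvalue_for f Lam x 1 (- c) t -> t ^+ 2 = - (U%:C)%C.
  pose phi := real_complex R.
  have WC : complexify (Wmx f Lam x) = col_mx (phi c *: delta_mx ord0 i_phi) (delta_mx ord0 i_phi).
    by rewrite /complexify WE map_col_mx map_mxZ map_delta_mx.
  have VC : complexify (Wperp f Lam x) =
      kermx (map_mx phi (Omega Lam x) *m (complexify (Wmx f Lam x))^T).
    by rewrite /complexify /Wperp map_kermx map_mxM map_trmx.
  rewrite /eigenvalue_for VC WC => et.
  have OC i : map_mx phi (Omega Lam x) i i_phi = [:: 0; 1; phi l; 0]`_i.
    by rewrite mxE Om3; move: i; apply: ord4P => /=; rewrite ?rmorph0 ?rmorph1.
  have AC i j : complexify (linearization f Lam 1 (- c) x) i j =
      (nth [::] [:: [:: 0; - (phi l * 1); 1; 0]; [:: 1 * phi p1; 0; 0; 1 * phi (F3 r)];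
        [:: 1 * phi p2; 0; 0; 1 * phi p * phi (derive1 F3 r)]; [:: 0; 0; 0; 0]] i)`_j.
    rewrite mxE lin -/r -/p -/p1 -/p2 -/l; move: i j; apply: ord4P; apply: ord4P => /=;
      by rewrite ?rmorph0 ?rmorphN ?rmorphM ?rmorph1.
  have UC : phi p2 - phi l * phi p1 = - phi U by rewrite -rmorphM -rmorphB UE rmorphN.
  have := quotient_eigenvalue_sqr OC AC (oner_neq0 R[i]) UC et.
  by rewrite expr1n mul1r.
(* A square root of the real number - U has vanishing real or imaginary part, and the sign of U
   tells which. *)
have re y z : eigenvalue_for f Lam x 1 (- c) (y +i* z)%C -> y ^+ 2 - z ^+ 2 = - U /\ y * z = 0.
  move=> /ev; rewrite expr2 => /eqP; rewrite eq_complex /= => /andP[/eqP h1 /eqP h2].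
  rewrite !expr2 h1; split=> //; move: h2; rewrite oppr0 [z * y]mulrC -mulr2n => /eqP.
  by rewrite mulrn_eq0 /= => /eqP.
split.
- split=> [[_ [a [b [n0 g0 /inv]]]]|/nd H]; first by apply; exact: ab n0 g0.
  by split=> //; exists 1, (- c).
- move=> U0; split=> //; exists 1, (- c); split; first by apply: nd; rewrite gt_eqF.
  move=> [y z] /re[E /eqP]; rewrite mulf_eq0 => /orP[/eqP//|/eqP z0].
  have := sqr_ge0 y; move: E; rewrite z0 expr0n subr0 => ->.
  by rewrite oppr_ge0 leNgt U0.
- move=> U0; split=> //; exists 1, (- c); split; first by apply: nd; rewrite lt_eqF.
  move=> [y z] /re[E /eqP]; rewrite mulf_eq0 => /orP[/eqP y0|/eqP//].
  have := sqr_ge0 z; rewrite -[z ^+ 2]opprK -[- z ^+ 2]add0r.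
  move: E; rewrite y0 expr0n => ->; rewrite opprK leNgt U0 //.
Qed.

End CriticalCircles.

(** * Types of the critical circles of the magnetic flow *)

Lemma momentum_critical_orbit (R : realType) (f Lam : R -> R) r : f r != 0 ->
  momentum f Lam @` orbit_set Lam r (kfun f Lam r) = [set gamma1 f Lam r].
Proof.
move=> fr; have E (x : 'rV[R]_4) : orbit_set Lam r (kfun f Lam r) x -> momentum f Lam x = gamma1 f Lam r.
  move=> [x0 xk xr]; rewrite /momentum /gamma1 xk; congr (_, _).
  have p : x ord0 i_pphi = f r * slope f Lam r.
    by move: xk; rewrite /Kint xr kfunE addrC => /addrI.
  by rewrite /Ham hfunE x0 xr p expr0n mul0r add0r; field.
apply/seteqP; split=> [_ [x xO <-]|_ ->]; first exact: E.
pose x : 'rV[R]_4 := mk4 0 (f r * slope f Lam r) r 0.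
have xO : orbit_set Lam r (kfun f Lam r) x by rewrite /orbit_set /= /Kint /x !mk4E kfunE addrC.
by exists x => //; exact: E.
Qed.

Theorem theorem3p7 (R : realType) (L : R) (f Lam : R -> R)
    (L_gt0 : 0 < L) (pregen : pregeneric L f Lam) :
  [/\ forall r : R, 0 < r < L -> derive1 f r != 0 ->
        let k := kfun f Lam in
        let O := orbit_set Lam r (k r) in
        let U'' := derive1n 2 (Ueff f Lam (k r)) r in
        [/\ [<-> orbit_nondegenerate f Lam O;
                 U'' != 0;
                 derive1 k r * derive1 Lam r != 0;
                 inflection f Lam r * derive1 Lam r != 0],
            0 < U'' -> orbit_elliptic f Lam O,
            U'' < 0 -> orbit_hyperbolic f Lam O
          & U'' != 0 ->
              Num.sg U'' = Num.sg (- derive1 k r * derive1 Lam r) /\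
              Num.sg U'' = Num.sg (inflection f Lam r * derive1 Lam r)],
      forall r : R, 0 < r < L ->
        let O := orbit_set Lam r (Lam r) in
        O `<=` C1Lam L Lam `\` (C1Lam L Lam `&` C1k L f Lam) ->
        orbit_nondegenerate f Lam O /\ orbit_elliptic f Lam O
    & generic L f Lam ->
      forall r : R, 0 < r < L -> derive1 f r != 0 ->
        let O := orbit_set Lam r (kfun f Lam r) in
        [/\ ~ orbit_nondegenerate f Lam O ->
              inflection f Lam r = 0 \/ derive1 Lam r = 0,
            inflection f Lam r = 0 ->
              [/\ ~ orbit_nondegenerate f Lam O,
                  momentum f Lam @` O = [set gamma1 f Lam r],
                  ordinary_cusp (gamma1 f Lam) r
                & parabolic_orbit L f Lam O]
          & derive1 Lam r = 0 ->
              [/\ ~ orbit_nondegenerate f Lam O,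
                  O = orbit_set Lam r (Lam r) /\
                    O `<=` C1k L f Lam `&` C1Lam L Lam,
                  momentum f Lam @` O = [set gamma1 f Lam r],
                  tangent_at (gamma1 f Lam) r (gamma2 Lam) r
                & asymmetric_elliptic_fork L f Lam O]]].
Proof.
case: pregen => f0 sf _ _ sL _ _ _ _ fM LM imm.
move/smooth1_Sm in sf; move/smooth1_Sm in sL.
have frn0 r : 0 < r < L -> f r != 0 by move=> /f0/gt_eqF->.
have crit r : 0 < r < L -> derive1 f r != 0 -> forall x, orbit_set Lam r (kfun f Lam r) x ->
    [/\ Defs.nondegenerate f Lam x <-> derive1n 2 (Ueff f Lam (kfun f Lam r)) r != 0,
      0 < derive1n 2 (Ueff f Lam (kfun f Lam r)) r -> elliptic f Lam x &
      derive1n 2 (Ueff f Lam (kfun f Lam r)) r < 0 -> hyperbolic f Lam x].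
  move=> rL Dr x [x0 xk xr].
  have := @nondegenerate_criterion R f Lam sf sL x; rewrite xk xr x0.
  by apply=> //; [exact: frn0|exact: (derive1_Ueff_kfun sf sL Dr (frn0 r rL))].
have nonempty r : orbit_set Lam r (kfun f Lam r) (mk4 0 (f r * slope f Lam r) r 0).
  by rewrite /orbit_set /= /Kint !mk4E kfunE addrC.
have orbP r : 0 < r < L -> derive1 f r != 0 ->
    orbit_nondegenerate f Lam (orbit_set Lam r (kfun f Lam r)) <->
    derive1n 2 (Ueff f Lam (kfun f Lam r)) r != 0.
  move=> rL Dr; split=> [/(_ _ (nonempty r))|U0 x xO].
    by have [H _ _] := crit r rL Dr _ (nonempty r) => /H.
  by have [H _ _] := crit r rL Dr _ xO; apply/H.
have U2E r : 0 < r < L -> derive1 f r != 0 -> derive1n 2 (Ueff f Lam (kfun f Lam r)) r =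
    - derive1 (kfun f Lam) r * derive1 Lam r / f r ^+ 2.
  by move=> rL Dr; exact: (derive2_Ueff_kfun sf sL Dr (frn0 r rL)).
have kE r : derive1 f r != 0 ->
    derive1 (kfun f Lam) r = - (f r * (inflection f Lam r / derive1 f r ^+ 2)).
  by move=> Dr; rewrite (derive1_kfun sf sL Dr) (derive1_slope sf sL Dr) mulNr mulrN.
have sgE r : 0 < r < L -> derive1 f r != 0 ->
    Num.sg (derive1n 2 (Ueff f Lam (kfun f Lam r)) r) = Num.sg (- derive1 (kfun f Lam) r * derive1 Lam r) /\
    Num.sg (derive1n 2 (Ueff f Lam (kfun f Lam r)) r) = Num.sg (inflection f Lam r * derive1 Lam r).
  move=> rL Dr; have fr := f0 r rL.
  have E1 : Num.sg (derive1n 2 (Ueff f Lam (kfun f Lam r)) r) =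
      Num.sg (- derive1 (kfun f Lam) r * derive1 Lam r).
    by rewrite U2E// sgrM [X in _ * X]gtr0_sg ?mulr1// invr_gt0 exprn_gt0.
  split=> //; rewrite E1 kE// opprK mulrC mulrCA sgrM gtr0_sg// mul1r mulrA.
  rewrite sgrM [X in _ * X]gtr0_sg ?mulr1 1?[_ * derive1 Lam r]mulrC//.
  by rewrite invr_gt0 lt_def expf_neq0//= sqr_ge0.
have sg0 (x y : R) : Num.sg x = Num.sg y -> (x != 0) = (y != 0) by move=> E; rewrite -sgr_eq0 E sgr_eq0.
split.
- move=> r rL Dr k O U''; have [s1 s2] := sgE r rL Dr.
  split.
  + have H1 := sg0 _ _ s1; have H2 := sg0 _ _ s2; rewrite mulNr oppr_eq0 in H1.
    tfae.
    * by move/(orbP r rL Dr).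
    * by rewrite H1.
    * by rewrite -H1 H2.
    * by rewrite -H2 => /(orbP r rL Dr).
  + by move=> U0 x xO; have [_ H _] := crit r rL Dr x xO; exact: H.
  + by move=> U0 x xO; have [_ _ H] := crit r rL Dr x xO; exact: H.
  + by [].
- move=> r rL O Osub.
  have main x : O x -> Defs.nondegenerate f Lam x /\ elliptic f Lam x.
    move=> xO; have [x0 xk xr] := xO; have [_ nC] := Osub x xO.
    (* If Lam' vanished, the immersion condition would give f' nonzero, hence k(r) = Lam(r), and the
       circle would belong to both families. *)
    have L1 : derive1 Lam r != 0.
      apply/negP => /eqP L0; apply: nC; split; first by exists r.
      have Dr : derive1 f r != 0.
        apply/negP => /eqP f1; have := imm r; rewrite L0 f1 expr0n addr0 ltxx => H.
        by suff : false by []; apply: H; case/andP: rL => /ltW -> /ltW ->.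
      by exists r => //; rewrite kfunE /slope L0 oppr0 mul0r mulr0 addr0.
    have fr := frn0 r rL.
    have [U1 U2] := Ueff_Lam sf sL fr.
    have [] := @nondegenerate_criterion R f Lam sf sL x; rewrite ?xr ?xk//.
    have U0 : 0 < derive1 (derive1 (Ueff f Lam (Lam r))) r.
      by rewrite U2 divr_gt0// lt_def expf_neq0//= sqr_ge0.
    by move=> H1 H2 _; split; [apply/H1; rewrite gt_eqF|exact: H2].
  by split=> x /main[].
- move=> [_ gen] r rL Dr O; have fr := frn0 r rL.
  have r0L : 0 <= r <= L by case/andP: rL => /ltW -> /ltW ->.
  have nd : orbit_nondegenerate f Lam O <-> inflection f Lam r * derive1 Lam r != 0.
    by rewrite -(sg0 _ _ (sgE r rL Dr).2); exact: orbP.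
  split.
  + move=> /nd/negP; rewrite negbK mulf_eq0 => /orP[/eqP ->|/eqP ->]; [by left|by right].
  + move=> i0.
    (* If Lam' vanished too, the inflection function would equal f' Lam'', which is nonzero because
       Lam is Morse; so the two degenerate types exclude each other. *)
    have L1 : derive1 Lam r != 0.
      apply/negP => /eqP L1; move: i0; rewrite /inflection L1 mulr0 subr0 => /eqP.
      by rewrite mulf_eq0 (negbTE Dr) /= (negbTE (LM r r0L L1)).
    have i1 := gen r r0L i0.
    split.
    * by move/nd; rewrite i0 mul0r eqxx.
    * exact: momentum_critical_orbit.
    * exact: (gamma1_ordinary_cusp sf sL rL f0 Dr i0 i1 L1).
    * exact: (parabolic_germ sf sL rL f0 Dr i0 i1 L1).
  + move=> L1; have L2 := LM r r0L L1.
    have kL : kfun f Lam r = Lam r by rewrite kfunE /slope L1 oppr0 mul0r mulr0 addr0.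
    split.
    * by move/nd; rewrite L1 mulr0 eqxx.
    * by split; [rewrite /O kL|move=> x xO; split; exists r; rewrite -?kL].
    * exact: momentum_critical_orbit.
    * exact: (tangent_gamma1_gamma2 sf sL rL f0 Dr L1 L2).
    * exact: (fork_germ sf sL rL f0 Dr L1 L2).
Qed.
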